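(* Let $i\in\mathbb{N}_0$ and let $\alpha,\beta\in\mathbb{C}$. Then $$F^{1:1;3}_{1:0;2}\left[\begin{matrix}\alpha: & \alpha+\beta-i\,; & i-\alpha,\ 1+\tfrac12\alpha,\ \tfrac{\alpha-\beta}{2}\,;\\ \beta: & -\,; & \tfrac12\alpha,\ 1+\tfrac{\alpha+\beta}{2}\,;\end{matrix}\ -1,\ -1\right] =\frac{\Gamma(-\alpha)\,\Gamma\!\left(1+\frac{\alpha+\beta}{2}\right)}{\Gamma(i-\alpha)\,\Gamma\!\left(\frac12\beta+\frac32\alpha-i+1\right)}\sum_{r=0}^{i}(-1)^r\binom{i}{r}\frac{\Gamma\!\left(\frac14\beta+\frac34\alpha+\frac{r+1-i}{2}\right)}{\Gamma\!\left(\frac14\beta-\frac14\alpha+\frac{r+1-i}{2}\right)}$$ and $$F^{1:1;3}_{1:0;2}\left[\begin{matrix}\alpha: & \alpha+\beta+i\,; & -\alpha-i,\ 1+\tfrac12\alpha,\ \tfrac{\alpha-\beta}{2}\,;\\ \beta: & -\,; & \tfrac12\alpha,\ 1+\tfrac{\alpha+\beta}{2}\,;\end{matrix}\ -1,\ -1\right] =\frac{\Gamma\!\left(1+\frac{\alpha+\beta}{2}\right)}{\Gamma\!\left(\frac12\beta+\frac32\alpha+i+1\right)}\sum_{r=0}^{i}\binom{i}{r}\frac{\Gamma\!\left(\frac14\beta+\frac34\alpha+\frac{r+1+i}{2}\right)}{\Gamma\!\left(\frac14\beta-\frac14\alpha+\frac{r+1-i}{2}\right)}.$$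
   Context: For $\lambda\in\mathbb{C}$ and $n\in\mathbb{N}_0$, $(\lambda)_0=1$ and $(\lambda)_n=\lambda(\lambda+1)\cdots(\lambda+n-1)$; $\Gamma$ is Euler's Gamma function and $\binom{i}{r}$ the binomial coefficient. The (generalized) Kampé de Fériet function is defined by $$F^{H:A;B}_{G:C;D}\left[\begin{matrix}(h_H): & (a_A)\,; & (b_B)\,;\\ (g_G): & (c_C)\,; & (d_D)\,;\end{matrix}\ x,\ y\right]=\sum_{m=0}^\infty\sum_{n=0}^\infty\frac{\prod_{j=1}^H(h_j)_{m+n}\prod_{j=1}^A(a_j)_m\prod_{j=1}^B(b_j)_n}{\prod_{j=1}^G(g_j)_{m+n}\prod_{j=1}^C(c_j)_m\prod_{j=1}^D(d_j)_n}\frac{x^m}{m!}\frac{y^n}{n!},$$ where a dash ''$-$'' denotes an empty list of parameters (empty products equal $1$). Parameters are tacitly assumed to be such that the double series converges, no denominator parameter is a non-positive integer, and all Gamma values appearing are finite. *)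

(* Defs.v *)
From Stdlib Require Import Reals List Arith.
From Coquelicot Require Export Coquelicot.
Export ListNotations.
Open Scope R_scope.
Open Scope C_scope.

Fixpoint Cpown (x : C) (n : nat) : C :=
  match n with O => 1 | S k => Cpown x k * x end.

Fixpoint poch (a : C) (n : nat) : C :=
  match n with O => 1 | S k => poch a k * (a + RtoC (INR k)) end.

Definition prodpoch (l : list C) (n : nat) : C :=
  fold_right (fun p acc => poch p n * acc) 1 l.

(* general term of the Kampe de Feriet double series
   F^{H:A;B}_{G:C;D}[(h):(a);(b);(g):(c);(d); x, y] *)
Definition kdf_term (h a b g c d : list C) (x y : C) (m n : nat) : C :=
  (prodpoch h (m + n) * prodpoch a m * prodpoch b n)
  / (prodpoch g (m + n) * prodpoch c m * prodpoch d n)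
  * (Cpown x m / RtoC (INR (fact m)))
  * (Cpown y n / RtoC (INR (fact n))).

Definition double_series (u : nat -> nat -> C) (S : C) : Prop :=
  exists s : nat -> C,
    (forall m, is_series (fun n => u m n) (s m)) /\ is_series s S.

(* n^z = exp(z ln n) for a positive integer n and complex z *)
Definition npowC (n : nat) (z : C) : C :=
  let t := ln (INR n) in
  RtoC (exp (Re z * t)) * (cos (Im z * t), sin (Im z * t)).

(* Euler's limit formula: Gamma(z) = lim n! n^z / (z (z+1) ... (z+n)) *)
Definition euler_seq (z : C) (n : nat) : C :=
  RtoC (INR (fact n)) * npowC n z / poch z (S n).

(* Euler's Gamma function on C (valid away from the poles 0,-1,-2,...) *)
Definition CGamma (z : C) : C :=
  @lim C_CompleteNormedModule (filtermap (euler_seq z) eventually).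

Definition not_pole (z : C) : Prop := forall k : nat, z <> RtoC (- INR k).

Definition binomC (i r : nat) : C := RtoC (Binomial.C i r).

(* Main.v *)
Require Import Defs.
From Stdlib Require Import Reals List Arith Factorial Lra Lia Psatz.
From Coquelicot Require Import Coquelicot.
Open Scope R_scope.
Open Scope C_scope.

(** Write c = 1 + (alpha + beta)/2 and let iota be i in the first identity and
    -i in the second.  By the Saalschütz sum the terms with m + n = N add up to
    the N-th coefficient of (1 - z) 2F1(alpha + 1, c + alpha - iota; c; z) at
    z = -1.  The hypothesis only gives conditional convergence of the iterated
    sum, and the resulting single series may even diverge, so the two are
    compared through Abel means: Euler's summation method, which turns
    sum (-1)^m (e)_m/m! mu_m into a series with ratio 1/2 built from the iterated
    differences of mu (Pfaff's transformation), gives bounds that are uniform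
    up to x = 1.  Hence the sum is 2^(-alpha) 2F1(iota - alpha, alpha + 1; c; 1/2).
    Contiguity relations reduce this to Bailey's series 2F1(1 - b, b; c; 1/2),
    which obeys a first-order recurrence in c with step 2 and is evaluated by
    letting c tend to infinity in Euler's limit for Gamma. *)

(** * Sequences and series of complex numbers *)

(** The double series is the sum over m of (-1)^m (e)_m/m! times the sum over n of w(m,n), with e =
    alpha + beta - iota, and w depends on m only through (alpha)_{m+n}/(beta)_{m+n}. Differences of
    order j in m therefore multiply w(0,n) by a constant and by the weight [lam] beta j n. Size and
    variation of these weights are bounded uniformly in j, so convergence of the single row m = 0
    controls, through summation by parts, every difference for every x in [0,1]; this is why
    conditional convergence is enough. The pair 1 + alpha/2 over alpha/2 contributes the factor 1 +
    2n/alpha, which is what produces the polynomial 1 - z on the diagonals. At the point 1/2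
    everything is written with 1/Gamma, which has no poles: the contiguity relations run through
    values such as c - i, which may be poles although c is not. The recurring rate 5/4 is just a q >
    1 with q^2 < 2: one factor q for a Pochhammer quotient, one for a difference, against 2^(-n),
    leaving 25/32. *)

Definition cv (u : nat -> C) (l : C) : Prop :=
  forall eps : R, (0 < eps)%R ->
  exists N, forall n, (N <= n)%nat -> (Cmod (u n - l) < eps)%R.

Lemma cv_ext_from (N0 : nat) (u v : nat -> C) (l : C) :
  (forall n, (N0 <= n)%nat -> u n = v n) -> cv u l -> cv v l.
Proof.
  intros E H eps He; destruct (H eps He) as [N HN].
  exists (max N N0); intros n Hn; rewrite <- E by lia; apply HN; lia.
Qed.

Lemma cv_ext (u v : nat -> C) (l : C) :
  (forall n, u n = v n) -> cv u l -> cv v l.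
Proof. intros E; apply (cv_ext_from 0); auto. Qed.

Lemma cv_eq (u : nat -> C) (l m : C) : l = m -> cv u l -> cv u m.
Proof. now intros ->. Qed.

Lemma cv_const (l : C) : cv (fun _ => l) l.
Proof.
  intros eps He; exists O; intros n _.
  replace (l - l) with (RtoC 0) by ring; now rewrite Cmod_0.
Qed.

Lemma cv_plus (u v : nat -> C) (l m : C) :
  cv u l -> cv v m -> cv (fun n => u n + v n) (l + m).
Proof.
  intros Hu Hv eps He.
  destruct (Hu (eps / 2)%R ltac:(lra)) as [N1 H1].
  destruct (Hv (eps / 2)%R ltac:(lra)) as [N2 H2].
  exists (max N1 N2); intros n Hn.
  replace (u n + v n - (l + m)) with ((u n - l) + (v n - m)) by ring.
  eapply Rle_lt_trans; [apply Cmod_triangle|].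
  specialize (H1 n ltac:(lia)); specialize (H2 n ltac:(lia)); lra.
Qed.

Lemma cv_of_le (u : nat -> C) (l : C) (v : nat -> R) :
  (forall n, (Cmod (u n - l) <= v n)%R) -> is_lim_seq v 0 -> cv u l.
Proof.
  intros H Hv eps He.
  apply is_lim_seq_spec in Hv; destruct (Hv (mkposreal eps He)) as [N HN].
  exists N; intros n Hn; specialize (HN n Hn); simpl in HN.
  specialize (H n); rewrite Rminus_0_r in HN.
  eapply Rle_lt_trans; [exact H|]. eapply Rle_lt_trans; [apply Rle_abs|exact HN].
Qed.

Lemma cv_bounded (u : nat -> C) (l : C) :
  cv u l -> exists B, (0 <= B)%R /\ forall n, (Cmod (u n) <= B)%R.
Proof.
  intros H; destruct (H 1%R Rlt_0_1) as [N HN].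
  assert (HB : forall M, exists B, (0 <= B)%R /\
            forall n, (n < M)%nat -> (Cmod (u n) <= B)%R).
  { induction M as [|M [B [HB0 HB]]].
    - exists 0%R; split; [lra|intros; lia].
    - exists (Rmax B (Cmod (u M))); split.
      + eapply Rle_trans; [exact HB0|apply Rmax_l].
      + intros n Hn; destruct (Nat.eq_dec n M) as [->|]; [apply Rmax_r|].
        eapply Rle_trans; [apply HB; lia|apply Rmax_l]. }
  destruct (HB N) as [B [HB0 HB1]].
  exists (Rmax B (Cmod l + 1)); split.
  - eapply Rle_trans; [exact HB0|apply Rmax_l].
  - intros n; destruct (Nat.lt_ge_cases n N) as [Hn|Hn].
    + eapply Rle_trans; [apply HB1; lia|apply Rmax_l].
    + eapply Rle_trans; [|apply Rmax_r].
      specialize (HN n Hn).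
      replace (u n) with (l + (u n - l)) by ring.
      eapply Rle_trans; [apply Cmod_triangle|lra].
Qed.

Lemma cv_mult (u v : nat -> C) (l m : C) :
  cv u l -> cv v m -> cv (fun n => u n * v n) (l * m).
Proof.
  intros Hu Hv eps He.
  destruct (cv_bounded u l Hu) as [B [HB0 HB]].
  assert (Hm := Cmod_ge_0 m).
  assert (HQ : (0 < B + Cmod m + 1)%R) by lra.
  assert (Hd : (0 < eps / (B + Cmod m + 1))%R) by (apply Rdiv_lt_0_compat; lra).
  destruct (Hu _ Hd) as [N1 H1]; destruct (Hv _ Hd) as [N2 H2].
  exists (max N1 N2); intros n Hn.
  replace (u n * v n - l * m) with (u n * (v n - m) + (u n - l) * m) by ring.
  eapply Rle_lt_trans; [apply Cmod_triangle|].
  rewrite !Cmod_mult.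
  specialize (H1 n ltac:(lia)); specialize (H2 n ltac:(lia)); specialize (HB n).
  set (d := (eps / (B + Cmod m + 1))%R) in *.
  assert (E : eps = (d * (B + Cmod m + 1))%R) by (unfold d; field; lra).
  assert (Cmod (u n) * Cmod (v n - m) <= B * d)%R.
  { apply Rmult_le_compat; try apply Cmod_ge_0; lra. }
  assert (Cmod (u n - l) * Cmod m <= d * Cmod m)%R.
  { apply Rmult_le_compat_r; lra. }
  nra.
Qed.

Lemma cv_scal (a : C) (u : nat -> C) (l : C) :
  cv u l -> cv (fun n => a * u n) (a * l).
Proof. intros H; apply cv_mult; [apply cv_const|exact H]. Qed.

Lemma cv_minus (u v : nat -> C) (l m : C) :
  cv u l -> cv v m -> cv (fun n => u n - v n) (l - m).
Proof.
  intros Hu Hv; replace (l - m) with (l + (-1) * m) by ring.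
  eapply cv_ext; [|apply cv_plus; [exact Hu|apply cv_scal; exact Hv]].
  intros n; simpl; ring.
Qed.

Lemma cv_unique (u : nat -> C) (l m : C) : cv u l -> cv u m -> l = m.
Proof.
  intros Hl Hm.
  assert (E : l - m = 0).
  { apply Cmod_eq_0; apply Rle_antisym; [|apply Cmod_ge_0].
    apply le_epsilon; intros eps He.
    destruct (Hl (eps / 2)%R ltac:(lra)) as [N1 H1].
    destruct (Hm (eps / 2)%R ltac:(lra)) as [N2 H2].
    specialize (H1 (max N1 N2) ltac:(lia)); specialize (H2 (max N1 N2) ltac:(lia)).
    set (w := u (max N1 N2)) in *.
    replace (l - m) with ((w - m) + - (w - l)) by ring.
    eapply Rle_trans; [apply Cmod_triangle|]; rewrite Cmod_opp; lra. }
  replace l with ((l - m) + m) by ring; rewrite E; ring.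
Qed.

Lemma cv_subseq (phi : nat -> nat) (u : nat -> C) (l : C) :
  (forall n, (n <= phi n)%nat) -> cv u l -> cv (fun n => u (phi n)) l.
Proof.
  intros Hp H eps He; destruct (H eps He) as [N HN].
  exists N; intros n Hn; apply HN; specialize (Hp n); lia.
Qed.

Lemma cv_succ (u : nat -> C) (l : C) : cv (fun n => u (S n)) l -> cv u l.
Proof.
  intros H eps He; destruct (H eps He) as [N HN].
  exists (S N); intros [|n] Hn; [lia|]; apply HN; lia.
Qed.

Lemma cv_Cmod_le (u : nat -> C) (l : C) (B : R) :
  cv u l -> (forall n, (Cmod (u n) <= B)%R) -> (Cmod l <= B)%R.
Proof.
  intros H HB; apply le_epsilon; intros eps He.
  destruct (H eps He) as [N HN]; specialize (HN N ltac:(lia)); specialize (HB N).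
  replace l with (u N + - (u N - l)) by ring.
  eapply Rle_trans; [apply Cmod_triangle|]; rewrite Cmod_opp; lra.
Qed.

Lemma is_lim_seq_geom_scal (K q : R) :
  (0 <= q < 1)%R -> is_lim_seq (fun n => (K * q ^ n)%R) 0.
Proof.
  intros Hq; replace (Finite 0) with (Rbar_mult K 0)
    by (simpl; now rewrite Rmult_0_r).
  apply is_lim_seq_scal_l, is_lim_seq_geom; rewrite Rabs_pos_eq; lra.
Qed.

(** * Finite sums *)

Fixpoint csum (f : nat -> C) (n : nat) : C :=
  match n with O => 0 | S k => csum f k + f k end.

Fixpoint rsum (f : nat -> R) (n : nat) : R :=
  match n with O => 0%R | S k => (rsum f k + f k)%R end.

Lemma csum_ext (f g : nat -> C) (n : nat) :
  (forall k, (k < n)%nat -> f k = g k) -> csum f n = csum g n.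
Proof.
  induction n as [|n IH]; intros H; [reflexivity|simpl].
  rewrite IH by (intros; apply H; lia); rewrite H by lia; reflexivity.
Qed.

Lemma csum_plus (f g : nat -> C) (n : nat) :
  csum (fun k => f k + g k) n = csum f n + csum g n.
Proof. induction n as [|n IH]; simpl; [ring|rewrite IH; ring]. Qed.

Lemma csum_minus (f g : nat -> C) (n : nat) :
  csum (fun k => f k - g k) n = csum f n - csum g n.
Proof. induction n as [|n IH]; simpl; [ring|rewrite IH; ring]. Qed.

Lemma csum_scal (a : C) (f : nat -> C) (n : nat) :
  csum (fun k => a * f k) n = a * csum f n.
Proof. induction n as [|n IH]; simpl; [ring|rewrite IH; ring]. Qed.

Lemma csum_telescope (X : nat -> C) (n : nat) :
  csum (fun k => X (S k) - X k) n = X n - X O.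
Proof. induction n as [|n IH]; simpl; [ring|rewrite IH; ring]. Qed.

Lemma csum_head (f : nat -> C) (n : nat) :
  csum f (S n) = f O + csum (fun k => f (S k)) n.
Proof.
  induction n as [|n IH]; [simpl; ring|].
  change (csum f (S (S n))) with (csum f (S n) + f (S n)).
  rewrite IH; simpl; ring.
Qed.

Lemma rsum_ext (f g : nat -> R) (n : nat) :
  (forall k, f k = g k) -> rsum f n = rsum g n.
Proof. intros H; induction n as [|n IH]; simpl; [|rewrite IH, H]; auto. Qed.

Lemma rsum_le (f g : nat -> R) (n : nat) :
  (forall k, (k < n)%nat -> (f k <= g k)%R) -> (rsum f n <= rsum g n)%R.
Proof.
  induction n as [|n IH]; intros H; simpl; [lra|].
  assert (f n <= g n)%R by (apply H; lia).
  assert (rsum f n <= rsum g n)%R by (apply IH; intros; apply H; lia); lra.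
Qed.

Lemma rsum_scal (a : R) (f : nat -> R) (n : nat) :
  rsum (fun k => (a * f k)%R) n = (a * rsum f n)%R.
Proof. induction n as [|n IH]; simpl; [ring|rewrite IH; ring]. Qed.

Lemma rsum_const (a : R) (n : nat) : rsum (fun _ => a) n = (INR n * a)%R.
Proof. induction n as [|n IH]; [simpl; ring|simpl rsum; rewrite IH, S_INR; ring]. Qed.

Lemma rsum_geom_le (q : R) (n : nat) :
  (0 <= q < 1)%R -> (rsum (fun k => (q ^ k)%R) n <= / (1 - q))%R.
Proof.
  intros Hq.
  assert (E : (rsum (fun k => (q ^ k)%R) n * (1 - q) = 1 - q ^ n)%R)
    by (induction n as [|n IH]; simpl; [ring|rewrite Rmult_plus_distr_r, IH; ring]).
  assert (0 <= q ^ n)%R by (apply pow_le; lra).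
  apply (Rmult_le_reg_r (1 - q)); [lra|]; rewrite E, Rinv_l; lra.
Qed.

Lemma Cmod_csum_le (f : nat -> C) (g : nat -> R) (n : nat) :
  (forall k, (k < n)%nat -> (Cmod (f k) <= g k)%R) ->
  (Cmod (csum f n) <= rsum g n)%R.
Proof.
  induction n as [|n IH]; intros H; simpl; [rewrite Cmod_0; lra|].
  eapply Rle_trans; [apply Cmod_triangle|].
  apply Rplus_le_compat; [apply IH; intros; apply H; lia|apply H; lia].
Qed.

(** * Convergent series and exchange of limits *)

Definition hassum (f : nat -> C) (l : C) : Prop := cv (csum f) l.

Lemma sum_n_csum (f : nat -> C) (n : nat) : sum_n f n = csum f (S n).
Proof.
  induction n as [|n IH].
  - rewrite sum_O; simpl; ring.
  - rewrite sum_Sn, IH; reflexivity.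
Qed.

Lemma cv_filterlim (u : nat -> C) (l : C) :
  cv u l <-> filterlim u eventually (@locally C_NormedModule l).
Proof.
  split.
  - intros H; apply filterlim_locally_ball_norm; intros eps.
    destruct (H eps (cond_pos eps)) as [N HN]; exists N; exact HN.
  - intros H eps He.
    apply (proj1 (@filterlim_locally_ball_norm C_AbsRing nat C_NormedModule _ _ u l)
             H (mkposreal eps He)).
Qed.

Lemma is_series_hassum (f : nat -> C) (l : C) :
  is_series f l <-> hassum f l.
Proof.
  unfold is_series; rewrite <- cv_filterlim; split; intros H.
  - apply cv_succ; eapply cv_ext; [|exact H]; intros n; apply sum_n_csum.
  - eapply cv_ext; [intros n; symmetry; apply sum_n_csum|].
    apply (cv_subseq S (csum f)); [intros; lia|exact H].
Qed.

(** Coquelicot's [lim] is total and specified only on Cauchy proper filters; convergence makes the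
    filter Cauchy, and uniqueness of limits identifies the value. This is the access to [CGamma],
    which is defined by [lim]. *)
Lemma lim_cv (u : nat -> C) (l : C) :
  cv u l -> @lim C_CompleteNormedModule (filtermap u eventually) = l.
Proof.
  intros H; apply cv_filterlim in H.
  set (F := filtermap u eventually).
  assert (PF : ProperFilter F) by (apply filtermap_proper_filter, eventually_filter).
  apply (@is_filter_lim_unique C_AbsRing C_NormedModule F _).
  - assert (Hc : @cauchy C_CompleteNormedModule F).
    { intros eps; exists l; apply H, locally_ball. }
    intros P [eps HP].
    refine (filter_imp _ P HP _).
    exact (@complete_cauchy C_CompleteNormedModule F PF Hc eps).
  - exact H.
Qed.

(** Total, hence meaningful only for convergent series; having the sum as a function names the sums
    of whole families of series at once. *)
Definition tsum (f : nat -> C) : C :=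
  @lim C_CompleteNormedModule (filtermap (csum f) eventually).

Lemma tsum_hassum (f : nat -> C) : (exists l, hassum f l) -> hassum f (tsum f).
Proof. intros [l Hl]; unfold tsum; now rewrite (lim_cv _ l Hl). Qed.

Lemma hassum_ext (f g : nat -> C) (l : C) :
  (forall n, f n = g n) -> hassum f l -> hassum g l.
Proof. intros E; apply cv_ext; intros n; apply csum_ext; auto. Qed.

Lemma hassum_unique (f : nat -> C) (l m : C) : hassum f l -> hassum f m -> l = m.
Proof. apply cv_unique. Qed.

Lemma hassum_plus (f g : nat -> C) (l m : C) :
  hassum f l -> hassum g m -> hassum (fun n => f n + g n) (l + m).
Proof.
  intros Hf Hg; eapply cv_ext; [intros n; symmetry; apply csum_plus|].
  now apply cv_plus.
Qed.

Lemma hassum_minus (f g : nat -> C) (l m : C) :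
  hassum f l -> hassum g m -> hassum (fun n => f n - g n) (l - m).
Proof.
  intros Hf Hg; eapply cv_ext; [intros n; symmetry; apply csum_minus|].
  now apply cv_minus.
Qed.

Lemma hassum_scal (a : C) (f : nat -> C) (l : C) :
  hassum f l -> hassum (fun n => a * f n) (a * l).
Proof.
  intros Hf; eapply cv_ext; [intros n; symmetry; apply csum_scal|].
  now apply cv_scal.
Qed.

Lemma hassum_shift (f : nat -> C) (l : C) :
  hassum (fun n => f (S n)) l -> hassum f (f O + l).
Proof.
  intros H; apply cv_succ.
  eapply cv_ext; [intros n; symmetry; apply csum_head|].
  apply cv_plus; [apply cv_const|exact H].
Qed.

Lemma ex_hassum_bounded (f : nat -> C) (B : R) :
  (forall N, (rsum (fun n => Cmod (f n)) N <= B)%R) -> exists l, hassum f l.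
Proof.
  intros HB.
  assert (Hs : forall n, sum_n (fun k => Cmod (f k)) n = rsum (fun k => Cmod (f k)) (S n)).
  { induction n as [|n IH]; [rewrite sum_O; simpl; ring|].
    rewrite sum_Sn, IH; reflexivity. }
  assert (Hex : ex_series (fun n => Cmod (f n))).
  { destruct (ex_finite_lim_seq_incr (sum_n (fun k => Cmod (f k))) B) as [l Hl].
    - intros n; rewrite !Hs; simpl; assert (H := Cmod_ge_0 (f (S n))); lra.
    - intros n; rewrite Hs; apply HB.
    - exists l; exact Hl. }
  destruct (@ex_series_le C_AbsRing C_CompleteNormedModule f _
              (fun n => Rle_refl _) Hex) as [l Hl].
  exists l; apply is_series_hassum; exact Hl.
Qed.

Lemma rsum_Cmod_geom_le (f : nat -> C) (K q : R) (n : nat) :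
  (0 <= q < 1)%R -> (0 <= K)%R -> (forall n, (Cmod (f n) <= K * q ^ n)%R) ->
  (rsum (fun k => Cmod (f k)) n <= K / (1 - q))%R.
Proof.
  intros Hq HK H; eapply Rle_trans; [apply rsum_le; intros; apply H|].
  rewrite rsum_scal; apply Rmult_le_compat_l; [exact HK|now apply rsum_geom_le].
Qed.

Lemma geom_bound_pos (f : nat -> C) (K q : R) :
  (forall n, (Cmod (f n) <= K * q ^ n)%R) -> (0 <= K)%R.
Proof. intros H; specialize (H O); assert (G := Cmod_ge_0 (f O)); simpl in H; lra. Qed.

Lemma ex_hassum_geom (f : nat -> C) (K q : R) :
  (0 <= q < 1)%R -> (forall n, (Cmod (f n) <= K * q ^ n)%R) ->
  exists l, hassum f l.
Proof.
  intros Hq H; apply (ex_hassum_bounded f (K / (1 - q))).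
  intros N; apply rsum_Cmod_geom_le; auto; eapply geom_bound_pos; eauto.
Qed.

Lemma csum_add (f : nat -> C) (n m : nat) :
  csum f (n + m) = csum f n + csum (fun k => f (n + k)%nat) m.
Proof.
  induction m as [|m IH]; [rewrite Nat.add_0_r; simpl; ring|].
  rewrite Nat.add_succ_r; simpl; rewrite IH; ring.
Qed.

Lemma hassum_tail_geom (f : nat -> C) (l : C) (K q : R) (N : nat) :
  (0 <= q < 1)%R -> (forall n, (Cmod (f n) <= K * q ^ n)%R) -> hassum f l ->
  (Cmod (csum f N - l) <= K / (1 - q) * q ^ N)%R.
Proof.
  intros Hq H Hl.
  assert (HK : (0 <= K)%R) by (eapply geom_bound_pos; eauto).
  rewrite <- Cmod_opp.
  apply (cv_Cmod_le (fun m => - (csum f N - csum f (N + m)%nat))).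
  - replace (- (csum f N - l)) with (l - csum f N) by ring.
    apply (cv_ext (fun m => csum f (N + m)%nat - csum f N)).
    + intros n; ring.
    + apply cv_minus; [|apply cv_const].
      apply (cv_subseq (fun m => (N + m)%nat)); [intros; lia|exact Hl].
  - intros m; rewrite csum_add.
    replace (- (csum f N - (csum f N + csum (fun k => f (N + k)%nat) m)))
      with (csum (fun k => f (N + k)%nat) m) by ring.
    eapply Rle_trans; [apply Cmod_csum_le; intros; apply H|].
    rewrite (rsum_ext _ (fun k => (K * q ^ N * q ^ k)%R))
      by (intros; rewrite pow_add; ring).
    rewrite rsum_scal.
    assert (0 <= q ^ N)%R by (apply pow_le; lra).
    assert (G := rsum_geom_le q m Hq).
    replace (K / (1 - q) * q ^ N)%R with (K * q ^ N * / (1 - q))%R by (field; lra).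
    apply Rmult_le_compat_l; [now apply Rmult_le_pos|exact G].
Qed.

(** Both sides run over the triangle m + n < M, by diagonals and by rows. *)
Lemma csum_diagonal (u : nat -> nat -> C) (M : nat) :
  csum (fun N => csum (fun m => u m (N - m)%nat) (S N)) M
  = csum (fun m => csum (u m) (M - m)) M.
Proof.
  induction M as [|M IH]; [reflexivity|].
  change (csum (fun N => csum (fun m => u m (N - m)%nat) (S N)) M
          + (csum (fun m => u m (M - m)%nat) M + u M (M - M)%nat)
          = csum (fun m => csum (u m) (S M - m)) M + csum (u M) (S M - M)).
  rewrite IH.
  replace (S M - M)%nat with 1%nat by lia; replace (M - M)%nat with O by lia.
  rewrite (csum_ext (fun m => csum (u m) (S M - m))
             (fun m => csum (u m) (M - m) + u m (M - m)%nat)).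
  - rewrite csum_plus; simpl; ring.
  - intros k Hk; replace (S M - k)%nat with (S (M - k)) by lia; reflexivity.
Qed.

Lemma INR_le_pow (h : R) (n : nat) : (0 < h)%R -> (INR n <= (1 + h) ^ n / h)%R.
Proof.
  intros Hh; apply (Rmult_le_reg_r h); [exact Hh|].
  unfold Rdiv; rewrite Rmult_assoc, Rinv_l, Rmult_1_r by lra.
  assert (G := Rle_pow_lin h n ltac:(lra)); lra.
Qed.

Lemma is_lim_seq_INR_geom (K q : R) :
  (0 <= K)%R -> (0 <= q < 1)%R -> is_lim_seq (fun n => (K * (INR n * q ^ n))%R) 0.
Proof.
  (* Bernoulli's inequality bounds n by (1 + h)^n / h, and this h still leaves (1 + h) q < 1. *)
  intros HK Hq; set (h := ((1 - q) / 2)%R).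
  assert (Hh : (0 < h)%R) by (unfold h; lra).
  apply (is_lim_seq_le_le (fun _ => 0%R) _ (fun n => (K / h * ((1 + h) * q) ^ n)%R)).
  - intros n; assert (G := INR_le_pow h n Hh).
    assert (0 <= q ^ n)%R by (apply pow_le; lra).
    assert (0 <= INR n)%R by apply pos_INR.
    split; [apply Rmult_le_pos; [lra|nra]|].
    rewrite Rpow_mult_distr.
    replace (K / h * ((1 + h) ^ n * q ^ n))%R
      with (K * ((1 + h) ^ n / h * q ^ n))%R by (field; lra).
    apply Rmult_le_compat_l; [lra|apply Rmult_le_compat_r; lra].
  - apply is_lim_seq_const.
  - apply is_lim_seq_geom_scal; unfold h; nra.
Qed.

(** Within the triangle of side M, row m misses a tail of size at most K q^M / (1 - q) whatever m
    is; the M rows together are off by a multiple of M q^M, which tends to 0. *)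
Lemma hassum_diagonal (u : nat -> nat -> C) (s : nat -> C) (T : C) (K q : R) :
  (0 <= q < 1)%R -> (forall m n, (Cmod (u m n) <= K * q ^ (m + n))%R) ->
  (forall m, hassum (u m) (s m)) -> hassum s T ->
  hassum (fun N => csum (fun m => u m (N - m)%nat) (S N)) T.
Proof.
  intros Hq Hu Hs HT.
  assert (HK : (0 <= K)%R) by (apply (geom_bound_pos (u O) K q); intros; apply Hu).
  assert (H0 : cv (fun M => csum (fun m => csum (u m) (M - m) - s m) M) 0).
  { apply (cv_of_le _ _ (fun M => (K / (1 - q) * (INR M * q ^ M))%R)).
    - intros M.
      replace (csum (fun m => csum (u m) (M - m) - s m) M - 0)
        with (csum (fun m => csum (u m) (M - m) - s m) M) by ring.
      eapply Rle_trans;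
        [apply (Cmod_csum_le _ (fun _ => (K / (1 - q) * q ^ M)%R))|].
      + intros m Hm.
        replace (K / (1 - q) * q ^ M)%R with (K * q ^ m / (1 - q) * q ^ (M - m))%R.
        * apply hassum_tail_geom; auto; intros n; rewrite Rmult_assoc, <- pow_add; auto.
        * replace M with (m + (M - m))%nat at 2 by lia; rewrite pow_add; field; lra.
      + rewrite rsum_const; lra.
    - apply is_lim_seq_INR_geom; auto.
      apply Rmult_le_pos; [exact HK|apply Rlt_le, Rinv_0_lt_compat; lra]. }
  unfold hassum; replace T with (0 + T) by ring.
  eapply cv_ext; [|apply cv_plus; [exact H0|exact HT]].
  intros M; cbv beta; rewrite csum_diagonal, csum_minus; ring.
Qed.

(** Dominated convergence for series with a geometric majorant: both tails beyond L are small
    uniformly in k, and the finite head converges term by term. *)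
Lemma hassum_tannery (a : nat -> nat -> C) (b A : nat -> C) (B : C) (K q : R) :
  (0 <= q < 1)%R -> (forall l k, (Cmod (a l k) <= K * q ^ l)%R) ->
  (forall l, cv (a l) (b l)) ->
  (forall k, hassum (fun l => a l k) (A k)) -> hassum b B -> cv A B.
Proof.
  intros Hq Ha Hab HA HB eps He.
  assert (HK : (0 <= K)%R)
    by (apply (geom_bound_pos (fun l => a l O) K q); intros; apply Ha).
  assert (Hb : forall l, (Cmod (b l) <= K * q ^ l)%R)
    by (intros l; apply (cv_Cmod_le (a l)); auto).
  assert (Hlim := is_lim_seq_geom_scal (K / (1 - q)) q Hq).
  apply is_lim_seq_spec in Hlim.
  destruct (Hlim (mkposreal (eps / 3) ltac:(lra))) as [L HL].
  specialize (HL L (Nat.le_refl _)); simpl in HL; rewrite Rminus_0_r in HL.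
  apply Rabs_def2 in HL; destruct HL as [HL _].
  assert (Hfin : forall M, cv (fun k => csum (fun l => a l k) M) (csum b M)).
  { induction M as [|M IH]; [exact (cv_const 0)|]; simpl; now apply cv_plus. }
  destruct (Hfin L (eps / 3)%R ltac:(lra)) as [N HN].
  exists N; intros k Hk.
  assert (H1 := hassum_tail_geom _ _ K q L Hq (fun l => Ha l k) (HA k)).
  assert (H2 := hassum_tail_geom _ _ K q L Hq Hb HB).
  specialize (HN k Hk); simpl in HN, H1.
  set (X := csum (fun l => a l k) L) in *; set (Y := csum b L) in *.
  replace (A k - B) with (- (X - A k) + ((X - Y) + (Y - B))) by ring.
  eapply Rle_lt_trans; [apply Cmod_triangle|]; rewrite Cmod_opp.
  eapply Rle_lt_trans; [apply Rplus_le_compat_l, Cmod_triangle|]; lra.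
Qed.

Lemma hassum_cauchy (f g : nat -> C) (l m : C) (K1 K2 q : R) :
  (0 <= q < 1)%R -> (forall n, (Cmod (f n) <= K1 * q ^ n)%R) ->
  (forall n, (Cmod (g n) <= K2 * q ^ n)%R) -> hassum f l -> hassum g m ->
  hassum (fun N => csum (fun k => f k * g (N - k)%nat) (S N)) (l * m).
Proof.
  intros Hq Hf Hg Hl Hm.
  apply (hassum_diagonal (fun i j => f i * g j) (fun i => m * f i) (l * m) (K1 * K2) q Hq).
  - intros i j; rewrite Cmod_mult, pow_add.
    replace (K1 * K2 * (q ^ i * q ^ j))%R with (K1 * q ^ i * (K2 * q ^ j))%R by ring.
    apply Rmult_le_compat; auto using Cmod_ge_0.
  - intros i; rewrite (Cmult_comm m); now apply hassum_scal.
  - rewrite (Cmult_comm l); now apply hassum_scal.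
Qed.

(** * Iterated differences and binomial sums *)

(** The sign is chosen for moment sequences: if f m is the integral of t^m, then [dif n f p] is the
    integral of t^p (1 - t)^n. *)
Fixpoint dif (n : nat) (f : nat -> C) (p : nat) : C :=
  match n with O => f p | S k => dif k f p - dif k f (S p) end.

(* [bs n x] is the sum of [binom n r * x r] over [r <= n]. *)
Fixpoint bs (n : nat) (x : nat -> C) : C :=
  match n with O => x O | S k => bs k x + bs k (fun r => x (S r)) end.

Fixpoint rbs (n : nat) (x : nat -> R) : R :=
  match n with O => x O | S k => (rbs k x + rbs k (fun r => x (S r)))%R end.

Lemma bs_ext (n : nat) (x y : nat -> C) :
  (forall r, (r <= n)%nat -> x r = y r) -> bs n x = bs n y.
Proof.
  revert x y; induction n as [|n IH]; intros x y H; simpl; [apply H; lia|].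
  rewrite (IH x y), (IH (fun r => x (S r)) (fun r => y (S r)));
    [reflexivity| |]; intros; apply H; lia.
Qed.

Lemma bs_plus (n : nat) (x y : nat -> C) :
  bs n (fun r => x r + y r) = bs n x + bs n y.
Proof.
  revert x y; induction n as [|n IH]; intros x y; simpl; [reflexivity|].
  rewrite IH, (IH (fun r => x (S r)) (fun r => y (S r))); ring.
Qed.

Lemma bs_scal (n : nat) (a : C) (x : nat -> C) :
  bs n (fun r => a * x r) = a * bs n x.
Proof.
  revert x; induction n as [|n IH]; intros x; simpl; [reflexivity|].
  rewrite IH, (IH (fun r => x (S r))); ring.
Qed.

Lemma bs_minus (n : nat) (x y : nat -> C) :
  bs n (fun r => x r - y r) = bs n x - bs n y.
Proof.
  rewrite (bs_ext n _ (fun r => x r + (-1) * y r)) by (intros; ring).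
  rewrite bs_plus, bs_scal; ring.
Qed.

Lemma bs_const (n : nat) (a : C) : bs n (fun _ => a) = 2 ^ n * a.
Proof. induction n as [|n IH]; simpl; [ring|rewrite IH; ring]. Qed.

Lemma Cmod_bs_le (n : nat) (x : nat -> C) (y : nat -> R) :
  (forall r, (r <= n)%nat -> (Cmod (x r) <= y r)%R) -> (Cmod (bs n x) <= rbs n y)%R.
Proof.
  revert x y; induction n as [|n IH]; intros x y H; simpl; [apply H; lia|].
  eapply Rle_trans; [apply Cmod_triangle|].
  apply Rplus_le_compat; apply IH; intros; apply H; lia.
Qed.

Lemma rbs_ext (n : nat) (x y : nat -> R) :
  (forall r, (r <= n)%nat -> x r = y r) -> rbs n x = rbs n y.
Proof.
  revert x y; induction n as [|n IH]; intros x y H; simpl; [apply H; lia|].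
  rewrite (IH x y), (IH (fun r => x (S r)) (fun r => y (S r)));
    [reflexivity| |]; intros; apply H; lia.
Qed.

Lemma rbs_scal (n : nat) (a : R) (x : nat -> R) :
  rbs n (fun r => (a * x r)%R) = (a * rbs n x)%R.
Proof.
  revert x; induction n as [|n IH]; intros x; simpl; [reflexivity|].
  rewrite IH, (IH (fun r => x (S r))); ring.
Qed.

Lemma rbs_plus (n : nat) (x y : nat -> R) :
  rbs n (fun r => (x r + y r)%R) = (rbs n x + rbs n y)%R.
Proof.
  revert x y; induction n as [|n IH]; intros x y; simpl; [reflexivity|].
  rewrite IH, (IH (fun r => x (S r)) (fun r => y (S r))); ring.
Qed.

Lemma rbs_binomial (n : nat) (a b : R) :
  rbs n (fun r => (a ^ (n - r) * b ^ r)%R) = ((a + b) ^ n)%R.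
Proof.
  induction n as [|n IH]; [simpl; ring|].
  change (rbs n (fun r => a ^ (S n - r) * b ^ r)
          + rbs n (fun r => a ^ (S n - S r) * b ^ S r) = (a + b) * (a + b) ^ n)%R.
  rewrite (rbs_ext n _ (fun r => (a * (a ^ (n - r) * b ^ r))%R)).
  2:{ intros r Hr; replace (S n - r)%nat with (S (n - r)) by lia; simpl; ring. }
  rewrite (rbs_ext n (fun r => (a ^ (S n - S r) * b ^ S r)%R)
             (fun r => (b * (a ^ (n - r) * b ^ r))%R)).
  2:{ intros r Hr; simpl; ring. }
  rewrite !rbs_scal, IH; ring.
Qed.

Lemma rbs_geom (n : nat) (b : R) : rbs n (fun r => (b ^ r)%R) = ((1 + b) ^ n)%R.
Proof.
  rewrite <- rbs_binomial; apply rbs_ext; intros; rewrite pow1; ring.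
Qed.

Lemma INR_fact_C_neq_0 (n : nat) : RtoC (INR (fact n)) <> 0.
Proof. intros H; apply RtoC_inj in H; revert H; apply INR_fact_neq_0. Qed.

Lemma INR_S_C (n : nat) : RtoC (INR (S n)) = RtoC (INR n) + 1.
Proof. now rewrite S_INR, RtoC_plus. Qed.

Lemma INR_fact_S_C (n : nat) :
  RtoC (INR (fact (S n))) = (RtoC (INR n) + 1) * RtoC (INR (fact n)).
Proof. now rewrite fact_simpl, mult_INR, RtoC_mult, INR_S_C. Qed.

Lemma INR_S_C_neq_0 (n : nat) : RtoC (INR n) + 1 <> 0.
Proof.
  rewrite <- INR_S_C; intros H; apply RtoC_inj in H; revert H.
  apply not_0_INR; lia.
Qed.

Lemma binomC_0 (n : nat) : binomC n 0 = 1.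
Proof.
  unfold binomC, Binomial.C; rewrite Nat.sub_0_r; f_equal; simpl.
  field; apply INR_fact_neq_0.
Qed.

Lemma binomC_diag (n : nat) : binomC n n = 1.
Proof.
  unfold binomC, Binomial.C; rewrite Nat.sub_diag; f_equal; simpl.
  field; apply INR_fact_neq_0.
Qed.

Lemma binomC_fact (n r : nat) :
  binomC n r = RtoC (INR (fact n)) / (RtoC (INR (fact r)) * RtoC (INR (fact (n - r)))).
Proof.
  unfold binomC, Binomial.C; rewrite RtoC_div, RtoC_mult; [reflexivity|].
  apply Rmult_integral_contrapositive; split; apply INR_fact_neq_0.
Qed.

Lemma bs_csum (n : nat) (x : nat -> C) :
  bs n x = csum (fun r => binomC n r * x r) (S n).
Proof.
  revert x; induction n as [|n IH]; intros x.
  - simpl; rewrite binomC_0; ring.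
  - simpl bs; rewrite IH, (IH (fun r => x (S r))).
    rewrite (csum_head (fun r => binomC n r * x r)).
    change (csum (fun r => binomC n r * x (S r)) (S n))
      with (csum (fun r => binomC n r * x (S r)) n + binomC n n * x (S n)).
    rewrite (csum_head (fun r => binomC (S n) r * x r)).
    change (csum (fun k => binomC (S n) (S k) * x (S k)) (S n))
      with (csum (fun k => binomC (S n) (S k) * x (S k)) n
            + binomC (S n) (S n) * x (S n)).
    rewrite !binomC_0, !binomC_diag.
    rewrite (csum_ext (fun k => binomC (S n) (S k) * x (S k))
               (fun k => binomC n (S k) * x (S k) + binomC n k * x (S k))).
    + rewrite csum_plus; ring.
    + intros k Hk; unfold binomC; rewrite <- pascal by exact Hk.
      rewrite RtoC_plus; ring.
Qed.

Lemma dif_ext (n : nat) (f g : nat -> C) (p : nat) :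
  (forall m, f m = g m) -> dif n f p = dif n g p.
Proof.
  intros H; revert p; induction n as [|n IH]; intros p; simpl; [apply H|].
  now rewrite !IH.
Qed.

Lemma dif_shift (n : nat) (f : nat -> C) (k p : nat) :
  dif n (fun m => f (m + k)%nat) p = dif n f (p + k)%nat.
Proof.
  revert p; induction n as [|n IH]; intros p; simpl; [reflexivity|].
  now rewrite !IH.
Qed.

Lemma dif_scal (n : nat) (a : C) (f : nat -> C) (p : nat) :
  dif n (fun m => a * f m) p = a * dif n f p.
Proof. revert p; induction n as [|n IH]; intros p; simpl; [|rewrite !IH]; ring. Qed.

Lemma dif_bs (n : nat) (f : nat -> C) (p : nat) :
  dif n f p = bs n (fun j => (-1) ^ j * f (p + j)%nat).
Proof.
  revert p; induction n as [|n IH]; intros p; simpl.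
  - rewrite Nat.add_0_r; ring.
  - rewrite !IH.
    rewrite (bs_ext n (fun r => -1 * (-1) ^ r * f (p + S r)%nat)
               (fun r => (-1) * ((-1) ^ r * f (S p + r)%nat))).
    + rewrite bs_scal; ring.
    + intros r _; rewrite Nat.add_succ_r; simpl; ring.
Qed.

(** In moment terms this is t^m = (1 - (1 - t))^m. *)
Lemma newton_series (m : nat) (f : nat -> C) (p : nat) :
  f (p + m)%nat = bs m (fun l => (-1) ^ l * dif l f p).
Proof.
  revert p; induction m as [|m IH]; intros p.
  - simpl; rewrite Nat.add_0_r; ring.
  - replace (p + S m)%nat with (S p + m)%nat by lia.
    rewrite IH; simpl bs; rewrite <- bs_plus; apply bs_ext; intros; simpl; ring.
Qed.

(** In moment terms, the n-th power of 1 - s t = (1 - s) + s (1 - t), with s belonging to f and t to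
    g; this explains the shift p + l in f. *)
Lemma dif_leibniz (n : nat) (f g : nat -> C) (p : nat) :
  dif n (fun m => f m * g m) p
  = bs n (fun l => dif l g p * dif (n - l) f (p + l)%nat).
Proof.
  revert p; induction n as [|n IH]; intros p.
  - simpl; rewrite Nat.add_0_r; ring.
  - change (dif (S n) (fun m => f m * g m) p) with
      (dif n (fun m => f m * g m) p - dif n (fun m => f m * g m) (S p)).
    rewrite !IH; simpl bs; rewrite <- bs_minus, <- bs_plus.
    apply bs_ext; intros r Hr.
    replace (match r with O => S n | S l => (n - l)%nat end) with (S (n - r))
      by (destruct r; lia).
    rewrite Nat.add_succ_r; simpl; ring.
Qed.

Lemma dif_pow (n : nat) (x : C) (p : nat) :
  dif n (fun m => x ^ m) p = (1 - x) ^ n * x ^ p.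
Proof. revert p; induction n as [|n IH]; intros p; simpl; [|rewrite !IH; simpl]; ring. Qed.

Lemma hassum_dif (n : nat) (w : nat -> nat -> C) (mu : nat -> C) (p : nat) :
  (forall m, hassum (w m) (mu m)) ->
  hassum (fun k => dif n (fun m => w m k) p) (dif n mu p).
Proof.
  intros H; revert p; induction n as [|n IH]; intros p; simpl; [apply H|].
  apply hassum_minus; apply IH.
Qed.

Lemma cv_dif (n : nat) (w : nat -> nat -> C) (mu : nat -> C) (p : nat) :
  (forall m, cv (w m) (mu m)) ->
  cv (fun k => dif n (fun m => w m k) p) (dif n mu p).
Proof.
  intros H; revert p; induction n as [|n IH]; intros p; simpl; [apply H|].
  apply cv_minus; apply IH.
Qed.

Lemma hassum_bs (n : nat) (w : nat -> nat -> C) (mu : nat -> C) :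
  (forall m, hassum (w m) (mu m)) ->
  hassum (fun k => bs n (fun r => w r k)) (bs n mu).
Proof.
  revert w mu; induction n as [|n IH]; intros w mu H; simpl; [apply H|].
  apply hassum_plus; [apply IH, H|].
  apply (IH (fun r => w (S r))); intros; apply H.
Qed.

(* If [nu m = int t^m d mu(t)], then [x^m nu m] is the moment sequence of the
   push-forward under [t |-> x t], and [1 - x t = (1 - x) + x (1 - t)]. *)
Lemma Cmod_dif_pow_le (nu : nat -> C) (x K q : R) (n : nat) :
  (0 <= x <= 1)%R -> (1 <= q)%R -> (forall j, (Cmod (dif j nu 0) <= K * q ^ j)%R) ->
  (Cmod (dif n (fun m => x ^ m * nu m)%C 0) <= K * q ^ n)%R.
Proof.
  intros Hx Hq H.
  assert (HK : (0 <= K)%R) by (apply (geom_bound_pos (fun j => dif j nu 0) K q H)).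
  rewrite dif_leibniz.
  eapply Rle_trans;
    [apply (Cmod_bs_le n _ (fun r => (K * ((1 - x) ^ (n - r) * (x * q) ^ r))%R))|].
  - intros r Hr; rewrite dif_pow, Nat.add_0_l, !Cmod_mult, !Cmod_pow.
    rewrite <- RtoC_minus, !Cmod_R, !Rabs_pos_eq by lra.
    rewrite Rpow_mult_distr.
    assert (0 <= (1 - x) ^ (n - r))%R by (apply pow_le; lra).
    assert (0 <= x ^ r)%R by (apply pow_le; lra).
    replace (K * ((1 - x) ^ (n - r) * (x ^ r * q ^ r)))%R
      with (K * q ^ r * ((1 - x) ^ (n - r) * x ^ r))%R by ring.
    apply Rmult_le_compat_r; [now apply Rmult_le_pos|apply H].
  - rewrite rbs_scal, rbs_binomial; apply Rmult_le_compat_l; [exact HK|].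
    apply pow_incr; split; nra.
Qed.

(** * Euler and Abel summation *)

(** A null sequence is replaced by a small constant plus a geometric transient, because averages of
    both can be computed exactly, for binomial as well as for Abel weights. *)
Lemma cv_zero_split (A : nat -> C) (d : R) :
  cv A 0 -> (0 < d)%R ->
  exists B, (0 <= B)%R /\ forall r, (Cmod (A r) <= d + B * (1 / 2) ^ r)%R.
Proof.
  intros HA Hd; destruct (HA d Hd) as [N HN]; destruct (cv_bounded A 0 HA) as [B [HB0 HB]].
  (* 2^N compensates (1/2)^r for the indices r < N, where only the global bound B is available. *)
  exists (B * 2 ^ N)%R; split; [apply Rmult_le_pos; [lra|apply pow_le; lra]|].
  intros r.
  assert (Hp : (0 <= (1 / 2) ^ r)%R) by (apply pow_le; lra).
  destruct (Nat.lt_ge_cases r N) as [Hr|Hr].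
  - assert (1 <= 2 ^ N * (1 / 2) ^ r)%R.
    { replace N with (r + (N - r))%nat by lia; rewrite pow_add.
      replace (2 ^ r * 2 ^ (N - r) * (1 / 2) ^ r)%R
        with ((2 * (1 / 2)) ^ r * 2 ^ (N - r))%R by (rewrite Rpow_mult_distr; ring).
      replace (2 * (1 / 2))%R with 1%R by field; rewrite pow1, Rmult_1_l.
      apply pow_R1_Rle; lra. }
    specialize (HB r); nra.
  - specialize (HN r Hr); replace (A r - 0) with (A r) in HN by ring.
    assert (0 <= B * 2 ^ N)%R by (apply Rmult_le_pos; [lra|apply pow_le; lra]); nra.
Qed.

(** The partial sums of Euler's transform are the binomial means, with weights binom K r / 2^K, of
    the original partial sums. *)
Lemma euler_partial_sum (f : nat -> C) (K : nat) :
  csum (fun k => (/ 2) ^ (S k) * dif k f 0) K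
  = (/ 2) ^ K * bs K (csum (fun m => (-1) ^ m * f m)).
Proof.
  induction K as [|K IH]; [simpl; ring|].
  change (csum (fun k => (/ 2) ^ (S k) * dif k f 0) (S K))
    with (csum (fun k => (/ 2) ^ (S k) * dif k f 0) K + (/ 2) ^ (S K) * dif K f 0).
  rewrite IH, dif_bs; simpl bs; rewrite bs_plus.
  simpl Cpow; field.
Qed.

(** Regularity of Euler's method: binomial means of a convergent sequence have the same limit,
    without any absolute convergence. *)
Lemma euler_summation (f : nat -> C) (S0 : C) :
  hassum (fun m => (-1) ^ m * f m) S0 ->
  hassum (fun k => (/ 2) ^ (S k) * dif k f 0) S0.
Proof.
  intros H eps He.
  set (A := csum (fun m => (-1) ^ m * f m)) in *.
  assert (H0 : cv (fun n => A n - S0) 0).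
  { replace (RtoC 0) with (S0 - S0) by ring; apply cv_minus; [exact H|apply cv_const]. }
  destruct (cv_zero_split _ (eps / 2) H0 ltac:(lra)) as [B [HB0 HB]].
  (* The binomial mean of (1/2)^r is ((1 + 1/2)/2)^K = (3/4)^K. *)
  assert (Hl := is_lim_seq_geom_scal B (3 / 4) ltac:(lra)); apply is_lim_seq_spec in Hl.
  destruct (Hl (mkposreal (eps / 2) ltac:(lra))) as [N HN].
  exists N; intros K HK; specialize (HN K HK); simpl in HN; rewrite Rminus_0_r in HN.
  apply Rabs_def2 in HN; destruct HN as [HN _].
  rewrite euler_partial_sum; fold A.
  assert (H2 : RtoC 2 <> 0) by (intros E; apply RtoC_inj in E; lra).
  replace ((/ 2) ^ K * bs K A - S0) with ((/ 2) ^ K * bs K (fun n => A n - S0)).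
  2:{ rewrite bs_minus, bs_const, Cpow_inv by exact H2.
      field; now apply Cpow_nz. }
  rewrite Cmod_mult, Cmod_pow, Cmod_inv, Cmod_R, Rabs_pos_eq by (auto; lra).
  assert (G := Cmod_bs_le K _ _ (fun r _ => HB r)).
  rewrite rbs_plus, rbs_scal, rbs_geom in G.
  rewrite (rbs_ext K (fun _ => (eps / 2)%R) (fun r => (eps / 2 * 1 ^ r)%R)) in G
    by (intros; rewrite pow1; ring).
  rewrite rbs_scal, rbs_geom in G.
  assert (Hp : (0 < (/ 2) ^ K)%R) by (apply pow_lt; lra).
  apply (Rmult_le_compat_l ((/ 2) ^ K)) in G; [|lra].
  eapply Rle_lt_trans; [exact G|].
  replace ((/ 2) ^ K * (eps / 2 * (1 + 1) ^ K + B * (1 + 1 / 2) ^ K))%R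
    with (eps / 2 * (/ 2 * (1 + 1)) ^ K + B * (/ 2 * (1 + 1 / 2)) ^ K)%R
    by (rewrite !Rpow_mult_distr; ring).
  replace (/ 2 * (1 + 1))%R with 1%R by field.
  replace (/ 2 * (1 + 1 / 2))%R with (3 / 4)%R by field.
  rewrite pow1; lra.
Qed.

Lemma csum_by_parts (q lam : nat -> C) (N : nat) :
  csum (fun n => q n * lam n) N
  = csum q N * lam N + csum (fun n => csum q (S n) * (lam n - lam (S n))) N.
Proof.
  induction N as [|N IH]; [simpl; ring|].
  change (csum (fun n => q n * lam n) (S N))
    with (csum (fun n => q n * lam n) N + q N * lam N).
  change (csum (fun n => csum q (S n) * (lam n - lam (S n))) (S N))
    with (csum (fun n => csum q (S n) * (lam n - lam (S n))) N
          + csum q (S N) * (lam N - lam (S N))).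
  rewrite IH; simpl; ring.
Qed.

Lemma Cmod_csum_by_parts (q lam : nat -> C) (B L V : R) (N : nat) :
  (forall n, (Cmod (csum q n) <= B)%R) -> (forall n, (Cmod (lam n) <= L)%R) ->
  (forall n, (rsum (fun k => Cmod (lam k - lam (S k))) n <= V)%R) ->
  (Cmod (csum (fun n => q n * lam n)%C N) <= B * (L + V))%R.
Proof.
  intros HB HL HV.
  assert (HB0 : (0 <= B)%R)
    by (eapply Rle_trans; [apply Cmod_ge_0|apply (HB O)]).
  rewrite csum_by_parts; eapply Rle_trans; [apply Cmod_triangle|].
  rewrite Rmult_plus_distr_l; apply Rplus_le_compat.
  - rewrite Cmod_mult; apply Rmult_le_compat; auto using Cmod_ge_0.
  - eapply Rle_trans;
      [apply (Cmod_csum_le _ (fun k => (B * Cmod (lam k - lam (S k)))%R))|].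
    + intros k _; rewrite Cmod_mult; apply Rmult_le_compat_r; auto using Cmod_ge_0.
    + rewrite rsum_scal; apply Rmult_le_compat_l; auto.
Qed.

(** Bounded variation makes [lam] convergent and the sum left by summation by parts absolutely
    convergent; complex weights admit no monotonicity assumption. *)
Lemma abel_test (q lam : nat -> C) (Q : C) (V : R) :
  hassum q Q -> (forall n, (rsum (fun k => Cmod (lam k - lam (S k))) n <= V)%R) ->
  exists l, hassum (fun n => q n * lam n) l.
Proof.
  intros HQ HV.
  destruct (cv_bounded _ _ HQ) as [B [HB0 HB]].
  destruct (ex_hassum_bounded (fun n => lam n - lam (S n)) V HV) as [v Hv].
  destruct (ex_hassum_bounded (fun n => csum q (S n) * (lam n - lam (S n))) (B * V))
    as [w Hw].
  { intros N.
    apply Rle_trans with (rsum (fun n => (B * Cmod (lam n - lam (S n)))%R) N).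
    - apply rsum_le; intros k _; rewrite Cmod_mult.
      apply Rmult_le_compat_r; auto using Cmod_ge_0.
    - rewrite rsum_scal; apply Rmult_le_compat_l; auto. }
  assert (Hlam : cv lam (lam O - v)).
  { apply (cv_ext (fun n => lam O - csum (fun n => lam n - lam (S n)) n)).
    - intros n; induction n as [|n IH]; simpl; [ring|].
      transitivity ((lam O - csum (fun n => lam n - lam (S n)) n) - (lam n - lam (S n)));
        [ring|rewrite IH; ring].
    - apply cv_minus; [apply cv_const|exact Hv]. }
  exists (Q * (lam O - v) + w).
  eapply cv_ext; [intros n; symmetry; apply csum_by_parts|].
  apply cv_plus; [now apply cv_mult|exact Hw].
Qed.

Lemma rsum_pow_variation (x : R) (n : nat) :
  (0 <= x <= 1)%R -> (rsum (fun k => Cmod (x ^ k - x ^ S k)%C) n <= 1)%R.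
Proof.
  intros Hx.
  assert (E : rsum (fun k => Cmod (x ^ k - x ^ S k)%C) n = (1 - x ^ n)%R).
  { induction n as [|n IH]; [simpl; ring|].
    cbn [rsum]; rewrite IH.
    replace (RtoC x ^ n - x ^ S n) with (RtoC (x ^ n * (1 - x)))
      by (rewrite RtoC_mult, RtoC_minus, RtoC_pow; simpl; ring).
    rewrite Cmod_R, Rabs_pos_eq; [simpl; ring|].
    apply Rmult_le_pos; [apply pow_le|]; lra. }
  rewrite E; assert (0 <= x ^ n)%R by (apply pow_le; lra); lra.
Qed.

(** A fixed sequence in [1/2, 1) tending to 1, so that Abel limits become limits of sequences. *)
Definition abel_x (k : nat) : R := (1 - / (INR k + 2))%R.

Lemma abel_x_bounds (k : nat) : (0 <= abel_x k < 1)%R.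
Proof.
  unfold abel_x; assert (H := pos_INR k).
  assert (0 < / (INR k + 2))%R by (apply Rinv_0_lt_compat; lra).
  assert (/ (INR k + 2) <= 1)%R
    by (rewrite <- Rinv_1; apply Rinv_le_contravar; lra).
  lra.
Qed.

Lemma abel_x_lim (d : R) : (0 < d)%R ->
  exists N, forall k, (N <= k)%nat -> (1 - abel_x k < d)%R.
Proof.
  intros Hd; destruct (nfloor_ex (/ d)) as [N [_ HN]].
  { apply Rlt_le, Rinv_0_lt_compat, Hd. }
  exists N; intros k Hk; unfold abel_x.
  apply le_INR in Hk; assert (H := pos_INR N).
  replace (1 - (1 - / (INR k + 2)))%R with (/ (INR k + 2))%R by ring.
  rewrite <- (Rinv_inv d); apply Rinv_lt_contravar; [|lra].
  apply Rmult_lt_0_compat; [apply Rinv_0_lt_compat|]; lra.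
Qed.

(** Abel's limit theorem: summation by parts against the remainders [R0], whose constant part meets
    total variation at most 1 and whose transient part meets the factor 1 - x. *)
Lemma abel_limit (p A : nat -> C) (P : C) :
  hassum p P -> (forall k, hassum (fun n => RtoC (abel_x k) ^ n * p n) (A k)) ->
  cv A P.
Proof.
  intros HP HA eps He.
  set (R0 := fun n => csum p n - P).
  assert (H0 : cv R0 0).
  { replace (RtoC 0) with (P - P) by ring; apply cv_minus; [exact HP|apply cv_const]. }
  (* The final estimate uses five contributions of size d: two from the constant part of the
     remainders, one from B (1/2)^M, one from 2 B (1 - x), one from truncating [A k]. *)
  set (d := (eps / 6)%R); assert (Hd : (0 < d)%R) by (unfold d; lra).
  destruct (cv_zero_split _ d H0 Hd) as [B [HB0 HB]].
  destruct (abel_x_lim (d / (2 * B + 1))) as [N HN].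
  { apply Rdiv_lt_0_compat; lra. }
  exists N; intros k Hk; specialize (HN k Hk).
  assert (Hx := abel_x_bounds k); set (x := abel_x k) in *.
  assert (HBx : (2 * B * (1 - x) <= d)%R).
  { apply Rlt_le in HN; apply (Rmult_le_compat_l (2 * B + 1)) in HN; [|lra].
    replace ((2 * B + 1) * (d / (2 * B + 1)))%R with d in HN by (field; lra); nra. }
  assert (E : forall M, csum (fun n => RtoC x ^ n * p n) M - P
            = R0 M * x ^ M + csum (fun n => R0 (S n) * (x ^ n - x ^ S n)) M).
  { intros M.
    rewrite (csum_ext (fun n => RtoC x ^ n * p n) (fun n => p n * x ^ n)) by (intros; ring).
    rewrite csum_by_parts; unfold R0.
    rewrite (csum_ext (fun n => (csum p (S n) - P) * (x ^ n - x ^ S n))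
      (fun n => csum p (S n) * (x ^ n - x ^ S n) + P * (x ^ S n - x ^ n)))
      by (intros; ring).
    rewrite csum_plus, csum_scal, csum_telescope; simpl; ring. }
  assert (Hbd : forall M, (Cmod (csum (fun n => RtoC x ^ n * p n) M - P)%C
                   <= 2 * d + B * (1 / 2) ^ M + 2 * B * (1 - x))%R).
  { intros M; rewrite E; eapply Rle_trans; [apply Cmod_triangle|].
    assert (Hxp : forall n, (0 <= x ^ n <= 1)%R).
    { intros n; split; [apply pow_le; lra|rewrite <- (pow1 n); apply pow_incr; lra]. }
    assert (F1 : (Cmod (R0 M * x ^ M)%C <= d + B * (1 / 2) ^ M)%R).
    { rewrite Cmod_mult, Cmod_pow, Cmod_R, Rabs_pos_eq by lra.
      specialize (HB M); specialize (Hxp M); assert (G := Cmod_ge_0 (R0 M)); nra. }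
    assert (F2 : (Cmod (csum (fun n => R0 (S n) * (x ^ n - x ^ S n))%C M)
                  <= rsum (fun n => d * Cmod (x ^ n - x ^ S n)%C
                                    + B * (1 - x) * (1 / 2) ^ n) M)%R).
    { apply Cmod_csum_le; intros n _; rewrite Cmod_mult.
      replace (RtoC x ^ n - x ^ S n) with (RtoC (x ^ n * (1 - x)))
        by (rewrite RtoC_mult, RtoC_minus, RtoC_pow; simpl; ring).
      rewrite Cmod_R, Rabs_pos_eq by (apply Rmult_le_pos; [apply Hxp|lra]).
      specialize (HB (S n)); simpl in HB; specialize (Hxp n).
      assert (Hh : (0 <= (1 / 2) ^ n)%R) by (apply pow_le; lra).
      assert (Hq : (0 <= x ^ n * (1 - x) <= 1 - x)%R) by (split; nra).
      apply Rle_trans with ((d + B * (1 / 2 * (1 / 2) ^ n)) * (x ^ n * (1 - x)))%R.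
      - apply Rmult_le_compat_r; lra.
      - assert (HBh : (0 <= B * (1 / 2) ^ n)%R) by (now apply Rmult_le_pos).
        assert (B * (1 / 2) ^ n * (x ^ n * (1 - x)) <= B * (1 / 2) ^ n * (1 - x))%R
          by (apply Rmult_le_compat_l; lra).
        nra. }
    assert (F3 : rsum (fun n => d * Cmod (x ^ n - x ^ S n)%C
                                    + B * (1 - x) * (1 / 2) ^ n)%R M
      = (d * rsum (fun n => Cmod (x ^ n - x ^ S n)%C) M
         + B * (1 - x) * rsum (fun n => (1 / 2) ^ n) M)%R).
    { clear; induction M as [|M IH]; cbn [rsum]; [ring|rewrite IH; ring]. }
    assert (F4 := rsum_pow_variation x M ltac:(lra)).
    assert (F5 := rsum_geom_le (1 / 2) M ltac:(lra)).
    replace (/ (1 - 1 / 2))%R with 2%R in F5 by field.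
    assert (F6 : (B * (1 - x) * rsum (fun n => (1 / 2) ^ n) M <= B * (1 - x) * 2)%R).
    { apply Rmult_le_compat_l; [apply Rmult_le_pos; lra|exact F5]. }
    assert (F7 : (d * rsum (fun n => Cmod (x ^ n - x ^ S n)%C) M <= d * 1)%R)
      by (apply Rmult_le_compat_l; lra).
    rewrite F3 in F2; lra. }
  assert (Hl := is_lim_seq_geom_scal B (1 / 2) ltac:(lra)); apply is_lim_seq_spec in Hl.
  destruct (Hl (mkposreal d Hd)) as [M1 HM1].
  destruct (HA k d Hd) as [M2 HM2].
  set (M := max M1 M2) in *.
  specialize (HM1 M ltac:(lia)); specialize (HM2 M ltac:(lia)); specialize (Hbd M).
  simpl in HM1; rewrite Rminus_0_r in HM1; apply Rabs_def2 in HM1.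
  fold x in HM2; set (X := csum (fun n => RtoC x ^ n * p n) M) in *.
  replace (A k - P) with (- (X - A k) + (X - P)) by ring.
  eapply Rle_lt_trans; [apply Cmod_triangle|]; rewrite Cmod_opp; unfold d in *; lra.
Qed.

(** * Pochhammer symbols *)

Lemma poch_head (a : C) (n : nat) : poch a (S n) = a * poch (a + 1) n.
Proof.
  induction n as [|n IH]; [simpl; ring|].
  change (poch a (S (S n))) with (poch a (S n) * (a + RtoC (INR (S n)))).
  rewrite IH; simpl poch; rewrite INR_S_C; ring.
Qed.

Lemma not_pole_neq_0 (z : C) (n : nat) : not_pole z -> z + RtoC (INR n) <> 0.
Proof.
  intros H E; apply (H n); rewrite RtoC_opp.
  replace z with ((z + RtoC (INR n)) - RtoC (INR n)) by ring; rewrite E; ring.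
Qed.

Lemma poch_neq_0 (z : C) (n : nat) : not_pole z -> poch z n <> 0.
Proof.
  intros H; induction n as [|n IH]; simpl; [apply C1_nz|].
  apply Cmult_neq_0; [exact IH|now apply not_pole_neq_0].
Qed.

Lemma not_pole_add (z : C) (n : nat) : not_pole z -> not_pole (z + RtoC (INR n)).
Proof.
  intros H k E; apply (H (n + k)%nat).
  replace z with ((z + RtoC (INR n)) - RtoC (INR n)) by ring.
  rewrite E, plus_INR, !RtoC_opp, RtoC_plus; ring.
Qed.

Lemma not_pole_neq (z : C) : not_pole z -> z <> 0.
Proof. intros H E; apply (H O); rewrite E; simpl; f_equal; ring. Qed.

(** The coefficient of z^n in (1 - z)^(-a). *)
Definition bp (a : C) (n : nat) : C := poch a n / RtoC (INR (fact n)).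

Lemma bp_S (a : C) (n : nat) :
  bp a (S n) = bp a n * (a + RtoC (INR n)) / (RtoC (INR n) + 1).
Proof.
  unfold bp; rewrite INR_fact_S_C; simpl poch.
  field; split; [apply INR_fact_C_neq_0|apply INR_S_C_neq_0].
Qed.

Lemma bp_0 (a : C) : bp a 0 = 1.
Proof. unfold bp; simpl; field. Qed.

Lemma geom_of_ratio (x : nat -> C) (q : R) (n0 : nat) :
  (1 <= q)%R -> (forall n, (n0 <= n)%nat -> (Cmod (x (S n)) <= q * Cmod (x n))%R) ->
  exists K, forall n, (Cmod (x n) <= K * q ^ n)%R.
Proof.
  intros Hq H.
  assert (Hq1 : forall n, (1 <= q ^ n)%R) by (intros; now apply pow_R1_Rle).
  assert (HF : exists B, (0 <= B)%R /\ forall n, (n <= n0)%nat -> (Cmod (x n) <= B)%R).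
  { clear H; induction n0 as [|M [B [HB0 HB]]].
    - exists (Cmod (x O)); split; [apply Cmod_ge_0|].
      intros n Hn; replace n with O by lia; lra.
    - exists (B + Cmod (x (S M)))%R; assert (G := Cmod_ge_0 (x (S M))); split; [lra|].
      intros n Hn; destruct (Nat.eq_dec n (S M)) as [->|]; [lra|].
      specialize (HB n ltac:(lia)); lra. }
  destruct HF as [B [HB0 HB]]; exists B.
  assert (HK : forall k, (Cmod (x (n0 + k)%nat) <= B * q ^ k)%R).
  { induction k as [|k IH]; [rewrite Nat.add_0_r; simpl; rewrite Rmult_1_r; auto|].
    rewrite Nat.add_succ_r; eapply Rle_trans; [apply H; lia|].
    simpl; apply (Rmult_le_compat_l q) in IH; lra. }
  intros n; destruct (Nat.le_gt_cases n n0) as [Hn|Hn].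
  - specialize (HB n Hn); specialize (Hq1 n); nra.
  - replace n with (n0 + (n - n0))%nat at 1 by lia.
    eapply Rle_trans; [apply HK|].
    apply Rmult_le_compat_l; [exact HB0|apply Rle_pow; [exact Hq|lia]].
Qed.

Lemma Cmod_add_INR_le (a : C) (n : nat) :
  (Cmod (a + RtoC (INR n))%C <= Cmod a + INR n)%R.
Proof.
  eapply Rle_trans; [apply Cmod_triangle|].
  rewrite Cmod_R, Rabs_pos_eq by apply pos_INR; lra.
Qed.

Lemma Cmod_add_INR_ge (a : C) (n : nat) :
  (INR n - Cmod a <= Cmod (a + RtoC (INR n))%C)%R.
Proof.
  assert (G := Cmod_triangle (a + RtoC (INR n)) (- a)).
  replace (a + RtoC (INR n) + - a) with (RtoC (INR n)) in G by ring.
  rewrite Cmod_opp, Cmod_R, Rabs_pos_eq in G by apply pos_INR; lra.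
Qed.

(** The quotient of |a + n| by |c + n| tends to 1, so it is eventually below any q > 1. Clearing the
    denominator in the hypothesis allows c + n to vanish for some n, which occurs for sequences
    built from 1/Gamma. *)
Lemma geom_of_recurrence (x : nat -> C) (a c : C) (q : R) :
  (1 < q)%R ->
  (forall n, x (S n) * (c + RtoC (INR n)) = x n * (a + RtoC (INR n))) ->
  exists K, forall n, (Cmod (x n) <= K * q ^ n)%R.
Proof.
  intros Hq H.
  assert (Ha := Cmod_ge_0 a); assert (Hc := Cmod_ge_0 c).
  (* Beyond this threshold |a| + n < q (n - |c|). *)
  destruct (nfloor_ex ((Cmod a + q * Cmod c) / (q - 1))) as [N [_ HN]].
  { apply Rmult_le_pos; [nra|apply Rlt_le, Rinv_0_lt_compat; lra]. }
  apply (geom_of_ratio x q (S N) ltac:(lra)); intros n Hn.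
  apply le_INR in Hn; rewrite S_INR in Hn.
  assert (Hn2 : ((Cmod a + q * Cmod c) < INR n * (q - 1))%R).
  { apply (Rmult_lt_reg_r (/ (q - 1))); [apply Rinv_0_lt_compat; lra|].
    replace (INR n * (q - 1) * / (q - 1))%R with (INR n) by (field; lra).
    unfold Rdiv in HN; lra. }
  assert (E := f_equal Cmod (H n)); rewrite !Cmod_mult in E.
  assert (G1 := Cmod_add_INR_le a n); assert (G2 := Cmod_add_INR_ge c n).
  assert (Hpos : (0 < INR n - Cmod c)%R) by nra.
  apply (Rmult_le_reg_r (Cmod (c + RtoC (INR n)))); [lra|].
  rewrite E; assert (Hx := Cmod_ge_0 (x n)).
  assert (Cmod (a + RtoC (INR n))%C <= q * Cmod (c + RtoC (INR n))%C)%R by nra.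
  replace (q * Cmod (x n) * Cmod (c + RtoC (INR n))%C)%R
    with (Cmod (x n) * (q * Cmod (c + RtoC (INR n))%C))%R by ring.
  now apply Rmult_le_compat_l.
Qed.

Lemma bp_geom (a : C) (q : R) :
  (1 < q)%R -> exists K, forall n, (Cmod (bp a n) <= K * q ^ n)%R.
Proof.
  intros Hq; apply (geom_of_recurrence _ a 1 q Hq); intros n; rewrite bp_S.
  field; apply INR_S_C_neq_0.
Qed.

Lemma poch_ratio_geom (a c : C) (q : R) :
  not_pole c -> (1 < q)%R ->
  exists K, forall n, (Cmod (poch a n / poch c n)%C <= K * q ^ n)%R.
Proof.
  intros Hc Hq; apply (geom_of_recurrence (fun n => poch a n / poch c n) a c q Hq).
  intros n; simpl; field; split; auto using not_pole_neq_0, poch_neq_0.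
Qed.

Lemma dif_bp (e : C) (n p : nat) :
  dif n (bp e) p = poch (1 - e) n * poch e p / RtoC (INR (fact (p + n))).
Proof.
  revert p; induction n as [|n IH]; intros p.
  - simpl; rewrite Nat.add_0_r; unfold bp; field; apply INR_fact_C_neq_0.
  - change (dif (S n) (bp e) p) with (dif n (bp e) p - dif n (bp e) (S p)).
    rewrite !IH, Nat.add_succ_r; simpl (S p + n)%nat.
    rewrite INR_fact_S_C, plus_INR, RtoC_plus; simpl poch.
    field; split; [apply INR_fact_C_neq_0|].
    rewrite <- RtoC_plus, <- plus_INR; apply INR_S_C_neq_0.
Qed.

(** The quotients (a)_m/(c)_m are the moments of the beta density with exponents a - 1 and c - a -
    1; multiplying it by (1 - t)^l raises c - a by l. The induction proves the identity for all
    complex parameters, and [dif_bp] is the instance c = 1. *)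
Lemma dif_poch_ratio (a c : C) (l p : nat) :
  not_pole c ->
  dif l (fun m => poch a m / poch c m) p
  = poch a p * poch (c - a) l / poch c (p + l).
Proof.
  intros Hc; revert p; induction l as [|l IH]; intros p.
  - simpl; rewrite Nat.add_0_r; field; now apply poch_neq_0.
  - change (dif (S l) (fun m => poch a m / poch c m) p)
      with (dif l (fun m => poch a m / poch c m) p
            - dif l (fun m => poch a m / poch c m) (S p)).
    rewrite !IH, Nat.add_succ_r; simpl (S p + l)%nat; simpl poch.
    assert (H := not_pole_neq_0 c (p + l) Hc); rewrite plus_INR, RtoC_plus in *.
    field; split; [exact H|now apply poch_neq_0].
Qed.

Lemma half_pow (n : nat) : (/ RtoC 2) ^ n = RtoC ((/ 2) ^ n).
Proof. rewrite RtoC_pow, RtoC_inv by lra; reflexivity. Qed.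

Lemma half_geom (f : nat -> C) (K q : R) :
  (forall n, (Cmod (f n) <= K * q ^ n)%R) ->
  forall n, (Cmod ((/ 2) ^ n * f n)%C <= K * (q / 2) ^ n)%R.
Proof.
  intros H n; rewrite half_pow, Cmod_mult, Cmod_R.
  assert (Hp : (0 < (/ 2) ^ n)%R) by (apply pow_lt; lra).
  rewrite Rabs_pos_eq by lra; unfold Rdiv; rewrite Rpow_mult_distr.
  specialize (H n); apply (Rmult_le_compat_l ((/ 2) ^ n)) in H; lra.
Qed.

Lemma geom_mult (f g : nat -> C) (K1 K2 q1 q2 : R) :
  (forall n, (Cmod (f n) <= K1 * q1 ^ n)%R) ->
  (forall n, (Cmod (g n) <= K2 * q2 ^ n)%R) ->
  forall n, (Cmod (f n * g n)%C <= K1 * K2 * (q1 * q2) ^ n)%R.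
Proof.
  intros Hf Hg n; rewrite Cmod_mult, Rpow_mult_distr.
  replace (K1 * K2 * (q1 ^ n * q2 ^ n))%R with (K1 * q1 ^ n * (K2 * q2 ^ n))%R by ring.
  apply Rmult_le_compat; auto using Cmod_ge_0.
Qed.

(* Pfaff's transformation at [-1]: the Euler transform of
   [sum (-1)^m bp e m mu_m] is a Cauchy product, by the Leibniz rule. *)
Lemma pfaff_sum (e : C) (mu : nat -> C) (S0 L1 L2 : C) (K : R) :
  hassum (fun m => (-1) ^ m * (bp e m * mu m)) S0 ->
  (forall l, (Cmod (dif l mu 0) <= K * (5 / 4) ^ l)%R) ->
  hassum (fun l => (/ 2) ^ l * bp (1 - e) l) L1 ->
  hassum (fun l => (/ 2) ^ l * (bp e l * dif l mu 0)) L2 ->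
  S0 = / 2 * L1 * L2.
Proof.
  intros HS HK H1 H2.
  (* [hassum_cauchy] wants one common rate: 25/16 is the product of the rates of [bp e] and of the
     differences, and it is also given to [bp (1 - e)]. *)
  destruct (bp_geom e (5 / 4) ltac:(lra)) as [Ka Ha].
  destruct (bp_geom (1 - e) (25 / 16) ltac:(lra)) as [Kb Hb].
  assert (Hc := geom_mult _ _ _ _ _ _ Ha HK).
  replace (5 / 4 * (5 / 4))%R with (25 / 16)%R in Hc by field.
  assert (Hb' := half_geom _ _ _ Hb); assert (Hc' := half_geom _ _ _ Hc).
  assert (HC := hassum_cauchy _ _ _ _ _ _ (25 / 16 / 2) ltac:(lra) Hc' Hb' H2 H1).
  apply euler_summation in HS.
  apply (hassum_scal (/ 2)) in HC.
  replace (/ 2 * L1 * L2) with (/ 2 * (L2 * L1)) by ring.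
  eapply hassum_unique; [exact HS|].
  eapply hassum_ext; [|exact HC]; intros k; cbv beta.
  (* The difference of order k - l of [bp e] at l is (1-e)_{k-l} (e)_l / k!; its k! cancels against
     the binomial coefficient, and the term splits into a factor in l and one in k - l. *)
  rewrite dif_leibniz, bs_csum, <- !csum_scal.
  apply csum_ext; intros l Hl.
  rewrite Nat.add_0_l, dif_bp, binomC_fact; unfold bp.
  replace (l + (k - l))%nat with k by lia.
  replace ((/ 2) ^ S k) with (/ 2 * ((/ 2) ^ l * (/ 2) ^ (k - l))).
  - field; repeat split; apply INR_fact_C_neq_0.
  - rewrite <- Cpow_add_r; replace (l + (k - l))%nat with k by lia; reflexivity.
Qed.

(** * Hypergeometric coefficients and the Saalschütz sum *)

Definition hterm (a b c : C) (n : nat) : C :=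
  poch a n * poch b n / (poch c n * RtoC (INR (fact n))).

Lemma hterm_S (a b c : C) (n : nat) :
  not_pole c ->
  hterm a b c (S n)
  = hterm a b c n * (a + RtoC (INR n)) * (b + RtoC (INR n))
    / ((c + RtoC (INR n)) * (RtoC (INR n) + 1)).
Proof.
  intros Hc; unfold hterm; rewrite INR_fact_S_C; simpl poch.
  field; repeat split;
    auto using INR_fact_C_neq_0, INR_S_C_neq_0, poch_neq_0, not_pole_neq_0.
Qed.

(** Equivalent to the N-th coefficient of Euler's transformation (1 - z)^(a+b-c) 2F1(a, b; c; z) =
    2F1(c-a, c-b; c; z). Both sides satisfy the same first-order recurrence in N. *)
Lemma saalschutz (a b c : C) (N : nat) :
  not_pole c ->
  csum (fun n => bp (c - a - b) (N - n) * hterm a b c n) (S N) = hterm (c - a) (c - b) c N.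
Proof.
  intros Hc; induction N as [|N IH].
  - simpl; rewrite bp_0; unfold hterm; simpl; field.
  - rewrite hterm_S, <- IH by exact Hc; clear IH.
    set (e := c - a - b).
    (* WZ certificate *)
    set (G := fun n => - (RtoC (INR n) * (c + RtoC (INR n) - 1)
                          * hterm a b c n * bp e (S N - n))).
    (* At n = N + 1 the truncated N - n would be wrong; that top term is added separately and
       cancels the boundary value G (S N). *)
    assert (E : forall n, (n < S N)%nat ->
      (c + RtoC (INR N)) * (RtoC (INR N) + 1) * (bp e (S N - n) * hterm a b c n)
      = (c - a + RtoC (INR N)) * (c - b + RtoC (INR N)) * (bp e (N - n) * hterm a b c n)
        + (G (S n) - G n)).
    { intros n Hn; unfold G; rewrite hterm_S by exact Hc.
      replace (S N - S n)%nat with (N - n)%nat by lia.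
      replace (S N - n)%nat with (S (N - n)) by lia.
      rewrite bp_S, INR_S_C.
      replace (RtoC (INR N)) with (RtoC (INR (N - n)) + RtoC (INR n))
        by (rewrite <- RtoC_plus, <- plus_INR; do 2 f_equal; lia).
      unfold e; field; repeat split; auto using INR_S_C_neq_0, not_pole_neq_0. }
    assert (Hz : (c + RtoC (INR N)) * (RtoC (INR N) + 1) <> 0)
      by (apply Cmult_neq_0; auto using INR_S_C_neq_0, not_pole_neq_0).
    assert (T : (c + RtoC (INR N)) * (RtoC (INR N) + 1)
                * csum (fun n => bp e (S N - n) * hterm a b c n) (S (S N))
              = (c - a + RtoC (INR N)) * (c - b + RtoC (INR N))
                * csum (fun n => bp e (N - n) * hterm a b c n) (S N)).
    { change (csum (fun n => bp e (S N - n) * hterm a b c n) (S (S N)))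
        with (csum (fun n => bp e (S N - n) * hterm a b c n) (S N)
              + bp e (S N - S N) * hterm a b c (S N)).
      rewrite Cmult_plus_distr_l, <- !csum_scal, (csum_ext _ _ _ E), csum_plus,
        csum_telescope.
      unfold G; rewrite Nat.sub_diag, bp_0, INR_S_C; simpl (INR 0); ring. }
    transitivity (((c + RtoC (INR N)) * (RtoC (INR N) + 1)
                * csum (fun n => bp e (S N - n) * hterm a b c n) (S (S N)))
                / ((c + RtoC (INR N)) * (RtoC (INR N) + 1))).
    + field; split; auto using INR_S_C_neq_0, not_pole_neq_0.
    + rewrite T; field; split; auto using INR_S_C_neq_0, not_pole_neq_0.
Qed.

(** * The reciprocal Gamma function *)

Definition cexp (w : C) : C := RtoC (exp (Re w)) * (cos (Im w), sin (Im w)).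

Lemma cexp_add (v w : C) : cexp (v + w) = cexp v * cexp w.
Proof.
  destruct v as [a b], w as [c d]; unfold cexp; simpl.
  rewrite exp_plus, cos_plus, sin_plus.
  unfold Cmult, RtoC; simpl; f_equal; ring.
Qed.

Lemma cexp_0 : cexp 0 = 1.
Proof.
  unfold cexp; simpl; rewrite exp_0, cos_0, sin_0.
  unfold Cmult, RtoC; simpl; f_equal; ring.
Qed.

Lemma cexp_neq_0 (w : C) : cexp w <> 0.
Proof.
  intros H; assert (E := cexp_add w (- w)).
  replace (w + - w) with (RtoC 0) in E by ring.
  rewrite H, cexp_0, Cmult_0_l in E; apply RtoC_inj in E; lra.
Qed.

Lemma Rabs_sin_le (y : R) : (Rabs (sin y) <= Rabs y)%R.
Proof.
  assert (H : forall x, (0 <= x)%R -> (Rabs (sin x) <= x)%R).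
  { intros x Hx; destruct (MVT_gen sin 0 x cos) as [c [_ Hc]].
    - intros; apply is_derive_sin.
    - intros; apply continuity_sin.
    - rewrite sin_0, !Rminus_0_r in Hc; rewrite Hc, Rabs_mult, (Rabs_pos_eq x) by lra.
      assert (G := COS_bound c).
      assert (Rabs (cos c) <= 1)%R by (apply Rabs_le; lra); nra. }
  destruct (Rle_lt_dec 0 y) as [Hy|Hy].
  - rewrite (Rabs_pos_eq y) by lra; auto.
  - rewrite <- (Rabs_Ropp y), (Rabs_pos_eq (- y)), <- Rabs_Ropp, <- sin_neg by lra.
    apply H; lra.
Qed.

Lemma one_minus_cos_bounds (y : R) : (0 <= 1 - cos y <= y ^ 2 / 2)%R.
Proof.
  replace y with (2 * (y / 2))%R at 1 2 by field.
  rewrite cos_2a_sin.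
  assert (H := Rabs_sin_le (y / 2)); apply Rsqr_le_abs_1 in H; unfold Rsqr in H.
  assert (G := Rle_0_sqr (sin (y / 2))); unfold Rsqr in G.
  split; nra.
Qed.

Lemma Rabs_sin_minus_le (y : R) : (Rabs y <= 1)%R -> (Rabs (sin y - y) <= y ^ 2)%R.
Proof.
  intros Hy; destruct (MVT_gen sin 0 y cos) as [c [Hc1 Hc]].
  - intros; apply is_derive_sin.
  - intros; apply continuity_sin.
  - rewrite sin_0, !Rminus_0_r in Hc.
    assert (Hcy : (Rabs c <= Rabs y)%R).
    { unfold Rmin, Rmax in Hc1; destruct (Rle_dec 0 y);
        unfold Rabs; destruct (Rcase_abs c), (Rcase_abs y); lra. }
    replace (sin y - y)%R with (- ((1 - cos c) * y))%R by lra.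
    rewrite Rabs_Ropp, Rabs_mult.
    assert (G := one_minus_cos_bounds c).
    rewrite (Rabs_pos_eq (1 - cos c)) by lra.
    assert (Hsq : (c ^ 2 <= Rabs y)%R).
    { rewrite <- (pow2_abs c); assert (H := Rabs_pos c); nra. }
    rewrite <- (pow2_abs y); assert (H := Rabs_pos y); nra.
Qed.

(** From exp (-x) >= 1 - x one gets exp x <= 1/(1 - x), and (1 + x + 2x^2)(1 - x) = 1 + x^2 (1 - 2x)
    is at least 1 for x <= 1/2. *)
Lemma exp_minus_bounds (x : R) :
  (Rabs x <= 1 / 2)%R -> (0 <= exp x - 1 - x <= 2 * x ^ 2)%R.
Proof.
  intros Hx; apply Rabs_le_between in Hx.
  assert (H1 := exp_ineq1_le x); assert (H2 := exp_ineq1_le (- x)).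
  split; [lra|].
  assert (E : (exp x * exp (- x) = 1)%R)
    by (rewrite <- exp_plus, Rplus_opp_r; apply exp_0).
  assert (Hp := exp_pos x).
  assert (H3 : (exp x * (1 - x) <= 1)%R) by nra.
  assert (H4 : (exp x * (1 - x) <= (1 + x + 2 * x ^ 2) * (1 - x))%R) by nra.
  apply Rmult_le_reg_r in H4; lra.
Qed.

Lemma Cmod_le_abs (a b : R) : (Cmod (a, b) <= Rabs a + Rabs b)%R.
Proof.
  replace ((a, b) : C) with (RtoC a + Ci * RtoC b)
    by (unfold Ci, Cmult, Cplus, RtoC; simpl; f_equal; ring).
  eapply Rle_trans; [apply Cmod_triangle|].
  rewrite Cmod_mult, !Cmod_R, Cmod_Ci; lra.
Qed.

Lemma Cmod_cexp_minus_le (w : C) :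
  (Cmod w <= 1 / 2)%R -> (Cmod (cexp w - 1 - w)%C <= 3 * Cmod w ^ 2)%R.
Proof.
  intros Hw.
  assert (Hx := re_le_Cmod w).
  assert (Hy : (Rabs (Im w) <= Cmod w)%R).
  { eapply Rle_trans; [apply Rmax_r|apply Rmax_Cmod]. }
  rewrite Cmod2_alt; destruct w as [x y]; simpl Re in *; simpl Im in *.
  unfold cexp; simpl Re; simpl Im.
  replace (RtoC (exp x) * (cos y, sin y) - 1 - (x, y))
    with (((exp x - 1 - x) - exp x * (1 - cos y),
           (exp x - 1) * sin y + (sin y - y))%R : C)
    by (unfold Cmult, Cminus, Cplus, Copp, RtoC; simpl; f_equal; ring).
  eapply Rle_trans; [apply Cmod_le_abs|].
  assert (He := exp_minus_bounds x ltac:(lra)).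
  assert (Hc := one_minus_cos_bounds y).
  assert (Hs := Rabs_sin_le y); assert (Hs2 := Rabs_sin_minus_le y ltac:(lra)).
  assert (Hx2 : (Rabs x <= 1 / 2)%R) by lra.
  assert (Hxx := pow2_abs x); assert (Hyy := pow2_abs y).
  assert (Px := Rabs_pos x); assert (Py := Rabs_pos y).
  assert (Hx3 := proj1 (Rabs_le_between _ _) Hx2).
  assert (Hex : (0 < exp x <= 2)%R) by (split; [apply exp_pos|nra]).
  assert (F1 : (Rabs ((exp x - 1 - x) - exp x * (1 - cos y)) <= 2 * x ^ 2 + y ^ 2)%R).
  { apply Rabs_le; split; nra. }
  assert (F2 : (Rabs (exp x - 1) <= 2 * Rabs x)%R).
  { replace (exp x - 1)%R with (x + (exp x - 1 - x))%R by ring.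
    eapply Rle_trans; [apply Rabs_triang|]; rewrite (Rabs_pos_eq (exp x - 1 - x)) by lra.
    nra. }
  assert (F3 : (Rabs ((exp x - 1) * sin y + (sin y - y)) <= 2 * Rabs x * Rabs y + y ^ 2)%R).
  { eapply Rle_trans; [apply Rabs_triang|]; apply Rplus_le_compat; [|exact Hs2].
    rewrite Rabs_mult; apply Rmult_le_compat; auto using Rabs_pos. }
  assert (F4 : (0 <= (Rabs x - Rabs y) ^ 2)%R) by apply pow2_ge_0.
  nra.
Qed.

Lemma npowC_cexp (n : nat) (z : C) : npowC n z = cexp (z * RtoC (ln (INR n))).
Proof.
  unfold npowC, cexp; destruct z as [x y]; simpl.
  replace (x * ln (INR n) - y * 0)%R with (x * ln (INR n))%R by ring.
  replace (x * 0 + y * ln (INR n))%R with (y * ln (INR n))%R by ring; reflexivity.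
Qed.

Lemma npowC_neq_0 (n : nat) (z : C) : npowC n z <> 0.
Proof. rewrite npowC_cexp; apply cexp_neq_0. Qed.

Lemma npowC_add (n : nat) (z w : C) : npowC n (z + w) = npowC n z * npowC n w.
Proof. rewrite !npowC_cexp, <- cexp_add; f_equal; ring. Qed.

Lemma npowC_0 (n : nat) : npowC n 0 = 1.
Proof. rewrite npowC_cexp, Cmult_0_l; apply cexp_0. Qed.

Lemma npowC_mul (n m : nat) (z : C) :
  (0 < n)%nat -> (0 < m)%nat -> npowC (n * m) z = npowC n z * npowC m z.
Proof.
  intros Hn Hm; rewrite !npowC_cexp, <- cexp_add, mult_INR, ln_mult
    by now apply lt_0_INR.
  rewrite RtoC_plus; f_equal; ring.
Qed.

Lemma npowC_1 (n : nat) : (0 < n)%nat -> npowC n 1 = RtoC (INR n).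
Proof.
  intros Hn; rewrite npowC_cexp, Cmult_1_l; unfold cexp; simpl.
  rewrite exp_ln, cos_0, sin_0 by now apply lt_0_INR.
  unfold Cmult, RtoC; simpl; f_equal; ring.
Qed.

Lemma npowC_opp (n : nat) (z : C) : npowC n (- z) = / npowC n z.
Proof.
  assert (E : npowC n z * npowC n (- z) = 1).
  { rewrite <- npowC_add; replace (z + - z) with (RtoC 0) by ring; apply npowC_0. }
  replace (npowC n (- z)) with (npowC n z * npowC n (- z) / npowC n z)
    by (field; apply npowC_neq_0).
  rewrite E; field; apply npowC_neq_0.
Qed.

Lemma rsum_inv_sq (n : nat) : (rsum (fun k => / (INR k + 1) ^ 2) n <= 2)%R.
Proof.
  (* The subtracted term makes the induction work: 1/(n+1)^2 <= 2/(n+1) - 2/(n+2). *)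
  assert (H : (rsum (fun k => / (INR k + 1) ^ 2) n <= 2 - 2 / (INR n + 1))%R).
  { induction n as [|n IH]; [simpl; lra|].
    cbn [rsum]; rewrite S_INR; assert (Hn := pos_INR n).
    assert (E : (2 / (INR n + 1) - 2 / (INR n + 1 + 1) - / (INR n + 1) ^ 2
             = INR n / ((INR n + 1) ^ 2 * (INR n + 1 + 1)))%R) by (field; lra).
    assert (0 <= INR n / ((INR n + 1) ^ 2 * (INR n + 1 + 1)))%R.
    { apply Rmult_le_pos; [lra|apply Rlt_le, Rinv_0_lt_compat].
      apply Rmult_lt_0_compat; [apply pow_lt|]; lra. }
    lra. }
  assert (0 < 2 / (INR n + 1))%R; [|lra].
  apply Rdiv_lt_0_compat; [lra|assert (Hn := pos_INR n); lra].
Qed.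

(** Partial products are bounded by the exponential of the sum of the |e n|, so the increments x n *
    e n are absolutely summable. *)
Lemma cv_product (x e : nat -> C) (Q : R) (n0 : nat) :
  (0 <= Q)%R ->
  (forall n, (n0 <= n)%nat -> x (S n) = x n * (1 + e n)) ->
  (forall n, (n0 <= n)%nat -> (Cmod (e n) <= Q / (INR n + 1) ^ 2)%R) ->
  exists l, cv x l.
Proof.
  intros HQ Hx He.
  set (y := fun k => x (n0 + k)%nat); set (a := fun k => (Q / (INR k + 1) ^ 2)%R).
  assert (Hpos : forall k, (0 < (INR k + 1) ^ 2)%R)
    by (intros k; apply pow_lt; assert (H := pos_INR k); lra).
  assert (Ha0 : forall k, (0 <= a k)%R)
    by (intros k; apply Rmult_le_pos; [exact HQ|apply Rlt_le, Rinv_0_lt_compat, Hpos]).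
  assert (Hea : forall k, (Cmod (e (n0 + k)%nat) <= a k)%R).
  { intros k; eapply Rle_trans; [apply He; lia|].
    apply Rmult_le_compat_l; [exact HQ|apply Rinv_le_contravar; [apply Hpos|]].
    apply pow_incr; rewrite plus_INR; assert (H := pos_INR k); assert (H' := pos_INR n0); lra. }
  assert (Hsum : forall k, (rsum a k <= Q * 2)%R).
  { intros k; unfold a, Rdiv; rewrite rsum_scal.
    apply Rmult_le_compat_l; [exact HQ|apply rsum_inv_sq]. }
  assert (Hy : forall k, y (S k) = y k * (1 + e (n0 + k)%nat)).
  { intros k; unfold y; rewrite Nat.add_succ_r; apply Hx; lia. }
  assert (HB : forall k, (Cmod (y k) <= Cmod (y O) * exp (rsum a k))%R).
  { induction k as [|k IH]; [simpl; rewrite exp_0; lra|].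
    rewrite Hy, Cmod_mult; cbn [rsum]; rewrite exp_plus, <- Rmult_assoc.
    apply Rmult_le_compat; auto using Cmod_ge_0.
    eapply Rle_trans; [apply Cmod_triangle|]; rewrite Cmod_1.
    specialize (Hea k); assert (G := exp_ineq1_le (a k)); lra. }
  set (B := (Cmod (y O) * exp (Q * 2))%R).
  assert (HB2 : forall k, (Cmod (y k) <= B)%R).
  { intros k; eapply Rle_trans; [apply HB|].
    apply Rmult_le_compat_l; [apply Cmod_ge_0|].
    destruct (Rle_lt_or_eq_dec _ _ (Hsum k)) as [H|H];
      [apply Rlt_le, exp_increasing, H|rewrite H; lra]. }
  assert (HB0 : (0 <= B)%R) by (eapply Rle_trans; [apply Cmod_ge_0|apply (HB2 O)]).
  destruct (ex_hassum_bounded (fun k => y (S k) - y k) (B * (Q * 2))) as [l Hl].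
  { intros N; apply Rle_trans with (rsum (fun k => (B * a k)%R) N).
    - apply rsum_le; intros k _; rewrite Hy.
      replace (y k * (1 + e (n0 + k)%nat) - y k) with (y k * e (n0 + k)%nat) by ring.
      rewrite Cmod_mult; apply Rmult_le_compat; auto using Cmod_ge_0.
    - rewrite rsum_scal; apply Rmult_le_compat_l; auto. }
  exists (y O + l).
  assert (Hcv : cv y (y O + l)).
  { apply (cv_ext (fun n => y O + csum (fun k => y (S k) - y k) n)).
    - intros n; rewrite csum_telescope; ring.
    - apply cv_plus; [apply cv_const|exact Hl]. }
  intros eps Heps; destruct (Hcv eps Heps) as [N HN]; exists (n0 + N)%nat; intros n Hn.
  replace n with (n0 + (n - n0))%nat by lia; apply HN; lia.
Qed.

(** The reciprocal of [euler_seq]; the Pochhammer symbol stands in the numerator, so the sequence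
    converges for every z, including the poles of Gamma. *)
Definition rseq (z : C) (n : nat) : C :=
  poch z (S n) / (RtoC (INR (fact n)) * npowC n z).

(** The quotient of consecutive terms of [rseq]: (1 + z/(n+1)) (n/(n+1))^z. *)
Definition rfac (z : C) (n : nat) : C :=
  (1 + z / (RtoC (INR n) + 1)) * cexp (- (z * RtoC (ln ((INR n + 1) / INR n)))).

Lemma rseq_S (z : C) (n : nat) : (0 < n)%nat -> rseq z (S n) = rseq z n * rfac z n.
Proof.
  intros Hn; unfold rseq, rfac; rewrite INR_fact_S_C.
  assert (Hn0 : (0 < INR n)%R) by now apply lt_0_INR.
  replace (npowC (S n) z) with (npowC n z * cexp (z * RtoC (ln ((INR n + 1) / INR n)))).
  - set (t := RtoC (ln ((INR n + 1) / INR n))).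
    change (poch z (S (S n))) with (poch z (S n) * (z + RtoC (INR (S n)))).
    assert (E : cexp (z * t) * cexp (- (z * t)) = 1).
    { rewrite <- cexp_add; replace (z * t + - (z * t)) with (RtoC 0) by ring; apply cexp_0. }
    replace (cexp (- (z * t))) with (/ cexp (z * t)).
    + rewrite INR_S_C; field; repeat split;
        auto using INR_fact_C_neq_0, INR_S_C_neq_0, npowC_neq_0, cexp_neq_0.
    + replace (cexp (- (z * t))) with (cexp (z * t) * cexp (- (z * t)) / cexp (z * t))
        by (field; apply cexp_neq_0).
      rewrite E; field; apply cexp_neq_0.
  - rewrite !npowC_cexp, <- cexp_add, <- Cmult_plus_distr_l, <- RtoC_plus.
    do 3 f_equal; rewrite S_INR, ln_div by lra; ring.
Qed.

Lemma ln_ratio_bounds (n : R) :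
  (0 < n)%R -> (/ (n + 1) <= ln ((n + 1) / n) <= / n)%R.
Proof.
  intros Hn; assert (Hq : (0 < (n + 1) / n)%R) by (apply Rdiv_lt_0_compat; lra).
  split.
  - assert (H := exp_ineq1_le (- ln ((n + 1) / n))).
    rewrite exp_Ropp, exp_ln in H by exact Hq.
    replace (/ ((n + 1) / n))%R with (1 - / (n + 1))%R in H by (field; lra); lra.
  - assert (H := exp_ineq1_le (ln ((n + 1) / n))).
    rewrite exp_ln in H by exact Hq.
    replace ((n + 1) / n)%R with (1 + / n)%R in H at 2 by (field; lra); lra.
Qed.

(** With v = z/(n+1) and w = -z ln(1 + 1/n) the first-order terms cancel, v + w = O(1/n^2), and the
    rest is quadratic. The bound 1/2 keeps the factors away from 0, so that their inverses can be
    multiplied too. *)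
Lemma rfac_bound (z : C) : exists Q n0, (0 <= Q)%R /\ (0 < n0)%nat /\
  forall n, (n0 <= n)%nat ->
    (Cmod (rfac z n - 1)%C <= Q / (INR n + 1) ^ 2)%R /\
    (Q / (INR n + 1) ^ 2 <= 1 / 2)%R.
Proof.
  set (r := Cmod z); assert (Hr : (0 <= r)%R) by apply Cmod_ge_0.
  (* The summands bound v + w, v w and (1 + v) h, where h is the remainder of the exponential; 4
     comes from squaring 1/x <= 2/(x + 1). *)
  set (Q := (4 * (r + r ^ 2 + (1 + r) * (3 * r ^ 2)))%R).
  assert (HQ : (0 <= Q)%R) by (unfold Q; nra).
  (* 2 r ensures |w| <= 1/2, and 2 Q ensures Q/(n+1)^2 <= 1/2. *)
  destruct (nfloor_ex (2 * r + 2 * Q) ltac:(lra)) as [N [_ HN]].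
  exists Q, (S N); split; [exact HQ|split; [lia|]]; intros n Hn.
  apply le_INR in Hn; rewrite S_INR in Hn; assert (HN0 := pos_INR N).
  set (x := INR n) in *; assert (Hx : (1 <= x)%R) by lra.
  split.
  2:{ apply (Rmult_le_reg_r ((x + 1) ^ 2)); [apply pow_lt; lra|].
      unfold Rdiv; rewrite Rmult_assoc, Rinv_l, Rmult_1_r by (apply pow_nonzero; lra).
      nra. }
  destruct (ln_ratio_bounds x ltac:(lra)) as [T1 T2].
  unfold rfac; fold x; set (t := ln ((x + 1) / x)) in *.
  assert (Hix : (0 < / x)%R) by (apply Rinv_0_lt_compat; lra).
  assert (Hix1 : (0 < / (x + 1) <= / x)%R)
    by (split; [apply Rinv_0_lt_compat|apply Rinv_le_contravar]; lra).
  assert (Hix2 : (/ x <= 1)%R) by (rewrite <- Rinv_1; apply Rinv_le_contravar; lra).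
  set (w := - (z * RtoC t)).
  assert (Hw : (Cmod w <= r * / x)%R).
  { unfold w; rewrite Cmod_opp, Cmod_mult, Cmod_R, Rabs_pos_eq by lra.
    apply Rmult_le_compat_l; [exact Hr|lra]. }
  assert (Hw2 : (Cmod w <= 1 / 2)%R).
  { eapply Rle_trans; [exact Hw|]; apply (Rmult_le_reg_r x); [lra|].
    rewrite Rmult_assoc, Rinv_l; lra. }
  assert (He := Cmod_cexp_minus_le w Hw2); set (h := cexp w - 1 - w) in *.
  assert (Hx1C : RtoC x + 1 = RtoC (x + 1)) by (rewrite RtoC_plus; reflexivity).
  assert (Hx1n : RtoC (x + 1) <> 0) by (intros E; apply RtoC_inj in E; lra).
  rewrite Hx1C.
  set (v := z / RtoC (x + 1)).
  assert (Hv : (Cmod v <= r * / x)%R).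
  { unfold v; rewrite Cmod_div by exact Hx1n; rewrite Cmod_R, Rabs_pos_eq by lra.
    apply Rmult_le_compat_l; [exact Hr|lra]. }
  assert (Hvw : (Cmod (v + w)%C <= r * (/ x) ^ 2)%R).
  { replace (v + w) with (z * RtoC (/ (x + 1) - t)).
    - rewrite Cmod_mult, Cmod_R; apply Rmult_le_compat_l; [exact Hr|].
      rewrite Rabs_left1 by lra.
      apply Rle_trans with (/ x - / (x + 1))%R; [lra|].
      replace (/ x - / (x + 1))%R with (/ x * / (x + 1))%R by (field; lra).
      simpl; rewrite Rmult_1_r; apply Rmult_le_compat_l; lra.
    - unfold v, w; rewrite RtoC_minus, RtoC_inv by lra; field; exact Hx1n. }
  replace ((1 + v) * cexp w - 1) with ((v + w) + (v * w + (1 + v) * h))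
    by (unfold h; ring).
  assert (G1 : (Cmod (v * w)%C <= r ^ 2 * (/ x) ^ 2)%R).
  { rewrite Cmod_mult; replace (r ^ 2 * (/ x) ^ 2)%R with (r * / x * (r * / x))%R by ring.
    apply Rmult_le_compat; auto using Cmod_ge_0. }
  assert (G2 : (Cmod ((1 + v) * h)%C <= (1 + r) * (3 * r ^ 2) * (/ x) ^ 2)%R).
  { rewrite Cmod_mult.
    replace ((1 + r) * (3 * r ^ 2) * (/ x) ^ 2)%R
      with ((1 + r) * (3 * (r * / x) ^ 2))%R by ring.
    apply Rmult_le_compat; auto using Cmod_ge_0.
    - eapply Rle_trans; [apply Cmod_triangle|]; rewrite Cmod_1; nra.
    - eapply Rle_trans; [exact He|]; apply Rmult_le_compat_l; [lra|].
      apply pow_incr; split; [apply Cmod_ge_0|exact Hw]. }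
  eapply Rle_trans; [apply Cmod_triangle|].
  eapply Rle_trans; [apply Rplus_le_compat_l, Cmod_triangle|].
  apply Rle_trans with (Q / 4 * (/ x) ^ 2)%R.
  { unfold Q; lra. }
  replace (Q / (x + 1) ^ 2)%R with (Q / 4 * (2 * / (x + 1)) ^ 2)%R by (field; lra).
  apply Rmult_le_compat_l; [lra|]; apply pow_incr; split; [lra|].
  apply (Rmult_le_reg_r (x * (x + 1))); [nra|].
  replace (/ x * (x * (x + 1)))%R with (x + 1)%R by (field; lra).
  replace (2 * / (x + 1) * (x * (x + 1)))%R with (2 * x)%R by (field; lra); lra.
Qed.

Lemma rseq_ex_cv (z : C) : exists l, cv (rseq z) l.
Proof.
  destruct (rfac_bound z) as [Q [n0 [HQ [Hn0 H]]]].
  apply (cv_product (rseq z) (fun n => rfac z n - 1) Q n0 HQ).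
  - intros n Hn; rewrite rseq_S by lia; f_equal; ring.
  - intros n Hn; apply H, Hn.
Qed.

Lemma euler_seq_rseq (z : C) (n : nat) : not_pole z -> euler_seq z n = / rseq z n.
Proof.
  intros Hz; unfold euler_seq, rseq; field; repeat split;
    auto using poch_neq_0, INR_fact_C_neq_0, npowC_neq_0.
Qed.

(** Inverting the limit of [rseq] would presuppose that it is nonzero. The product criterion is
    applied to the inverse factors instead; with both limits at hand their product is 1, and the
    non-vanishing of [rGamma] follows. *)
Lemma euler_seq_ex_cv (z : C) : not_pole z -> exists l, cv (euler_seq z) l.
Proof.
  intros Hz; destruct (rfac_bound z) as [Q [n0 [HQ [Hn0 H]]]].
  assert (Hf : forall n, (n0 <= n)%nat -> (1 / 2 <= Cmod (rfac z n))%R).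
  { intros n Hn; destruct (H n Hn) as [H1 H2].
    assert (G := Cmod_triangle (rfac z n) (- (rfac z n - 1))).
    replace (rfac z n + - (rfac z n - 1)) with (RtoC 1) in G by ring.
    rewrite Cmod_1, Cmod_opp in G; lra. }
  assert (Hf0 : forall n, (n0 <= n)%nat -> rfac z n <> 0).
  { intros n Hn; apply Cmod_gt_0; specialize (Hf n Hn); lra. }
  apply (cv_product (euler_seq z) (fun n => / rfac z n - 1) (2 * Q) n0 ltac:(lra)).
  - intros n Hn; rewrite !euler_seq_rseq, rseq_S by (auto; lia).
    assert (Hr : rseq z n <> 0).
    { intros E; assert (G := euler_seq_rseq z n Hz).
      assert (G2 : euler_seq z n * rseq z n = 1).
      { unfold euler_seq, rseq; field; repeat split;
          auto using poch_neq_0, INR_fact_C_neq_0, npowC_neq_0. }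
      rewrite E, Cmult_0_r in G2; apply RtoC_inj in G2; lra. }
    field; split; auto.
  - intros n Hn; destruct (H n Hn) as [H1 H2]; specialize (Hf n Hn); specialize (Hf0 n Hn).
    replace (/ rfac z n - 1) with (- (rfac z n - 1) / rfac z n) by (field; exact Hf0).
    rewrite Cmod_div, Cmod_opp by exact Hf0.
    apply (Rmult_le_reg_r (Cmod (rfac z n))); [lra|].
    replace (Cmod (rfac z n - 1) / Cmod (rfac z n) * Cmod (rfac z n))%R
      with (Cmod (rfac z n - 1)%C) by (field; lra).
    replace (2 * Q / (INR n + 1) ^ 2)%R with (2 * (Q / (INR n + 1) ^ 2))%R
      by (field; assert (P := pos_INR n); lra).
    assert (P := Cmod_ge_0 (rfac z n - 1)); nra.
Qed.

Definition rGamma (z : C) : C :=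
  @lim C_CompleteNormedModule (filtermap (rseq z) eventually).

Lemma rseq_cv (z : C) : cv (rseq z) (rGamma z).
Proof.
  destruct (rseq_ex_cv z) as [l Hl]; unfold rGamma; now rewrite (lim_cv _ l Hl).
Qed.

Lemma CGamma_rGamma (z : C) : not_pole z -> CGamma z * rGamma z = 1.
Proof.
  intros Hz; destruct (euler_seq_ex_cv z Hz) as [l Hl].
  unfold CGamma; rewrite (lim_cv _ l Hl).
  apply (cv_unique (fun n => euler_seq z n * rseq z n)).
  - apply cv_mult; [exact Hl|apply rseq_cv].
  - apply (cv_ext (fun _ => RtoC 1)); [|apply cv_const].
    intros n; unfold euler_seq, rseq; field; repeat split;
      auto using poch_neq_0, INR_fact_C_neq_0, npowC_neq_0.
Qed.

Lemma rGamma_neq_0 (z : C) : not_pole z -> rGamma z <> 0.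
Proof.
  intros Hz E; assert (H := CGamma_rGamma z Hz); rewrite E, Cmult_0_r in H.
  apply RtoC_inj in H; lra.
Qed.

Lemma CGamma_inv (z : C) : not_pole z -> CGamma z = / rGamma z.
Proof.
  intros Hz; assert (H := CGamma_rGamma z Hz); assert (H0 := rGamma_neq_0 z Hz).
  replace (CGamma z) with (CGamma z * rGamma z / rGamma z) by (field; exact H0).
  rewrite H; field; exact H0.
Qed.

Lemma cv_inv_INR (a : C) : cv (fun n => a / RtoC (INR n)) 0.
Proof.
  apply cv_succ, (cv_of_le _ _ (fun n => (Cmod a * / (INR n + 1))%R)).
  - intros n.
    replace (a / RtoC (INR (S n)) - 0) with (a / RtoC (INR (S n))) by ring.
    assert (P := pos_INR n).
    rewrite Cmod_div, Cmod_R, S_INR, Rabs_pos_eq by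
      (rewrite ?INR_S_C; try apply INR_S_C_neq_0; lra); apply Rle_refl.
  - replace (Finite 0) with (Rbar_mult (Cmod a) 0) by (simpl; now rewrite Rmult_0_r).
    apply is_lim_seq_scal_l.
    apply (is_lim_seq_ext (fun n => / INR (S n))%R); [intros; now rewrite S_INR|].
    apply (is_lim_seq_incr_1 (fun n => / INR n)%R).
    apply (is_lim_seq_inv _ p_infty); [apply is_lim_seq_INR|discriminate].
Qed.

Lemma INR_C_neq_0 (n : nat) : (0 < n)%nat -> RtoC (INR n) <> 0.
Proof.
  intros Hn E; apply RtoC_inj in E; revert E; apply not_0_INR; lia.
Qed.

Lemma cv_shift_ratio (a : C) : cv (fun n => (a + RtoC (INR n)) / RtoC (INR n)) 1.
Proof.
  apply (cv_ext_from 1 (fun n => a / RtoC (INR n) + 1)).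
  - intros n Hn; field; now apply INR_C_neq_0.
  - apply (cv_eq _ (0 + 1)); [ring|].
    apply cv_plus; [apply cv_inv_INR|apply cv_const].
Qed.

Lemma cv_inv (u : nat -> C) (l : C) :
  l <> 0 -> cv u l -> cv (fun n => / u n) (/ l).
Proof.
  intros Hl H eps He.
  assert (Hm : (0 < Cmod l)%R) by now apply Cmod_gt_0.
  destruct (H (Cmod l / 2)%R ltac:(lra)) as [N1 H1].
  destruct (H (eps * (Cmod l * Cmod l / 2))%R) as [N2 H2].
  { apply Rmult_lt_0_compat; [exact He|nra]. }
  exists (max N1 N2); intros n Hn.
  specialize (H1 n ltac:(lia)); specialize (H2 n ltac:(lia)).
  assert (Hu : (Cmod l / 2 < Cmod (u n))%R).
  { assert (G := Cmod_triangle (u n) (- (u n - l))).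
    replace (u n + - (u n - l)) with l in G by ring; rewrite Cmod_opp in G; lra. }
  assert (Hu0 : u n <> 0) by (apply Cmod_gt_0; lra).
  replace (/ u n - / l) with (- (u n - l) / (u n * l)) by (field; auto).
  rewrite Cmod_div, Cmod_opp, Cmod_mult by now apply Cmult_neq_0.
  apply (Rmult_lt_reg_r (Cmod (u n) * Cmod l)); [nra|].
  unfold Rdiv; rewrite Rmult_assoc, Rinv_l, Rmult_1_r by nra.
  eapply Rlt_le_trans; [exact H2|].
  apply Rmult_le_compat_l; [lra|nra].
Qed.

Lemma rGamma_rec (z : C) : rGamma z = z * rGamma (z + 1).
Proof.
  apply (cv_unique (fun n => rseq z n * ((z + 1 + RtoC (INR n)) / RtoC (INR n)))).
  - rewrite <- (Cmult_1_r (rGamma z)).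
    apply cv_mult; [apply rseq_cv|apply cv_shift_ratio].
  - apply (cv_ext_from 1 (fun n => z * rseq (z + 1) n)); [|apply cv_scal, rseq_cv].
    intros n Hn; unfold rseq.
    assert (E : poch z (S n) * (z + 1 + RtoC (INR n)) = z * poch (z + 1) (S n)).
    { rewrite <- poch_head; change (poch z (S (S n)))
        with (poch z (S n) * (z + RtoC (INR (S n)))); rewrite INR_S_C; ring. }
    rewrite npowC_add, npowC_1 by lia.
    transitivity (z * poch (z + 1) (S n) / (RtoC (INR (fact n)) * (npowC n z * RtoC (INR n)))).
    + field; repeat split; auto using INR_fact_C_neq_0, npowC_neq_0, INR_C_neq_0.
    + rewrite <- E; field; repeat split; auto using INR_fact_C_neq_0, npowC_neq_0, INR_C_neq_0.
Qed.

Lemma rGamma_poch (z : C) (n : nat) : rGamma z = poch z n * rGamma (z + RtoC (INR n)).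
Proof.
  induction n as [|n IH]; [simpl; rewrite Cplus_0_r; ring|].
  rewrite IH, (rGamma_rec (z + RtoC (INR n))), INR_S_C, Cplus_assoc; simpl; ring.
Qed.

(** [rseq] with its last factor z + n removed and one power of n exchanged; z + n is nonzero once n
    exceeds |z|. *)
Lemma poch_asymptotic (z : C) :
  cv (fun n => poch z n / (RtoC (INR (fact n)) * npowC n (z - 1))) (rGamma z).
Proof.
  destruct (nfloor_ex (Cmod z) (Cmod_ge_0 z)) as [N [_ HN]].
  assert (Hz : forall n, (S N <= n)%nat -> z + RtoC (INR n) <> 0).
  { intros n Hn; apply Cmod_gt_0; assert (G := Cmod_add_INR_ge z n).
    apply le_INR in Hn; rewrite S_INR in Hn; lra. }
  apply (cv_ext_from (S N)
    (fun n => rseq z n * / ((z + RtoC (INR n)) / RtoC (INR n)))).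
  - intros n Hn; unfold rseq; simpl poch.
    replace (npowC n (z - 1)) with (npowC n z / RtoC (INR n)).
    + field; repeat split; auto using INR_fact_C_neq_0, npowC_neq_0.
      apply INR_C_neq_0; lia.
    + unfold Cminus; rewrite npowC_add, npowC_opp, npowC_1 by lia; reflexivity.
  - rewrite <- (Cmult_1_r (rGamma z)); apply cv_mult; [apply rseq_cv|].
    apply (cv_eq _ (/ 1)); [field|].
    apply cv_inv; [apply C1_nz|apply cv_shift_ratio].
Qed.

Lemma not_pole_pos (z : C) : (0 < Re z)%R -> not_pole z.
Proof.
  intros Hz k E; rewrite E in Hz; simpl in Hz; assert (H := pos_INR k); lra.
Qed.

Lemma ex_not_pole_add (z : C) : exists K, not_pole (z + RtoC (INR K)).
Proof.
  destruct (nfloor_ex (Cmod z) (Cmod_ge_0 z)) as [N [_ HN]].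
  exists (S N); apply not_pole_pos.
  assert (G := re_le_Cmod z); apply Rabs_le_between in G.
  change (Re (z + RtoC (INR (S N)))) with (Re z + INR (S N))%R; rewrite S_INR; lra.
Qed.

(** Away from the poles, divide 1/Gamma(z) = (z)_n / Gamma(z + n) by the previous asymptotics. At a
    pole that division is by 0, so the claim is carried down from z + 1 by the functional
    equation. *)
Lemma rGamma_asymptotic (z : C) :
  cv (fun n => RtoC (INR (fact n)) * npowC n (z - 1) * rGamma (z + RtoC (INR n))) 1.
Proof.
  assert (Hnp : forall z, not_pole z ->
    cv (fun n => RtoC (INR (fact n)) * npowC n (z - 1) * rGamma (z + RtoC (INR n))) 1).
  { clear z; intros z Hz; assert (H0 := rGamma_neq_0 z Hz).
    apply (cv_ext (fun n => rGamma z * / (poch z n / (RtoC (INR (fact n)) * npowC n (z - 1))))).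
    - intros n; rewrite (rGamma_poch z n); field; repeat split;
        auto using INR_fact_C_neq_0, npowC_neq_0, poch_neq_0.
    - apply (cv_eq _ (rGamma z * / rGamma z)); [field; exact H0|].
      apply cv_scal, cv_inv; [exact H0|apply poch_asymptotic]. }
  destruct (ex_not_pole_add z) as [K HK]; revert z HK.
  induction K as [|K IH]; intros z HK.
  - apply Hnp; simpl in HK; now rewrite Cplus_0_r in HK.
  - rewrite INR_S_C in HK.
    assert (H : not_pole (z + 1 + RtoC (INR K))).
    { replace (z + 1 + RtoC (INR K)) with (z + (RtoC (INR K) + 1)) by ring; exact HK. }
    specialize (IH _ H).
    apply (cv_ext_from 1 (fun n => RtoC (INR (fact n)) * npowC n (z + 1 - 1)
       * rGamma (z + 1 + RtoC (INR n)) * ((z + RtoC (INR n)) / RtoC (INR n)))).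
    + intros n Hn; rewrite (rGamma_rec (z + RtoC (INR n))).
      replace (z + RtoC (INR n) + 1) with (z + 1 + RtoC (INR n)) by ring.
      replace (z + 1 - 1) with ((z - 1) + 1) by ring.
      rewrite npowC_add, npowC_1 by lia; field; now apply INR_C_neq_0.
    + apply (cv_eq _ (1 * 1)); [ring|].
      apply cv_mult; [exact IH|apply cv_shift_ratio].
Qed.

(** * The hypergeometric series at 1/2 *)

Lemma hassum_head (f : nat -> C) (l : C) :
  hassum f l -> hassum (fun n => f (S n)) (l - f O).
Proof.
  intros H; apply (cv_ext (fun n => csum f (S n) - f O)).
  - intros n; rewrite csum_head; ring.
  - apply cv_minus; [|apply cv_const].
    apply (cv_subseq S (csum f)); [intros; lia|exact H].
Qed.

Lemma hassum_term_cv (f : nat -> C) (l : C) : hassum f l -> cv f 0.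
Proof.
  intros H; apply (cv_ext (fun n => csum f (S n) - csum f n)).
  - intros n; simpl; ring.
  - apply (cv_eq _ (l - l)); [ring|apply cv_minus; [|exact H]].
    apply (cv_subseq S (csum f)); [intros; lia|exact H].
Qed.

Lemma hassum_telescope (X : nat -> C) :
  X O = 0 -> cv (fun n => X (S n)) 0 -> hassum (fun n => X n - X (S n)) 0.
Proof.
  intros H0 H; apply (cv_ext (fun n => (-1) * X n)).
  - intros n; transitivity (-1 * csum (fun k => X (S k) - X k) n).
    + rewrite csum_telescope, H0; ring.
    + rewrite <- csum_scal; apply csum_ext; intros; ring.
  - apply (cv_eq _ ((-1) * 0)); [ring|]; apply cv_scal, cv_succ, H.
Qed.

(* The regularized series 2F1(p, b; c; 1/2) / Gamma(c): unlike 2F1 it makes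
   sense for every c, so the contiguity relations may pass through poles of c. *)
Definition hgF_term (p b c : C) (n : nat) : C :=
  (/ 2) ^ n * (bp p n * (poch b n * rGamma (c + RtoC (INR n)))).

Lemma hgF_term_geom (p b c : C) :
  exists K, forall n, (Cmod (hgF_term p b c n) <= K * (25 / 32) ^ n)%R.
Proof.
  destruct (bp_geom p (5 / 4) ltac:(lra)) as [K1 H1].
  destruct (geom_of_recurrence (fun n => poch b n * rGamma (c + RtoC (INR n))) b c (5 / 4))
    as [K2 H2]; [lra| |].
  { intros n; rewrite (rGamma_rec (c + RtoC (INR n))), INR_S_C, Cplus_assoc; simpl; ring. }
  exists (K1 * K2)%R.
  assert (H := half_geom _ _ _ (geom_mult _ _ _ _ _ _ H1 H2)).
  replace (5 / 4 * (5 / 4) / 2)%R with (25 / 32)%R in H by field; exact H.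
Qed.

Definition hgF (p b c : C) : C := tsum (hgF_term p b c).

Lemma hgF_hassum (p b c : C) : hassum (hgF_term p b c) (hgF p b c).
Proof.
  destruct (hgF_term_geom p b c) as [K HK].
  apply tsum_hassum, (ex_hassum_geom _ K (25 / 32) ltac:(lra) HK).
Qed.

Lemma poch_shift (p : C) (n : nat) : p * poch (p + 1) n = poch p n * (p + RtoC (INR n)).
Proof. now rewrite <- poch_head. Qed.

(** Holds term by term: p (p+1)_n = (p)_n (p + n), and p + n = (c + n) - (c - p), where c + n is
    absorbed by the recurrence of 1/Gamma. *)
Lemma hgF_contiguous_numerator (p b c : C) :
  p * hgF (p + 1) b (c + 1) = hgF p b c - (c - p) * hgF p b (c + 1).
Proof.
  apply (hassum_unique (fun n => p * hgF_term (p + 1) b (c + 1) n)).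
  - apply hassum_scal, hgF_hassum.
  - eapply hassum_ext; [|apply hassum_minus;
      [apply hgF_hassum|apply hassum_scal, hgF_hassum]].
    intros n; unfold hgF_term; cbv beta; rewrite (rGamma_rec (c + RtoC (INR n))).
    replace (c + RtoC (INR n) + 1) with (c + 1 + RtoC (INR n)) by ring.
    assert (E : p * bp (p + 1) n = bp p n * (p + RtoC (INR n))).
    { unfold bp; transitivity (p * poch (p + 1) n / RtoC (INR (fact n))).
      - field; apply INR_fact_C_neq_0.
      - rewrite poch_shift; field; apply INR_fact_C_neq_0. }
    transitivity ((/ 2) ^ n * (p * bp (p + 1) n * (poch b n * rGamma (c + 1 + RtoC (INR n)))));
      [rewrite E|]; ring.
Qed.

(** Gauss's relation c (1 - z) F(b+1; c) = c F(b; c) - (c - p) z F(b+1; c+1) at z = 1/2. It holds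
    only after summation, so the terms are corrected by a telescoping difference. *)
Lemma hgF_contiguous_doubling (p b c : C) :
  2 * hgF p b c = hgF p (b + 1) c + (c - p) * hgF p (b + 1) (c + 1).
Proof.
  (* The certificate is itself a convergent series shifted by one index, so it starts at 0 and tends
     to 0. *)
  set (X := fun n => match n with O => RtoC 0 | S k => p * hgF_term (p + 1) (b + 1) (c + 1) k end).
  assert (HX : hassum (fun n => X n - X (S n)) 0).
  { apply hassum_telescope; [reflexivity|].
    apply (cv_eq _ (p * 0)); [ring|]; apply cv_scal.
    eapply hassum_term_cv, hgF_hassum. }
  replace (2 * hgF p b c) with (2 * hgF p b c + 0) by ring.
  apply (hassum_unique (fun n => 2 * hgF_term p b c n + (X n - X (S n)))).
  - apply hassum_plus; [apply hassum_scal, hgF_hassum|exact HX].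
  - eapply hassum_ext; [|apply hassum_plus;
      [apply hgF_hassum|apply hassum_scal, hgF_hassum]].
    intros n; cbv beta.
    destruct n as [|k]; unfold X, hgF_term.
    + simpl; rewrite !bp_0, !Cplus_0_r, (rGamma_rec c); ring.
    + rewrite (rGamma_rec (c + RtoC (INR (S k)))).
      replace (c + RtoC (INR (S k)) + 1) with (c + 1 + RtoC (INR (S k))) by ring.
      rewrite (poch_head b k).
      unfold bp; rewrite (poch_head p k).
      replace (poch (p + 1) (S k)) with (poch (p + 1) k * (p + 1 + RtoC (INR k)))
        by reflexivity.
      replace (poch (b + 1) (S k)) with (poch (b + 1) k * (b + 1 + RtoC (INR k)))
        by reflexivity.
      rewrite (rGamma_rec (c + 1 + RtoC (INR k))).
      replace (c + 1 + RtoC (INR k) + 1) with (c + 1 + RtoC (INR (S k)))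
        by (rewrite INR_S_C; ring).
      rewrite INR_fact_S_C, INR_S_C; simpl Cpow.
      field; auto using INR_fact_C_neq_0, INR_S_C_neq_0.
Qed.

(** The three-term relation linking c - 1, c, c + 1 has middle coefficient c - 1 - (2c - p - b - 1)
    z up to a factor c. At z = 1/2 this is (p + b - 1)/2, which vanishes exactly for p = 1 - b. *)
Lemma hgF_bailey_rec (b c : C) :
  hgF (1 - b) b c = (c + b) * (1 + c - b) * hgF (1 - b) b (c + 2).
Proof.
  set (X := fun n => match n with
                     | O => RtoC 0
                     | S k => (1 - b) * b * hgF_term (1 - b + 1) (b + 1) (c + 2) k end).
  assert (HX : hassum (fun n => X n - X (S n)) 0).
  { apply hassum_telescope; [reflexivity|].
    apply (cv_eq _ ((1 - b) * b * 0)); [ring|]; apply cv_scal.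
    eapply hassum_term_cv, hgF_hassum. }
  replace ((c + b) * (1 + c - b) * hgF (1 - b) b (c + 2))
    with ((c + b) * (1 + c - b) * hgF (1 - b) b (c + 2) + 0) by ring.
  apply (hassum_unique (hgF_term (1 - b) b c)); [apply hgF_hassum|].
  eapply hassum_ext; [|apply hassum_plus;
      [apply hassum_scal, hgF_hassum|exact HX]].
  intros n; cbv beta.
  destruct n as [|k]; unfold X, hgF_term.
  - simpl; rewrite !bp_0, !Cplus_0_r, (rGamma_rec c), (rGamma_rec (c + 1)).
    replace (c + 1 + 1) with (c + 2) by ring; ring.
  - rewrite (rGamma_rec (c + RtoC (INR (S k)))), (rGamma_rec (c + RtoC (INR (S k)) + 1)).
    rewrite (rGamma_rec (c + 2 + RtoC (INR k))).
    replace (c + RtoC (INR (S k)) + 1 + 1) with (c + 2 + RtoC (INR (S k))) by ring.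
    replace (c + 2 + RtoC (INR k) + 1) with (c + 2 + RtoC (INR (S k)))
      by (rewrite INR_S_C; ring).
    unfold bp; rewrite !(poch_head b k), !(poch_head (1 - b) k).
    replace (poch (1 - b + 1) (S k)) with (poch (1 - b + 1) k * (1 - b + 1 + RtoC (INR k)))
      by reflexivity.
    replace (poch (b + 1) (S k)) with (poch (b + 1) k * (b + 1 + RtoC (INR k)))
      by reflexivity.
    rewrite INR_fact_S_C, INR_S_C; simpl Cpow.
    field; auto using INR_fact_C_neq_0, INR_S_C_neq_0.
Qed.

Lemma C2_neq_0 : RtoC 2 <> 0.
Proof. intros E; apply RtoC_inj in E; lra. Qed.

Lemma INR_double_C (N : nat) : RtoC (INR (2 * N)) = 2 * RtoC (INR N).
Proof. rewrite mult_INR, RtoC_mult; reflexivity. Qed.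

Lemma hgF_bailey_iter (b c : C) (N : nat) :
  hgF (1 - b) b c
  = 4 ^ N * poch ((c + b) / 2) N * poch ((1 + c - b) / 2) N
    * hgF (1 - b) b (c + RtoC (INR (2 * N))).
Proof.
  induction N as [|N IH].
  - simpl; rewrite Cplus_0_r; ring.
  - rewrite IH, hgF_bailey_rec.
    replace (c + RtoC (INR (2 * S N))) with (c + RtoC (INR (2 * N)) + 2).
    + rewrite INR_double_C; simpl Cpow; simpl poch; field; apply C2_neq_0.
    + replace (2 * S N)%nat with (S (S (2 * N))) by lia; rewrite !INR_S_C; ring.
Qed.

Lemma poch_double (a : C) (N : nat) :
  poch a (2 * N) = 4 ^ N * poch (a / 2) N * poch ((1 + a) / 2) N.
Proof.
  induction N as [|N IH]; [simpl; ring|].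
  replace (2 * S N)%nat with (S (S (2 * N))) by lia.
  change (poch a (S (S (2 * N)))) with
    (poch a (2 * N) * (a + RtoC (INR (2 * N))) * (a + RtoC (INR (S (2 * N))))).
  rewrite IH, INR_S_C, INR_double_C; simpl Cpow; simpl poch; field; apply C2_neq_0.
Qed.

(** * Behaviour for large c, and Bailey's value *)

Lemma Cmod_poch_ge (w : C) (n : nat) :
  (1 <= Re w)%R -> (INR (fact n) <= Cmod (poch w n))%R.
Proof.
  intros Hw; induction n as [|n IH]; [simpl; rewrite Cmod_1; lra|].
  rewrite fact_simpl, mult_INR; simpl poch; rewrite Cmod_mult, Rmult_comm.
  apply Rmult_le_compat; try apply pos_INR; [exact IH|].
  assert (G := re_le_Cmod (w + RtoC (INR n))); apply Rabs_le_between in G.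
  change (Re (w + RtoC (INR n))) with (Re w + INR n)%R in G; rewrite S_INR; lra.
Qed.

(** Since |(w+k)_n| >= n!, the terms are dominated independently of k by those with [bp b]; each
    term with n > 0 is O(1/(k+1)), so only the term n = 0 survives. *)
Lemma hassum_hterm_limit (p b w : C) (h : nat -> C) :
  (1 <= Re w)%R ->
  (forall k, hassum (fun n => (/ 2) ^ n * (bp p n * (poch b n / poch (w + RtoC (INR k)) n))) (h k)) ->
  cv h 1.
Proof.
  intros Hw Hh.
  destruct (bp_geom p (5 / 4) ltac:(lra)) as [K1 H1].
  destruct (bp_geom b (5 / 4) ltac:(lra)) as [K2 H2].
  assert (Hre : forall k, (INR k + 1 <= Re (w + RtoC (INR k)))%R).
  { intros k; change (Re (w + RtoC (INR k))) with (Re w + INR k)%R; lra. }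
  assert (Hre1 : forall k, (1 <= Re (w + RtoC (INR k)))%R).
  { intros k; specialize (Hre k); assert (P := pos_INR k); lra. }
  assert (Hnz : forall k n, poch (w + RtoC (INR k)) n <> 0).
  { intros k n; apply poch_neq_0, not_pole_pos; specialize (Hre1 k); lra. }
  assert (Hfp : forall n, (0 < INR (fact n))%R) by (intros; apply lt_0_INR, lt_O_fact).
  assert (Hr : forall k n, (Cmod (poch b n / poch (w + RtoC (INR k)) n)%C <= K2 * (5 / 4) ^ n)%R).
  { intros k n; eapply Rle_trans; [|apply H2].
    unfold bp; rewrite !Cmod_div by auto using INR_fact_C_neq_0.
    apply Rmult_le_compat_l; [apply Cmod_ge_0|].
    rewrite Cmod_R, Rabs_pos_eq by (apply Rlt_le, Hfp).
    apply Rinv_le_contravar; [apply Hfp|apply Cmod_poch_ge, Hre1]. }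
  apply (hassum_tannery
    (fun n k => (/ 2) ^ n * (bp p n * (poch b n / poch (w + RtoC (INR k)) n)))
    (fun n => match n with O => RtoC 1 | _ => RtoC 0 end) h 1
    (K1 * K2) (5 / 4 * (5 / 4) / 2)); [lra| | |exact Hh|].
  - intros n k; apply (half_geom (fun n => bp p n * (poch b n / poch (w + RtoC (INR k)) n))).
    intros m; apply (geom_mult _ _ K1 K2 (5 / 4) (5 / 4) H1 (Hr k)).
  - intros [|n].
    + apply (cv_ext (fun _ => RtoC 1)); [|apply cv_const].
      intros k; simpl; rewrite bp_0; field.
    + set (Z := (/ 2) ^ S n * (bp p (S n) * poch b (S n))).
      apply (cv_of_le _ _ (fun k => (Cmod Z / INR (fact n) * / (INR k + 1))%R)).
      * intros k; replace ((/ 2) ^ S n * (bp p (S n)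
            * (poch b (S n) / poch (w + RtoC (INR k)) (S n))) - 0)
          with (Z / poch (w + RtoC (INR k)) (S n)) by (unfold Z; field; apply Hnz).
        rewrite Cmod_div by apply Hnz; unfold Rdiv; rewrite Rmult_assoc.
        apply Rmult_le_compat_l; [apply Cmod_ge_0|].
        assert (P := pos_INR k); assert (F := Hfp n).
        rewrite <- Rinv_mult; apply Rinv_le_contravar; [nra|].
        rewrite poch_head, Cmod_mult, Rmult_comm.
        apply Rmult_le_compat; [lra|lra| |].
        -- assert (G := re_le_Cmod (w + RtoC (INR k))); apply Rabs_le_between in G.
           specialize (Hre k); lra.
        -- apply Cmod_poch_ge.
           change (Re (w + RtoC (INR k) + 1)) with (Re (w + RtoC (INR k)) + 1)%R.
           specialize (Hre1 k); lra.
      * apply (is_lim_seq_ext (fun k => (Cmod Z / INR (fact n) * / INR (S k))%R));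
          [intros; now rewrite S_INR|].
        replace (Finite 0) with (Rbar_mult (Cmod Z / INR (fact n))%R 0)
          by (simpl; now rewrite Rmult_0_r).
        apply is_lim_seq_scal_l, (is_lim_seq_incr_1 (fun n => / INR n)%R).
        apply (is_lim_seq_inv _ p_infty); [apply is_lim_seq_INR|discriminate].
  - apply cv_succ, (cv_ext (fun _ => RtoC 1)); [|apply cv_const].
    intros n; induction n as [|n IH]; [simpl; ring|].
    change (RtoC 1 = csum (fun n => match n with O => RtoC 1 | _ => RtoC 0 end) (S n) + 0).
    rewrite <- IH; ring.
Qed.

Lemma hgF_asymptotic (p b c : C) :
  cv (fun M => RtoC (INR (fact M)) * npowC M (c - 1) * hgF p b (c + RtoC (INR M))) 1.
Proof.
  destruct (nfloor_ex (Cmod c) (Cmod_ge_0 c)) as [N [_ HN]].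
  (* Past this shift the real part is at least 1, so 1/Gamma is nonzero there and may be divided
     out. *)
  set (M0 := S (S N)).
  assert (Hw : (1 <= Re (c + RtoC (INR M0)))%R).
  { assert (G := re_le_Cmod c); apply Rabs_le_between in G.
    change (Re (c + RtoC (INR M0))) with (Re c + INR M0)%R; unfold M0.
    rewrite !S_INR; lra. }
  set (w := c + RtoC (INR M0)) in *.
  assert (Hnp : forall k, not_pole (w + RtoC (INR k))).
  { intros k; apply not_pole_pos.
    change (Re (w + RtoC (INR k))) with (Re w + INR k)%R; assert (P := pos_INR k); lra. }
  set (h := fun k => / rGamma (w + RtoC (INR k)) * hgF p b (w + RtoC (INR k))).
  assert (Hh : cv h 1).
  { apply (hassum_hterm_limit p b w h Hw); intros k.
    eapply hassum_ext; [|apply hassum_scal, hgF_hassum].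
    intros n; unfold hgF_term; cbv beta.
    rewrite (rGamma_poch (w + RtoC (INR k)) n); field; split;
      [now apply poch_neq_0|now apply rGamma_neq_0, not_pole_add]. }
  assert (H : cv (fun k => RtoC (INR (fact (M0 + k))) * npowC (M0 + k) (c - 1)
                * rGamma (c + RtoC (INR (M0 + k))) * h k) 1).
  { apply (cv_eq _ (1 * 1)); [ring|]; apply cv_mult; [|exact Hh].
    apply (cv_subseq (fun k => (M0 + k)%nat)
      (fun n => RtoC (INR (fact n)) * npowC n (c - 1) * rGamma (c + RtoC (INR n)))).
    - intros; lia.
    - apply rGamma_asymptotic. }
  intros eps He; destruct (H eps He) as [K HK]; exists (M0 + K)%nat; intros n Hn.
  specialize (HK (n - M0)%nat ltac:(lia)).
  replace (M0 + (n - M0))%nat with n in HK by lia.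
  unfold h in HK.
  replace (w + RtoC (INR (n - M0))) with (c + RtoC (INR n)) in HK.
  - replace (RtoC (INR (fact n)) * npowC n (c - 1) * hgF p b (c + RtoC (INR n)))
      with (RtoC (INR (fact n)) * npowC n (c - 1) * rGamma (c + RtoC (INR n))
            * (/ rGamma (c + RtoC (INR n)) * hgF p b (c + RtoC (INR n)))); [exact HK|].
    field; apply rGamma_neq_0.
    replace (c + RtoC (INR n)) with (w + RtoC (INR (n - M0))); [apply Hnp|].
    unfold w; rewrite <- Cplus_assoc, <- RtoC_plus, <- plus_INR; do 3 f_equal; lia.
  - unfold w; rewrite <- Cplus_assoc, <- RtoC_plus, <- plus_INR; do 3 f_equal; lia.
Qed.

(** The left side equals its N-fold iterate for every N, and the factors of the iterate have known
    asymptotics. The symbol ((1+a)/2)_N is traded by duplication for (a)_{2N}/(a/2)_N, which yields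
    the shape needed for the final sums. *)
Lemma hgF_bailey (a b : C) :
  not_pole (a / 2) ->
  hgF (1 - b) b (1 + a - b)
  = npowC 2 (b - 1) * rGamma a * rGamma (a / 2 - b + 1) * CGamma (a / 2).
Proof.
  intros Ha; set (c := 1 + a - b).
  assert (H0 := rGamma_neq_0 _ Ha).
  assert (H1 := hgF_asymptotic (1 - b) b c).
  apply (cv_subseq (fun n => (2 * n)%nat)) in H1; [|intros; lia].
  assert (H2 := poch_asymptotic a).
  apply (cv_subseq (fun n => (2 * n)%nat)) in H2; [|intros; lia].
  assert (H3 := poch_asymptotic (a / 2 - b + 1)).
  assert (H4 := cv_inv _ _ H0 (poch_asymptotic (a / 2))).
  assert (H := cv_scal (npowC 2 (b - 1)) _ _
                 (cv_mult _ _ _ _ H1 (cv_mult _ _ _ _ H2 (cv_mult _ _ _ _ H3 H4)))).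
  rewrite CGamma_inv by exact Ha.
  replace (npowC 2 (b - 1) * rGamma a * rGamma (a / 2 - b + 1) * / rGamma (a / 2))
    with (npowC 2 (b - 1) * (1 * (rGamma a * (rGamma (a / 2 - b + 1) * / rGamma (a / 2)))))
    by ring.
  eapply cv_unique; [apply cv_const|].
  eapply cv_ext_from; [|exact H].
  instantiate (1 := 1%nat); intros N HN; cbv beta.
  (* The series is taken at 2N and (a/2 - b + 1)_N at N: (2N)^(1-b) against N^(1-b) leaves 2^(1-b),
     which the prefactor removes. *)
  rewrite (hgF_bailey_iter b c N), poch_double.
  replace ((c + b) / 2) with ((1 + a) / 2) by (unfold c; f_equal; ring).
  replace ((1 + c - b) / 2) with (a / 2 - b + 1) by (unfold c; field; apply C2_neq_0).
  replace (c - 1) with ((a - 1) + (1 - b)) by (unfold c; ring).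
  replace (a / 2 - b + 1 - 1) with ((a / 2 - 1) + (1 - b)) by ring.
  replace (b - 1) with (- (1 - b)) by ring.
  rewrite !npowC_add, npowC_opp, (npowC_mul 2 N (1 - b)) by lia.
  field; repeat split;
    auto using INR_fact_C_neq_0, npowC_neq_0, poch_neq_0.
Qed.

Lemma poch_1 (n : nat) : poch 1 n = RtoC (INR (fact n)).
Proof.
  induction n as [|n IH]; [reflexivity|].
  rewrite INR_fact_S_C; simpl poch; rewrite IH; ring.
Qed.

Lemma fact_double (N : nat) :
  RtoC (INR (fact (2 * N))) = 4 ^ N * poch (1 / 2) N * RtoC (INR (fact N)).
Proof.
  rewrite <- !poch_1, poch_double.
  replace ((1 + 1) / 2) with (RtoC 1) by (field; apply C2_neq_0); ring.
Qed.

(** The binomial series (1 - z)^(-w) at 1/2. For c = b the regularized series reduces to it, so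
    Bailey's recurrence evaluates it without any theory of complex powers. *)
Lemma hassum_bp_half (w : C) :
  hassum (fun n => (/ 2) ^ n * bp w n) (npowC 2 w).
Proof.
  assert (Hex : forall w, exists l, hassum (fun n => (/ 2) ^ n * bp w n) l).
  { intros v; destruct (bp_geom v (5 / 4) ltac:(lra)) as [K HK].
    apply (ex_hassum_geom _ K (5 / 4 / 2) ltac:(lra)), half_geom, HK. }
  assert (Hnp : forall w, not_pole (1 - w) ->
            hassum (fun n => (/ 2) ^ n * bp w n) (npowC 2 w)).
  { intros v Hv; set (b := 1 - v) in *.
    assert (H0 := rGamma_neq_0 b Hv).
    destruct (Hex v) as [L HL].
    assert (E1 : hgF (1 - b) b b = rGamma b * L).
    { apply (hassum_unique (hgF_term (1 - b) b b)); [apply hgF_hassum|].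
      eapply hassum_ext; [|apply hassum_scal, HL].
      intros n; unfold hgF_term; cbv beta; rewrite (rGamma_poch b n).
      replace (1 - b) with v by (unfold b; ring); ring. }
    assert (E2 : hgF (1 - b) b b = npowC 2 v * (1 * rGamma b)).
    { assert (H1 := hgF_asymptotic (1 - b) b b).
      apply (cv_subseq (fun n => (2 * n)%nat)) in H1; [|intros; lia].
      assert (H := cv_scal (npowC 2 v) _ _ (cv_mult _ _ _ _ H1 (poch_asymptotic b))).
      eapply cv_unique; [apply cv_const|].
      eapply cv_ext_from; [|exact H].
      instantiate (1 := 1%nat); intros N HN; cbv beta.
      rewrite (hgF_bailey_iter b b N), fact_double.
      replace ((b + b) / 2) with b by (field; apply C2_neq_0).
      replace ((1 + b - b) / 2) with (1 / 2) by (f_equal; ring).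
      rewrite (npowC_mul 2 N) by lia.
      replace (b - 1) with (- v) by (unfold b; ring).
      rewrite !npowC_opp; field; repeat split;
        auto using INR_fact_C_neq_0, npowC_neq_0. }
    replace (npowC 2 v) with L; [exact HL|].
    replace L with (rGamma b * L / rGamma b) by (field; exact H0).
    rewrite <- E1, E2; field; exact H0. }
  (* When 1 - w is a pole, w is lowered until it is not; the step from w - 1 to w is multiplication
     of the series by 1 - z, that is by 1/2. *)
  destruct (ex_not_pole_add (1 - w)) as [K HK]; revert w HK.
  induction K as [|K IH]; intros w HK.
  - apply Hnp; simpl in HK; now rewrite Cplus_0_r in HK.
  - rewrite INR_S_C in HK.
    assert (IHw : hassum (fun n => (/ 2) ^ n * bp (w - 1) n) (npowC 2 (w - 1))).
    { apply IH; replace (1 - (w - 1) + RtoC (INR K)) with (1 - w + (RtoC (INR K) + 1))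
        by ring; exact HK. }
    destruct (Hex w) as [L HL].
    assert (HL2 : hassum (fun n => (/ 2) ^ n * bp (w - 1) n) (1 + (L - 1 - / 2 * L))).
    { assert (HH := hassum_head _ _ HL); simpl in HH; rewrite bp_0 in HH.
      assert (H := hassum_shift (fun n => (/ 2) ^ n * bp (w - 1) n) (L - 1 - / 2 * L)).
      simpl in H; rewrite bp_0, Cmult_1_r in H; apply H.
      eapply hassum_ext; [|apply hassum_minus;
        [rewrite Cmult_1_r in HH; exact HH|apply (hassum_scal (/ 2)), HL]].
      intros n; cbv beta.
      assert (E : bp w (S n) = bp (w - 1) (S n) + bp w n).
      { unfold bp; rewrite (poch_head (w - 1)); replace (w - 1 + 1) with w by ring.
        rewrite INR_fact_S_C; simpl poch; field.
        split; auto using INR_S_C_neq_0, INR_fact_C_neq_0. }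
      rewrite E; ring. }
    assert (E := hassum_unique _ _ _ IHw HL2).
    replace (npowC 2 w) with L; [exact HL|].
    replace w with ((w - 1) + 1) by ring; rewrite npowC_add, E, npowC_1 by lia.
    replace (INR 2) with 2%R by (simpl; ring); field; apply C2_neq_0.
Qed.

(** Raising p and c together preserves c - p, so the coefficients of the i steps assemble into (c -
    p)_r. *)
Lemma hgF_numerator_iter (i : nat) (p b c : C) :
  poch p i * hgF (p + RtoC (INR i)) b (c + RtoC (INR i))
  = bs i (fun r => (-1) ^ r * (poch (c - p) r * hgF p b (c + RtoC (INR r)))).
Proof.
  revert p c; induction i as [|i IH]; intros p c.
  - simpl; rewrite !Cplus_0_r; ring.
  - rewrite poch_head, INR_S_C.
    replace (p + (RtoC (INR i) + 1)) with (p + 1 + RtoC (INR i)) by ring.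
    replace (c + (RtoC (INR i) + 1)) with (c + 1 + RtoC (INR i)) by ring.
    rewrite <- Cmult_assoc, IH, <- bs_scal; cbn [bs]; rewrite <- bs_plus.
    apply bs_ext; intros r _; cbn [Cpow poch].
    replace (c + 1 - (p + 1)) with (c - p) by ring.
    replace (c + 1 + RtoC (INR r)) with (c + RtoC (INR r) + 1) by ring.
    transitivity ((-1) ^ r * (poch (c - p) r * (p * hgF (p + 1) b (c + RtoC (INR r) + 1))));
      [ring|].
    rewrite hgF_contiguous_numerator, INR_S_C.
    replace (c + (RtoC (INR r) + 1)) with (c + RtoC (INR r) + 1) by ring; ring.
Qed.

Lemma hgF_doubling_iter (i : nat) (p b c : C) :
  2 ^ i * hgF p b c
  = bs i (fun r => poch (c - p) r * hgF p (b + RtoC (INR i)) (c + RtoC (INR r))).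
Proof.
  revert b c; induction i as [|i IH]; intros b c.
  - simpl; rewrite !Cplus_0_r; ring.
  - change (2 ^ S i) with (2 * 2 ^ i).
    replace (2 * 2 ^ i * hgF p b c) with (2 ^ i * (2 * hgF p b c)) by ring.
    rewrite hgF_contiguous_doubling.
    transitivity (2 ^ i * hgF p (b + 1) c + (c - p) * (2 ^ i * hgF p (b + 1) (c + 1)));
      [ring|].
    rewrite !IH; cbn [bs]; f_equal.
    + apply bs_ext; intros; do 2 f_equal; rewrite INR_S_C; ring.
    + rewrite <- bs_scal; apply bs_ext; intros r _.
      rewrite (poch_head (c - p)), !INR_S_C.
      replace (c + 1 - p) with (c - p + 1) by ring.
      replace (b + (RtoC (INR i) + 1)) with (b + 1 + RtoC (INR i)) by ring.
      replace (c + (RtoC (INR r) + 1)) with (c + 1 + RtoC (INR r)) by ring; ring.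
Qed.

(** * Uniform bounds *)

(** |z + n| never vanishes and grows like n; the convergent quotient (1 + n)/(z + n) is bounded. *)
Lemma not_pole_linear_bound (z : C) :
  not_pole z -> exists B, (0 < B)%R /\
    forall n, (INR n + 1 <= B * Cmod (z + RtoC (INR n))%C)%R.
Proof.
  intros Hz.
  assert (H : cv (fun n => (1 + RtoC (INR n)) / (z + RtoC (INR n))) 1).
  { apply (cv_ext_from 1 (fun n => (1 + RtoC (INR n)) / RtoC (INR n)
                          * / ((z + RtoC (INR n)) / RtoC (INR n)))).
    - intros n Hn; field; auto using not_pole_neq_0, INR_C_neq_0.
    - apply (cv_eq _ (1 * / 1)); [field|].
      apply cv_mult; [apply cv_shift_ratio|].
      apply cv_inv; [apply C1_nz|apply cv_shift_ratio]. }
  destruct (cv_bounded _ _ H) as [B [HB0 HB]].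
  exists (B + 1)%R; split; [lra|]; intros n; specialize (HB n).
  assert (Hn := not_pole_neq_0 z n Hz); assert (P := pos_INR n).
  rewrite Cmod_div, <- RtoC_plus, Cmod_R, Rabs_pos_eq in HB by (auto; lra).
  assert (Hm : (0 < Cmod (z + RtoC (INR n)))%R) by now apply Cmod_gt_0.
  apply (Rmult_le_compat_r (Cmod (z + RtoC (INR n)))) in HB; [|lra].
  replace ((1 + INR n) / Cmod (z + RtoC (INR n)) * Cmod (z + RtoC (INR n)))%R
    with (1 + INR n)%R in HB by (field; lra).
  nra.
Qed.

(** The weight that a j-th difference in m puts on the n-th term of the row m = 0, normalized to 1
    at n = 0. *)
Definition lam (b : C) (j n : nat) : C := poch b j * poch b n / poch b (n + j).

Lemma lam_S (b : C) (j n : nat) :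
  not_pole b ->
  lam b (S j) n = lam b j n * ((b + RtoC (INR j)) / (b + RtoC (INR j) + RtoC (INR n))).
Proof.
  intros Hb; unfold lam; rewrite Nat.add_succ_r; simpl poch.
  assert (H := not_pole_neq_0 b (n + j) Hb).
  rewrite plus_INR, RtoC_plus in *.
  field; repeat split; auto using poch_neq_0.
  replace (b + RtoC (INR j) + RtoC (INR n)) with (b + (RtoC (INR n) + RtoC (INR j))) by ring.
  exact H.
Qed.

Lemma lam_dif (b : C) (j n : nat) :
  not_pole b ->
  lam b j n - lam b j (S n) = RtoC (INR j) / (b + RtoC (INR j)) * lam b (S j) n.
Proof.
  intros Hb; unfold lam; rewrite Nat.add_succ_r; simpl (S n + j)%nat; simpl poch.
  assert (H := not_pole_neq_0 b (n + j) Hb).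
  rewrite plus_INR, RtoC_plus in *.
  field; repeat split; auto using poch_neq_0, not_pole_neq_0.
Qed.

Lemma lam_ratio_le (b : C) :
  not_pole b -> exists D, (1 <= D)%R /\ forall j n,
    (Cmod ((b + RtoC (INR j)) / (b + RtoC (INR j) + RtoC (INR n)))%C
     <= D * (INR j + 1))%R.
Proof.
  intros Hb; destruct (not_pole_linear_bound b Hb) as [B [HB0 HB]].
  assert (P := Cmod_ge_0 b).
  exists (1 + B * (Cmod b + 1))%R; split; [nra|]; intros j n.
  assert (H := not_pole_neq_0 b (j + n) Hb).
  specialize (HB (j + n)%nat); rewrite plus_INR, RtoC_plus, Cplus_assoc in *.
  rewrite Cmod_div by exact H.
  assert (Hm := proj1 (Cmod_gt_0 _) H).
  assert (Pj := pos_INR j); assert (Pn := pos_INR n); assert (G := Cmod_add_INR_le b j).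
  apply (Rmult_le_reg_r (Cmod (b + RtoC (INR j) + RtoC (INR n)))); [exact Hm|].
  unfold Rdiv; rewrite Rmult_assoc, Rinv_l, Rmult_1_r by lra.
  set (M := Cmod (b + RtoC (INR j) + RtoC (INR n))) in *.
  assert (Cmod (b + RtoC (INR j))%C <= (Cmod b + 1) * (INR j + 1))%R by nra.
  assert ((Cmod b + 1) * (INR j + 1) * 1 <= (Cmod b + 1) * (INR j + 1) * (B * M))%R.
  { apply Rmult_le_compat_l; nra. }
  assert (0 <= (INR j + 1) * M)%R by nra.
  nra.
Qed.

(** At j = 2 the weight is b(b+1)/((b+n)(b+n+1)). Only finitely many later factors can exceed 1 in
    modulus, so the decay 1/n^2 persists with one constant for all larger j. *)
Lemma lam_sq_bound (b : C) :
  not_pole b -> exists Q, (0 <= Q)%R /\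
    forall j n, (Cmod (lam b (S (S j)) n) <= Q / (INR n + 1) ^ 2)%R.
Proof.
  intros Hb; destruct (not_pole_linear_bound b Hb) as [B [HB0 HB]].
  destruct (lam_ratio_le b Hb) as [D [HD1 HD]].
  assert (Hsq : forall n, (0 < / (INR n + 1) ^ 2)%R).
  { intros n; apply Rinv_0_lt_compat, pow_lt; assert (P := pos_INR n); lra. }
  assert (HJ : forall J, exists Q, (0 <= Q)%R /\ forall j, (j <= J)%nat ->
            forall n, (Cmod (lam b (S (S j)) n) <= Q / (INR n + 1) ^ 2)%R).
  { induction J as [|J [Q [HQ0 HQ]]].
    - exists (Cmod (b * (b + 1)) * (B * B))%R; split.
      { apply Rmult_le_pos; [apply Cmod_ge_0|nra]. }
      intros j Hj n; replace j with O by lia.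
      assert (N1 := not_pole_neq_0 b n Hb); assert (N2 := not_pole_neq_0 b (S n) Hb).
      replace (lam b 2 n) with (b * (b + 1) / ((b + RtoC (INR n)) * (b + RtoC (INR (S n))))).
      2:{ unfold lam; replace (n + 2)%nat with (S (S n)) by lia.
          change (poch b (S (S n))) with
            (poch b n * (b + RtoC (INR n)) * (b + RtoC (INR (S n)))).
          simpl poch; simpl (INR 0); simpl (INR 1).
          field; repeat split; auto using poch_neq_0. }
      set (W := b * (b + 1)).
      rewrite Cmod_div by now apply Cmult_neq_0.
      rewrite (Cmod_mult (b + RtoC (INR n))).
      unfold Rdiv; rewrite Rmult_assoc.
      apply Rmult_le_compat_l; [apply Cmod_ge_0|].
      assert (B1 := HB n); assert (B2 := HB (S n)).
      assert (HSn := S_INR n).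
      assert (P := pos_INR n).
      assert (M1 := proj1 (Cmod_gt_0 _) N1); assert (M2 := proj1 (Cmod_gt_0 _) N2).
      set (x := Cmod (b + RtoC (INR n))) in *; set (y := Cmod (b + RtoC (INR (S n)))) in *.
      apply (Rmult_le_reg_r (x * y * (INR n + 1) ^ 2)).
      { apply Rmult_lt_0_compat; [nra|apply pow_lt; lra]. }
      replace (/ (x * y) * (x * y * (INR n + 1) ^ 2))%R with ((INR n + 1) * (INR n + 1))%R
        by (field; lra).
      replace (B * B * / (INR n + 1) ^ 2 * (x * y * (INR n + 1) ^ 2))%R
        with (B * x * (B * y))%R by (field; lra).
      apply Rmult_le_compat; lra.
    - set (E := (D * (INR (S (S J)) + 1))%R).
      assert (HE : (1 <= E)%R) by (unfold E; assert (P := pos_INR (S (S J))); nra).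
      exists (Q * E)%R; split; [nra|]; intros j Hj n.
      assert (P := Hsq n); unfold Rdiv in *.
      destruct (Nat.eq_dec j (S J)) as [->|Hne].
      + rewrite lam_S, Cmod_mult by exact Hb.
        specialize (HQ J (Nat.le_refl _) n); specialize (HD (S (S J)) n); fold E in HD.
        replace (Q * E * / (INR n + 1) ^ 2)%R with (Q * / (INR n + 1) ^ 2 * E)%R by ring.
        apply Rmult_le_compat; auto using Cmod_ge_0.
      + specialize (HQ j ltac:(lia) n).
        replace (Q * E * / (INR n + 1) ^ 2)%R with (Q * / (INR n + 1) ^ 2 * E)%R by ring.
        assert (0 <= Q * / (INR n + 1) ^ 2)%R by (apply Rmult_le_pos; lra); nra. }
  (* |b| < J + 1: beyond J no factor enlarges the weight, and the constant obtained for j <= J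
     serves everywhere. *)
  destruct (nfloor_ex (Cmod b) (Cmod_ge_0 b)) as [J [_ HJ1]].
  destruct (HJ J) as [Q [HQ0 HQ]]; exists Q; split; [exact HQ0|]; intros j n.
  induction j as [|j IH]; [apply HQ; lia|].
  destruct (Nat.le_gt_cases (S j) J) as [Hj|Hj]; [now apply HQ|].
  rewrite lam_S, Cmod_mult by exact Hb.
  (* [Re (b + j + 2) >= 0], so the new factor has modulus at most 1. *)
  assert (Hf : (Cmod ((b + RtoC (INR (S (S j)))) /
                  (b + RtoC (INR (S (S j))) + RtoC (INR n)))%C <= 1)%R).
  { assert (N0 : b + RtoC (INR (S (S j))) + RtoC (INR n) <> 0).
    { rewrite <- Cplus_assoc, <- RtoC_plus, <- plus_INR; now apply not_pole_neq_0. }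
    rewrite Cmod_div by exact N0; assert (M0 := proj1 (Cmod_gt_0 _) N0).
    apply (Rmult_le_reg_r (Cmod (b + RtoC (INR (S (S j))) + RtoC (INR n)))); [exact M0|].
    unfold Rdiv; rewrite Rmult_assoc, Rinv_l, Rmult_1_r, Rmult_1_l by lra.
    apply Rsqr_incr_0_var; [|apply Cmod_ge_0].
    rewrite !Rsqr_pow2, !Cmod2_alt.
    change (Re (b + RtoC (INR (S (S j))) + RtoC (INR n)))
      with (Re b + INR (S (S j)) + INR n)%R.
    change (Re (b + RtoC (INR (S (S j))))) with (Re b + INR (S (S j)))%R.
    change (Im (b + RtoC (INR (S (S j))) + RtoC (INR n))) with (Im b + 0 + 0)%R.
    change (Im (b + RtoC (INR (S (S j))))) with (Im b + 0)%R.
    assert (G := re_le_Cmod b); apply Rabs_le_between in G.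
    apply le_INR in Hj; rewrite !S_INR in Hj; rewrite !S_INR.
    assert (P := pos_INR n); assert (Pj := pos_INR j).
    assert (0 <= Re b + (INR j + 1 + 1))%R by lra; nra. }
  assert (G1 := Cmod_ge_0 (lam b (S (S j)) n)).
  assert (G2 := Cmod_ge_0 ((b + RtoC (INR (S (S j)))) /
                  (b + RtoC (INR (S (S j))) + RtoC (INR n)))).
  nra.
Qed.

Lemma lam_bound (b : C) :
  not_pole b -> exists L, forall j n, (Cmod (lam b j n) <= L)%R.
Proof.
  intros Hb; destruct (lam_sq_bound b Hb) as [Q [HQ0 HQ]].
  destruct (lam_ratio_le b Hb) as [D [HD1 HD]].
  assert (H0 : forall n, lam b 0 n = 1).
  { intros n; unfold lam; rewrite Nat.add_0_r; simpl; field; now apply poch_neq_0. }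
  exists (Q + D)%R; intros [|[|j]] n.
  - rewrite H0, Cmod_1; lra.
  - rewrite lam_S, H0, Cmult_1_l by exact Hb.
    specialize (HD O n); simpl (INR 0) in HD; rewrite Rplus_0_l, Rmult_1_r in HD.
    simpl (INR 0); lra.
  - eapply Rle_trans; [apply HQ|].
    assert (/ (INR n + 1) ^ 2 <= 1)%R.
    { rewrite <- Rinv_1; apply Rinv_le_contravar; [lra|].
      apply pow_R1_Rle; assert (P := pos_INR n); lra. }
    unfold Rdiv; nra.
Qed.

(** A difference in n raises j by one, at the cost of the bounded factor j/(b + j). It vanishes for
    j = 0, and for j >= 1 the raised index is at least 2, where the square bound applies. *)
Lemma lam_variation (b : C) :
  not_pole b -> exists V, forall j n,
    (rsum (fun k => Cmod (lam b j k - lam b j (S k))) n <= V)%R.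
Proof.
  intros Hb; destruct (lam_sq_bound b Hb) as [Q [HQ0 HQ]].
  destruct (not_pole_linear_bound b Hb) as [B [HB0 HB]].
  exists (B * (Q * 2))%R; intros j n.
  apply Rle_trans with (rsum (fun k => (B * (Q * / (INR k + 1) ^ 2))%R) n).
  - apply rsum_le; intros k _; rewrite lam_dif, Cmod_mult by exact Hb.
    assert (N0 := not_pole_neq_0 b j Hb); assert (M0 := proj1 (Cmod_gt_0 _) N0).
    destruct j as [|j].
    + simpl (INR 0); replace (0 / (b + 0)) with (RtoC 0).
      * rewrite Cmod_0, Rmult_0_l; apply Rmult_le_pos; [lra|apply Rmult_le_pos; [lra|]].
        apply Rlt_le, Rinv_0_lt_compat, pow_lt; assert (P := pos_INR k); lra.
      * simpl in N0; field; rewrite Cplus_0_r in N0; exact N0.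
    + apply Rmult_le_compat; [apply Cmod_ge_0|apply Cmod_ge_0| |apply HQ].
      rewrite Cmod_div, Cmod_R, Rabs_pos_eq by (auto using pos_INR).
      specialize (HB (S j)).
      apply (Rmult_le_reg_r (Cmod (b + RtoC (INR (S j))))); [exact M0|].
      unfold Rdiv; rewrite Rmult_assoc, Rinv_l, Rmult_1_r by lra; lra.
  - rewrite rsum_scal, rsum_scal; apply Rmult_le_compat_l; [lra|].
    apply Rmult_le_compat_l; [lra|apply rsum_inv_sq].
Qed.

(** Summation by parts twice, against [lam] and then against x^n; the bound is uniform in j and
    includes x = 1. The final factor 1 + 1 is the size plus the variation of x^n. *)
Lemma lam_partial_sums (b Q : C) (q : nat -> C) :
  not_pole b -> hassum q Q ->
  exists B, forall j (x : R) N, (0 <= x <= 1)%R ->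
    (Cmod (csum (fun n => q n * lam b j n * RtoC x ^ n)%C N) <= B)%R.
Proof.
  intros Hb Hq; destruct (cv_bounded _ _ Hq) as [B [HB0 HB]].
  destruct (lam_bound b Hb) as [L HL]; destruct (lam_variation b Hb) as [V HV].
  exists (B * (L + V) * (1 + 1))%R; intros j x N Hx.
  apply (Cmod_csum_by_parts (fun n => q n * lam b j n) (fun n => RtoC x ^ n)).
  - intros n; apply (Cmod_csum_by_parts q (lam b j)); auto.
  - intros n; rewrite Cmod_pow, Cmod_R, Rabs_pos_eq by lra.
    rewrite <- (pow1 n); apply pow_incr; lra.
  - intros n; now apply rsum_pow_variation.
Qed.

Lemma cv_abel_x (m : nat) : cv (fun k => RtoC (abel_x k) ^ m) 1.
Proof.
  assert (H : cv (fun k => RtoC (abel_x k)) 1).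
  { intros eps He; destruct (abel_x_lim eps He) as [N HN]; exists N; intros k Hk.
    specialize (HN k Hk); assert (B := abel_x_bounds k).
    rewrite <- RtoC_minus, Cmod_R, Rabs_left1 by lra; lra. }
  induction m as [|m IH]; [exact (cv_const 1)|].
  apply (cv_eq _ (1 * 1)); [ring|]; simpl; now apply cv_mult.
Qed.

(** Room for four Pochhammer quotients of rate q against x^n: the terms of the double series grow at
    most like q^(2m + 4n). *)
Lemma ex_pow4_lt_inv (x : R) :
  (0 <= x < 1)%R -> exists q, (1 < q)%R /\ (0 <= q ^ 4 * x < 1)%R.
Proof.
  (* 15 = 4 + 6 + 4 + 1, so (1 + h)^4 <= 1 + 15 h for h <= 1, and x = 1 - 15 h. *)
  intros Hx; exists (1 + (1 - x) / 15)%R; split; [lra|].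
  set (h := ((1 - x) / 15)%R).
  assert (Hh : (0 < h <= 1)%R) by (unfold h; lra).
  assert (Ex : x = (1 - 15 * h)%R) by (unfold h; field).
  assert (Hp : (0 <= (1 + h) ^ 4 <= 1 + 15 * h)%R).
  { split; [apply pow_le; lra|].
    assert (h ^ 2 <= h)%R by nra; assert (h ^ 3 <= h)%R by nra; assert (h ^ 4 <= h)%R by nra.
    nra. }
  split; [nra|].
  apply Rle_lt_trans with ((1 + 15 * h) * x)%R; [apply Rmult_le_compat_r; lra|].
  rewrite Ex; nra.
Qed.

(** * The double series *)

Lemma csum_rev (f : nat -> C) (N : nat) :
  csum f (S N) = csum (fun n => f (N - n)%nat) (S N).
Proof.
  revert f; induction N as [|N IH]; intros f; [reflexivity|].
  rewrite csum_head, IH.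
  change (csum (fun n => f (S N - n)%nat) (S (S N)))
    with (csum (fun n => f (S N - n)%nat) (S N) + f (S N - S N)%nat).
  rewrite Nat.sub_diag, Cplus_comm; f_equal.
  apply csum_ext; intros k Hk; f_equal; lia.
Qed.

Lemma Cpown_Cpow (x : C) (n : nat) : Cpown x n = x ^ n.
Proof. induction n as [|n IH]; simpl; [reflexivity|rewrite IH; ring]. Qed.

Lemma poch_succ_ratio (z : C) (n : nat) :
  not_pole z -> poch (1 + z) n / poch z n = 1 + RtoC (INR n) / z.
Proof.
  intros Hz; assert (H := poch_shift z n); assert (H0 := not_pole_neq z Hz).
  replace (1 + z) with (z + 1) by ring.
  replace (poch (z + 1) n) with (z * poch (z + 1) n / z) by (field; exact H0).
  rewrite H; field; split; auto using poch_neq_0.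
Qed.

(** Everything depending on n alone; the parameter pair 1 + al/2 over al/2 has been evaluated to 1 +
    2n/al. *)
Definition bcoef (al c io : C) (n : nat) : C :=
  (-1) ^ n * (hterm (io - al) (al - c + 1) c n * (1 + RtoC (INR n) / (al / 2))).

Definition wterm (al be c io : C) (m n : nat) : C :=
  bcoef al c io n * (poch al (m + n) / poch be (m + n)).

Lemma kdf_term_wterm (al be c io : C) (m n : nat) :
  be = 2 * c - 2 - al -> not_pole be -> not_pole (al / 2) -> not_pole c ->
  kdf_term [al] [al + be - io] [io - al; 1 + al / 2; (al - be) / 2]
    [be] [] [al / 2; c] (RtoC (-1)) (RtoC (-1)) m n
  = (-1) ^ m * (bp (2 * c - 2 - io) m * wterm al be c io m n).
Proof.
  intros Hbe Hb Ha Hc; unfold kdf_term, wterm, bcoef, hterm, bp.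
  cbn [prodpoch fold_right].
  rewrite !Cpown_Cpow, <- (poch_succ_ratio (al / 2) n Ha).
  replace ((al - be) / 2) with (al - c + 1) by (rewrite Hbe; field; apply C2_neq_0).
  replace (al + be - io) with (2 * c - 2 - io) by (rewrite Hbe; ring).
  field; repeat split; auto using INR_fact_C_neq_0, poch_neq_0.
Qed.

(** Lowering the exponent e by one multiplies (1 - z)^(-e) by 1 - z, so the Saalschütz values are
    differenced. *)
Lemma saalschutz_lowered (a b c : C) (k : nat) :
  not_pole c ->
  csum (fun n => bp (c - a - b - 1) (S k - n) * hterm a b c n) (S (S k))
  = hterm (c - a) (c - b) c (S k) - hterm (c - a) (c - b) c k.
Proof.
  intros Hc; rewrite <- !saalschutz by exact Hc.
  set (e := c - a - b).
  assert (E : forall m, bp (e - 1) (S m) = bp e (S m) - bp e m).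
  { intros m; unfold bp; rewrite poch_head; replace (e - 1 + 1) with e by ring.
    rewrite INR_fact_S_C; simpl poch; field.
    split; auto using INR_S_C_neq_0, INR_fact_C_neq_0. }
  change (csum (fun n => bp e (S k - n) * hterm a b c n) (S (S k)))
    with (csum (fun n => bp e (S k - n) * hterm a b c n) (S k)
          + bp e (S k - S k) * hterm a b c (S k)).
  change (csum (fun n => bp (e - 1) (S k - n) * hterm a b c n) (S (S k)))
    with (csum (fun n => bp (e - 1) (S k - n) * hterm a b c n) (S k)
          + bp (e - 1) (S k - S k) * hterm a b c (S k)).
  rewrite Nat.sub_diag, !bp_0.
  rewrite (csum_ext (fun n => bp (e - 1) (S k - n) * hterm a b c n)
    (fun n => bp e (S k - n) * hterm a b c n - bp e (k - n) * hterm a b c n)).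
  - rewrite csum_minus; ring.
  - intros n Hn; replace (S k - n)%nat with (S (k - n)) by lia; rewrite E; ring.
Qed.

(** The weight n cancels against n!, and shifting the index raises a, b, c by one; their excess is
    then c - a - b - 1, so Saalschütz applies again. *)
Lemma saalschutz_weighted (a b c : C) (k : nat) :
  not_pole c ->
  csum (fun n => bp (c - a - b - 1) (S k - n) * (RtoC (INR n) * hterm a b c n)) (S (S k))
  = a * b / c * hterm (c - a) (c - b) (c + 1) k.
Proof.
  intros Hc.
  assert (Hc1 : not_pole (c + 1)) by exact (not_pole_add c 1 Hc).
  assert (Hc0 := not_pole_neq c Hc).
  assert (E := saalschutz (a + 1) (b + 1) (c + 1) k Hc1).
  replace (c + 1 - (a + 1)) with (c - a) in E by ring.
  replace (c + 1 - (b + 1)) with (c - b) in E by ring.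
  replace (c - a - (b + 1)) with (c - a - b - 1) in E by ring.
  rewrite <- E, csum_head; simpl (INR 0); rewrite Cmult_0_l, Cmult_0_r, Cplus_0_l.
  rewrite <- csum_scal; apply csum_ext; intros n Hn.
  replace (S k - S n)%nat with (k - n)%nat by lia.
  unfold hterm; rewrite !(poch_head _ n), INR_fact_S_C, INR_S_C.
  field; repeat split; auto using INR_fact_C_neq_0, INR_S_C_neq_0, poch_neq_0.
Qed.

(** The coefficient of z^n in 2F1(al + 1, c + al - io; c; z). *)
Definition fcoef (al c io : C) (n : nat) : C :=
  bp (al + 1) n * (poch (c + al - io) n / poch c n).

(* On a diagonal [m + n = N] the double series collapses to the [N]-th
   coefficient of [(1 - z) 2F1(al + 1, c + al - io; c; z)]. *)
Lemma diagonal_sum (al be c io : C) (N : nat) :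
  be = 2 * c - 2 - al -> not_pole be -> not_pole (al / 2) -> not_pole c ->
  csum (fun m => (-1) ^ m * (bp (2 * c - 2 - io) m * wterm al be c io m (N - m))) (S N)
  = (-1) ^ N * (fcoef al c io N
                - match N with O => 0 | S k => fcoef al c io k end).
Proof.
  intros Hbe Hb Ha Hc.
  assert (Ha0 : al <> 0).
  { intros E; apply (not_pole_neq _ Ha); rewrite E; field; apply C2_neq_0. }
  assert (Hc0 := not_pole_neq c Hc); assert (Hb0 := not_pole_neq be Hb).
  set (a := io - al); set (b := al - c + 1).
  assert (Ee : 2 * c - 2 - io = c - a - b - 1) by (unfold a, b; ring).
  rewrite csum_rev.
  (* On a diagonal the quotient with index m + n is constant; the weight 1 + 2n/al splits the rest
     into a plain sum and one weighted by n. *)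
  transitivity ((-1) ^ N * (poch al N / poch be N)
    * (csum (fun n => bp (c - a - b - 1) (N - n) * hterm a b c n) (S N)
       + 2 / al * csum (fun n => bp (c - a - b - 1) (N - n)
                                 * (RtoC (INR n) * hterm a b c n)) (S N))).
  { rewrite <- csum_scal, <- csum_plus, <- csum_scal; apply csum_ext; intros n Hn.
    unfold wterm, bcoef; rewrite Ee.
    replace (N - (N - n))%nat with n by lia; replace (N - n + n)%nat with N by lia.
    fold a b.
    replace ((-1) ^ N) with ((-1) ^ (N - n) * (-1) ^ n)
      by (rewrite <- Cpow_add_r; f_equal; lia).
    field; repeat split; auto using poch_neq_0, C2_neq_0. }
  destruct N as [|k].
  { simpl; rewrite bp_0; unfold hterm, fcoef; rewrite bp_0; simpl; field; exact Ha0. }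
  rewrite saalschutz_lowered, saalschutz_weighted by exact Hc.
  replace (c - a) with (c + al - io) by (unfold a; ring).
  replace (c - b) with (be + 1) by (rewrite Hbe; unfold b; ring).
  unfold fcoef, hterm, bp.
  rewrite (poch_head al k), (poch_head be k), !INR_fact_S_C.
  assert (Hc1 : not_pole (c + 1)) by exact (not_pole_add c 1 Hc).
  assert (Hb1 : not_pole (be + 1)) by exact (not_pole_add be 1 Hb).
  assert (E1 : poch (c + 1) k = poch c k * (c + RtoC (INR k)) / c).
  { rewrite <- poch_shift; field; exact Hc0. }
  rewrite E1.
  replace (poch c (S k)) with (poch c k * (c + RtoC (INR k))) by reflexivity.
  replace (poch (c + al - io) (S k))
    with (poch (c + al - io) k * (c + al - io + RtoC (INR k))) by reflexivity.
  replace (poch (be + 1) (S k)) with (poch (be + 1) k * (be + 1 + RtoC (INR k)))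
    by reflexivity.
  replace (poch (al + 1) (S k)) with (poch (al + 1) k * (al + 1 + RtoC (INR k)))
    by reflexivity.
  assert (Hp := poch_neq_0 (be + 1) k Hb1); set (P := poch (be + 1) k) in *; clearbody P.
  unfold a, b; clear Ee a b Hb1 Hb E1; subst be.
  field; repeat split; auto using INR_fact_C_neq_0, INR_S_C_neq_0, poch_neq_0, not_pole_neq_0.
Qed.

Lemma bcoef_geom (al c io : C) (q : R) :
  not_pole (al / 2) -> not_pole c -> (1 < q)%R ->
  exists K, forall n, (Cmod (bcoef al c io n) <= K * (q ^ 3) ^ n)%R.
Proof.
  intros Ha Hc Hq.
  destruct (bp_geom (al - c + 1) q Hq) as [K1 H1].
  destruct (poch_ratio_geom (io - al) c q Hc Hq) as [K2 H2].
  destruct (poch_ratio_geom (1 + al / 2) (al / 2) q Ha Hq) as [K3 H3].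
  exists (K1 * (K2 * K3))%R; intros n.
  assert (G := geom_mult _ _ _ _ _ _ H1 (geom_mult _ _ _ _ _ _ H2 H3) n).
  replace (q * (q * q))%R with (q ^ 3)%R in G by ring.
  eapply Rle_trans; [|exact G]; apply Req_le.
  unfold bcoef, hterm, bp.
  rewrite <- (poch_succ_ratio (al / 2) n Ha), Cmod_mult, Cmod_pow, Cmod_R.
  replace (Rabs (-1)) with 1%R by (rewrite Rabs_left; lra).
  rewrite pow1, Rmult_1_l; f_equal.
  field; repeat split; auto using INR_fact_C_neq_0, poch_neq_0.
Qed.

Lemma wterm_geom (al be c io : C) (x : R) :
  not_pole be -> not_pole (al / 2) -> not_pole c -> (0 <= x < 1)%R ->
  exists K q, (0 <= q < 1)%R /\ forall m n,
    (Cmod (RtoC x ^ (m + n) * (bp (2 * c - 2 - io) m * wterm al be c io m n))%C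
       <= K * q ^ (m + n))%R.
Proof.
  intros Hb Ha Hc Hx; destruct (ex_pow4_lt_inv x Hx) as [q [Hq Hqx]].
  destruct (bp_geom (2 * c - 2 - io) q Hq) as [K1 H1].
  destruct (bcoef_geom al c io q Ha Hc Hq) as [K2 H2].
  destruct (poch_ratio_geom al be q Hb Hq) as [K3 H3].
  assert (P1 := geom_bound_pos _ _ _ H1); assert (P2 := geom_bound_pos _ _ _ H2).
  assert (P3 := geom_bound_pos _ _ _ H3).
  exists (K1 * K2 * K3)%R, (q ^ 4 * x)%R; split; [exact Hqx|]; intros m n.
  assert (Hx0 : (0 <= x ^ (m + n))%R) by (apply pow_le; lra).
  unfold wterm; rewrite !Cmod_mult, Cmod_pow, Cmod_R, Rabs_pos_eq, Rpow_mult_distr by lra.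
  apply Rle_trans
    with (x ^ (m + n) * (K1 * q ^ m * (K2 * (q ^ 3) ^ n * (K3 * q ^ (m + n)))))%R.
  - apply Rmult_le_compat_l; [exact Hx0|].
    apply Rmult_le_compat; [apply Cmod_ge_0| |apply H1|].
    { apply Rmult_le_pos; apply Cmod_ge_0. }
    apply Rmult_le_compat; auto using Cmod_ge_0.
  - replace (x ^ (m + n) * (K1 * q ^ m * (K2 * (q ^ 3) ^ n * (K3 * q ^ (m + n)))))%R
      with (K1 * K2 * K3 * ((q ^ m * (q ^ 3) ^ n * q ^ (m + n)) * x ^ (m + n)))%R by ring.
    apply Rmult_le_compat_l; [repeat apply Rmult_le_pos; assumption|].
    apply Rmult_le_compat_r; [exact Hx0|].
    rewrite <- !pow_mult, <- !pow_add; apply Rle_pow; [lra|lia].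
Qed.

Lemma wterm_lam (al be c io : C) (x : R) (j n : nat) :
  not_pole be ->
  dif j (fun m => RtoC x ^ n * wterm al be c io m n) 0
  = poch (be - al) j / poch be j
    * (wterm al be c io 0 n * lam be j n * RtoC x ^ n).
Proof.
  intros Hb; unfold wterm.
  rewrite (dif_ext j _ (fun m => RtoC x ^ n * bcoef al c io n
             * (poch al (m + n) / poch be (m + n)))) by (intros; ring).
  rewrite dif_scal, (dif_shift j (fun m => poch al m / poch be m) n 0).
  rewrite dif_poch_ratio by exact Hb; rewrite !Nat.add_0_l; unfold lam.
  field; repeat split; auto using poch_neq_0.
Qed.

(** The hypothesis says nothing about row m when (e)_m = 0. Newton's expansion writes the row as a
    finite combination of the row 0 weighted by [lam], and those series converge by Abel's test. *)
Lemma wterm_ex_hassum (al be c io Q : C) (m : nat) :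
  not_pole be -> hassum (wterm al be c io 0) Q ->
  exists l, hassum (wterm al be c io m) l.
Proof.
  intros Hb HQ; destruct (lam_variation be Hb) as [V HV].
  assert (H : forall j, hassum (fun n => wterm al be c io 0 n * lam be j n)
                          (tsum (fun n => wterm al be c io 0 n * lam be j n))).
  { intros j; apply tsum_hassum, (abel_test _ _ Q V HQ (HV j)). }
  eexists.
  eapply hassum_ext; [|apply (hassum_bs m (fun l n => (-1) ^ l
      * (poch (be - al) l / poch be l) * (wterm al be c io 0 n * lam be l n)))].
  - intros n; cbv beta; unfold wterm at 2.
    rewrite (Nat.add_comm m n), (newton_series m (fun m => poch al m / poch be m) n).
    rewrite <- bs_scal; apply bs_ext; intros l Hl.
    rewrite dif_poch_ratio by exact Hb; unfold wterm, lam; rewrite !Nat.add_0_l.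
    field; repeat split; auto using poch_neq_0.
  - intros l; apply hassum_scal, H.
Qed.

(** The constant is chosen before x, so that it serves all Abel means as well as the original series
    at x = 1. Bounds on partial sums pass to the limit even under conditional convergence. *)
Lemma wterm_dif_bound (al be c io Q : C) :
  not_pole be -> hassum (wterm al be c io 0) Q ->
  exists K, forall (x : R) nu, (0 <= x <= 1)%R ->
    (forall m, hassum (fun n => RtoC x ^ n * wterm al be c io m n) (nu m)) ->
    forall l, (Cmod (dif l (fun m => RtoC x ^ m * nu m)%C 0) <= K * (5 / 4) ^ l)%R.
Proof.
  intros Hb HQ.
  destruct (lam_partial_sums be Q _ Hb HQ) as [B HB].
  destruct (poch_ratio_geom (be - al) be (5 / 4) Hb ltac:(lra)) as [K HK].
  exists (K * B)%R; intros x nu Hx Hnu l.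
  apply Cmod_dif_pow_le; [exact Hx|lra|]; intros j.
  assert (H := hassum_dif j (fun m n => RtoC x ^ n * wterm al be c io m n) nu 0 Hnu).
  apply (cv_Cmod_le _ _ _ H); intros N.
  rewrite (csum_ext _ (fun n => poch (be - al) j / poch be j
      * (wterm al be c io 0 n * lam be j n * RtoC x ^ n)))
    by (intros; now apply wterm_lam).
  rewrite csum_scal, Cmod_mult.
  replace (K * B * (5 / 4) ^ j)%R with (K * (5 / 4) ^ j * B)%R by ring.
  apply Rmult_le_compat; auto using Cmod_ge_0.
Qed.


(** * Pfaff's transformation and its passage to the limit *)

Definition pfaff_series (e : C) (mu : nat -> C) (l : nat) : C :=
  (/ 2) ^ l * (bp e l * dif l mu 0).

Lemma pfaff_series_geom (e : C) (K : R) :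
  exists K', forall mu, (forall l, (Cmod (dif l mu 0) <= K * (5 / 4) ^ l)%R) ->
    forall l, (Cmod (pfaff_series e mu l) <= K' * (25 / 32) ^ l)%R.
Proof.
  destruct (bp_geom e (5 / 4) ltac:(lra)) as [K1 H1].
  exists (K1 * K)%R; intros mu Hmu.
  assert (H := half_geom _ _ _ (geom_mult _ _ _ _ _ _ H1 Hmu)).
  replace (5 / 4 * (5 / 4) / 2)%R with (25 / 32)%R in H by field; exact H.
Qed.

Lemma pfaff_series_hassum (e : C) (mu : nat -> C) (K : R) :
  (forall l, (Cmod (dif l mu 0) <= K * (5 / 4) ^ l)%R) ->
  hassum (pfaff_series e mu) (tsum (pfaff_series e mu)).
Proof.
  intros Hmu; destruct (pfaff_series_geom e K) as [K' HK'].
  apply tsum_hassum, (ex_hassum_geom _ K' (25 / 32)); [lra|auto].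
Qed.

Lemma pfaff_transform (e : C) (mu : nat -> C) (S0 : C) (K : R) :
  hassum (fun m => (-1) ^ m * (bp e m * mu m)) S0 ->
  (forall l, (Cmod (dif l mu 0) <= K * (5 / 4) ^ l)%R) ->
  S0 = / 2 * npowC 2 (1 - e) * tsum (pfaff_series e mu).
Proof.
  intros HS HK; apply (pfaff_sum e mu S0 _ _ K HS HK); [apply hassum_bp_half|].
  now apply (pfaff_series_hassum e mu K).
Qed.

(** The uniform bound on the differences makes the transformed series dominated, so pointwise
    convergence suffices, even where the untransformed series would not converge in the limit. *)
Lemma pfaff_series_cv (e : C) (muk : nat -> nat -> C) (mu : nat -> C) (K : R) :
  (forall k l, (Cmod (dif l (muk k) 0) <= K * (5 / 4) ^ l)%R) ->
  (forall m, cv (fun k => muk k m) (mu m)) ->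
  cv (fun k => tsum (pfaff_series e (muk k))) (tsum (pfaff_series e mu)).
Proof.
  intros HK Hcv; destruct (pfaff_series_geom e K) as [K' HK'].
  assert (Hd : forall l, cv (fun k => dif l (muk k) 0) (dif l mu 0))
    by (intros l; apply (cv_dif l (fun m k => muk k m)), Hcv).
  apply (hassum_tannery (fun l k => pfaff_series e (muk k) l) (pfaff_series e mu) _ _
           K' (25 / 32)); [lra|auto| | |].
  - intros l; do 2 apply cv_scal; apply Hd.
  - intros k; now apply (pfaff_series_hassum e _ K).
  - apply (pfaff_series_hassum e _ K); intros l.
    apply (cv_Cmod_le _ _ _ (Hd l)); auto.
Qed.

Lemma ex_hassum_abel_fcoef (al c io : C) (x : R) :
  not_pole c -> (0 <= x < 1)%R ->
  exists l, hassum (fun m => (-1) ^ m * (bp (al + 1) m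
               * (RtoC x ^ m * (poch (c + al - io) m / poch c m)))) l.
Proof.
  intros Hc Hx; destruct (ex_pow4_lt_inv x Hx) as [q [Hq Hqx]].
  destruct (bp_geom (al + 1) q Hq) as [K1 H1].
  destruct (poch_ratio_geom (c + al - io) c q Hc Hq) as [K2 H2].
  assert (H := geom_mult _ _ _ _ _ _ H1 H2).
  apply (ex_hassum_geom _ (K1 * K2) (q * q * x)).
  - assert (1 <= q ^ 2)%R by (apply pow_R1_Rle; lra).
    split; [nra|]; apply Rle_lt_trans with (q ^ 4 * x)%R; [|lra].
    apply Rmult_le_compat_r; [lra|nra].
  - intros n; specialize (H n).
    rewrite (Rpow_mult_distr (q * q) x), <- Rmult_assoc.
    replace ((-1) ^ n * (bp (al + 1) n * (RtoC x ^ n * (poch (c + al - io) n / poch c n))))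
      with ((-1) ^ n * RtoC x ^ n * (bp (al + 1) n * (poch (c + al - io) n / poch c n))) by ring.
    rewrite (Cmod_mult ((-1) ^ n * RtoC x ^ n)), (Cmod_mult ((-1) ^ n)), !Cmod_pow, !Cmod_R.
    replace (Rabs (-1)) with 1%R by (rewrite Rabs_left; lra).
    rewrite pow1, Rmult_1_l, (Rabs_pos_eq x), Rmult_comm by lra.
    apply Rmult_le_compat_r; [apply pow_le; lra|exact H].
Qed.

(* Both sides are compared through the Abel means [x = abel_x k] of the double
   series: for [x < 1] everything converges absolutely, so the series may be
   summed along diagonals. *)
Lemma kdf_sum (al be c io S0 : C) :
  be = 2 * c - 2 - al -> not_pole be -> not_pole (al / 2) -> not_pole c ->
  double_series
    (kdf_term [al] [al + be - io] [io - al; 1 + al / 2; (al - be) / 2]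
       [be] [] [al / 2; c] (RtoC (-1)) (RtoC (-1))) S0 ->
  S0 = npowC 2 (- al) * hgF (io - al) (al + 1) c / rGamma c.
Proof.
  intros Hbe Hb Ha Hc [s [Hs HS]].
  set (e := 2 * c - 2 - io).
  (* The factor (e)_0/0! is 1, so row 0 always transmits its convergence. *)
  assert (HQ : hassum (wterm al be c io 0) (s O)).
  { specialize (Hs O); apply is_series_hassum in Hs.
    eapply hassum_ext; [|exact Hs]; intros n; cbv beta.
    rewrite (kdf_term_wterm al be c io 0 n Hbe Hb Ha Hc), bp_0; simpl; ring. }
  set (mu := fun m => tsum (wterm al be c io m)).
  assert (Hmu : forall m, hassum (wterm al be c io m) (mu m)).
  { intros m; apply tsum_hassum, (wterm_ex_hassum _ _ _ _ (s O)); auto. }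
  assert (HS1 : hassum (fun m => (-1) ^ m * (bp e m * mu m)) S0).
  { apply is_series_hassum in HS; eapply hassum_ext; [|exact HS]; intros m.
    specialize (Hs m); apply is_series_hassum in Hs.
    apply (hassum_unique _ _ _ Hs); rewrite Cmult_assoc.
    eapply hassum_ext; [|apply hassum_scal, Hmu]; intros n; cbv beta.
    rewrite (kdf_term_wterm al be c io m n Hbe Hb Ha Hc); unfold e; ring. }
  destruct (wterm_dif_bound al be c io (s O) Hb HQ) as [K HK].
  set (nu := fun k m => tsum (fun n => RtoC (abel_x k) ^ n * wterm al be c io m n)).
  assert (Hnu : forall k m,
     hassum (fun n => RtoC (abel_x k) ^ n * wterm al be c io m n) (nu k m)).
  { intros k m; apply tsum_hassum; assert (Hx := abel_x_bounds k).
    destruct (abel_test (wterm al be c io m) (fun n => RtoC (abel_x k) ^ n) (mu m) 1)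
      as [l Hl]; [apply Hmu|intros; apply rsum_pow_variation; lra|].
    exists l; eapply hassum_ext; [|exact Hl]; intros n; cbv beta; ring. }
  set (muk := fun k m => RtoC (abel_x k) ^ m * nu k m).
  set (rk := fun k m => RtoC (abel_x k) ^ m * (poch (c + al - io) m / poch c m)).
  set (r := fun m => poch (c + al - io) m / poch c m).
  assert (Hr : exists K2, forall l, (Cmod (dif l r 0) <= K2 * (5 / 4) ^ l)%R).
  { destruct (poch_ratio_geom (io - al) c (5 / 4) Hc ltac:(lra)) as [K2 H2].
    exists K2; intros l; unfold r; rewrite dif_poch_ratio by exact Hc.
    replace (c - (c + al - io)) with (io - al) by ring.
    rewrite Nat.add_0_l; simpl poch; rewrite Cmult_1_l; apply H2. }
  destruct Hr as [K2 HK2].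
  assert (Hmuk : forall k l, (Cmod (dif l (muk k) 0) <= K * (5 / 4) ^ l)%R).
  { intros k; apply HK; [assert (Hx := abel_x_bounds k); lra|apply Hnu]. }
  assert (Hrk : forall k l, (Cmod (dif l (rk k) 0) <= K2 * (5 / 4) ^ l)%R).
  { intros k l; apply (Cmod_dif_pow_le r); [|lra|exact HK2].
    assert (Hx := abel_x_bounds k); lra. }
  (* For x < 1 the diagonal sums identify both Abel means; each is then written in its transformed
     form, the only one that survives x tending to 1. *)
  assert (Hkey : forall k,
    / 2 * npowC 2 (1 - e) * tsum (pfaff_series e (muk k))
    = (1 + RtoC (abel_x k))
      * (/ 2 * npowC 2 (1 - (al + 1)) * tsum (pfaff_series (al + 1) (rk k)))).
  { intros k; assert (Hx := abel_x_bounds k); set (x := abel_x k) in *.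
    destruct (wterm_geom al be c io x Hb Ha Hc Hx) as [K3 [q [Hq H3]]]; fold e in H3.
    set (u := fun m n => RtoC x ^ (m + n) * ((-1) ^ m * (bp e m * wterm al be c io m n))).
    assert (Hu : forall m n, (Cmod (u m n) <= K3 * q ^ (m + n))%R).
    { intros m n; eapply Rle_trans; [|apply H3]; apply Req_le; unfold u.
      rewrite !Cmod_mult, (Cmod_pow (-1)), Cmod_R.
      replace (Rabs (-1)) with 1%R by (rewrite Rabs_left; lra); rewrite pow1; ring. }
    assert (Hum : forall m, hassum (u m) ((-1) ^ m * (bp e m * muk k m))).
    { intros m; unfold muk; fold x.
      replace ((-1) ^ m * (bp e m * (RtoC x ^ m * nu k m)))
        with ((-1) ^ m * bp e m * RtoC x ^ m * nu k m) by ring.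
      eapply hassum_ext; [|apply hassum_scal, Hnu]; intros n; cbv beta; unfold u; fold x.
      rewrite Cpow_add_r; ring. }
    assert (HT : exists T, hassum (fun m => (-1) ^ m * (bp e m * muk k m)) T).
    { apply (ex_hassum_geom _ (K3 / (1 - q)) q Hq); intros m.
      (* The tail estimate at index 0 bounds the whole row sum by a multiple of q^m. *)
      assert (G := hassum_tail_geom (u m) _ (K3 * q ^ m) q 0 Hq
        ltac:(intros n; rewrite Rmult_assoc, <- pow_add; apply Hu) (Hum m)).
      simpl in G; rewrite <- Cmod_opp.
      replace (- ((-1) ^ m * (bp e m * muk k m)))
        with (0 - (-1) ^ m * (bp e m * muk k m)) by ring.
      eapply Rle_trans; [exact G|]; apply Req_le; field; lra. }
    destruct HT as [T HT].
    rewrite <- (pfaff_transform e (muk k) T K HT (Hmuk k)).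
    destruct (ex_hassum_abel_fcoef al c io x Hc Hx) as [T2 HT2].
    rewrite <- (pfaff_transform (al + 1) (rk k) T2 K2 HT2 (Hrk k)).
    assert (HD := hassum_diagonal u _ T K3 q Hq Hu Hum HT).
    apply (hassum_unique _ _ _ HD).
    set (F := fun N => (-1) ^ N * (bp (al + 1) N
                * (RtoC x ^ N * (poch (c + al - io) N / poch c N)))) in HT2.
    (* The polynomial 1 - z at z = -x gives the factor 1 + x: the series plus x times its shift. *)
    assert (HF : hassum (fun N => match N with O => RtoC 0 | S j => RtoC x * F j end)
                   (0 + RtoC x * T2)).
    { apply (hassum_shift (fun N => match N with O => RtoC 0 | S j => RtoC x * F j end)).
      apply hassum_scal, HT2. }
    replace ((1 + RtoC x) * T2) with (T2 + (0 + RtoC x * T2)) by ring.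
    eapply hassum_ext; [|apply hassum_plus; [exact HT2|exact HF]].
    intros N; cbv beta.
    rewrite (csum_ext _ (fun m => RtoC x ^ N
       * ((-1) ^ m * (bp e m * wterm al be c io m (N - m))))).
    - rewrite csum_scal; unfold e; rewrite (diagonal_sum al be c io N Hbe Hb Ha Hc).
      unfold F, fcoef; destruct N as [|j]; simpl Cpow; ring.
    - intros m Hm; unfold u; replace (m + (N - m))%nat with N by lia; reflexivity. }
  assert (L1 := pfaff_series_cv e muk mu K Hmuk).
  assert (L2 := pfaff_series_cv (al + 1) rk r K2 Hrk).
  assert (C1 : forall m, cv (fun k => muk k m) (mu m)).
  { intros m; apply (cv_eq _ (1 * mu m)); [ring|]; apply cv_mult; [apply cv_abel_x|].
    apply (abel_limit (wterm al be c io m)); [apply Hmu|intros k; apply Hnu]. }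
  assert (C2 : forall m, cv (fun k => rk k m) (r m)).
  { intros m; apply (cv_eq _ (1 * r m)); [ring|]; apply cv_mult; [apply cv_abel_x|].
    apply cv_const. }
  specialize (L1 C1); specialize (L2 C2).
  (* The case x = 1 of the uniform bound, which lets Pfaff's transformation act on the original
     iterated sum. *)
  assert (Kmu : forall l, (Cmod (dif l mu 0) <= K * (5 / 4) ^ l)%R).
  { intros l.
    rewrite (dif_ext l mu (fun m => RtoC 1 ^ m * mu m)) by (intros; rewrite Cpow_1_l; ring).
    apply HK; [lra|]; intros m; eapply hassum_ext; [|apply Hmu].
    intros n; rewrite Cpow_1_l; ring. }
  rewrite (pfaff_transform e mu S0 K HS1 Kmu).
  assert (R1 := cv_scal (/ 2 * npowC 2 (1 - e)) _ _ L1).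
  assert (R2 : cv (fun k => (1 + RtoC (abel_x k))
      * (/ 2 * npowC 2 (1 - (al + 1)) * tsum (pfaff_series (al + 1) (rk k))))
      ((1 + 1) * (/ 2 * npowC 2 (1 - (al + 1)) * tsum (pfaff_series (al + 1) r)))).
  { apply cv_mult; [|apply cv_scal, L2].
    apply cv_plus; [apply cv_const|].
    eapply cv_ext; [|apply (cv_abel_x 1)]; intros k; simpl; ring. }
  apply (cv_ext _ _ _ Hkey) in R1.
  rewrite (cv_unique _ _ _ R1 R2).
  assert (Hg := rGamma_neq_0 c Hc).
  replace (tsum (pfaff_series (al + 1) r)) with (/ rGamma c * hgF (io - al) (al + 1) c).
  - replace (1 - (al + 1)) with (- al) by ring; field; exact Hg.
  - apply (hassum_unique (pfaff_series (al + 1) r)).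
    + eapply hassum_ext; [|apply hassum_scal, hgF_hassum]; intros n; cbv beta.
      unfold pfaff_series, hgF_term, r; rewrite dif_poch_ratio by exact Hc.
      replace (c - (c + al - io)) with (io - al) by ring.
      rewrite (rGamma_poch c n), Nat.add_0_l; unfold bp; simpl (poch _ 0).
      field; repeat split;
        auto using INR_fact_C_neq_0, poch_neq_0, rGamma_neq_0, not_pole_add.
    + now apply (pfaff_series_hassum _ _ K2).
Qed.

(** * Assembly of the two identities *)

Lemma npowC_2_INR (n : nat) : npowC 2 (RtoC (INR n)) = 2 ^ n.
Proof.
  induction n as [|n IH]; [apply npowC_0|].
  rewrite INR_S_C, npowC_add, IH, npowC_1 by lia; simpl Cpow.
  replace (INR 2) with 2%R by (simpl; ring); ring.
Qed.

(** The symbol (a)_r turns 1/Gamma(a + r) into 1/Gamma(a), so the prefactor no longer depends on r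
    and leaves the binomial sum. *)
Lemma poch_hgF_bailey (a b z w : C) (r : nat) :
  not_pole z -> not_pole w -> z = (a + RtoC (INR r)) / 2 -> w = z - b + 1 ->
  poch a r * hgF (1 - b) b (1 + a - b + RtoC (INR r))
  = npowC 2 (b - 1) * rGamma a * (CGamma z / CGamma w).
Proof.
  intros Nz Nw Hz Hw.
  replace (1 + a - b + RtoC (INR r)) with (1 + (a + RtoC (INR r)) - b) by ring.
  rewrite hgF_bailey by (rewrite <- Hz; exact Nz).
  rewrite <- Hz, <- Hw, (rGamma_poch a r), (CGamma_inv w Nw).
  field; now apply rGamma_neq_0.
Qed.

Theorem theorem5 (i : nat) (alpha beta : C) :
  (* first identity *)
  (forall S : C,
     not_pole beta -> not_pole (alpha / 2) ->
     not_pole (1 + (alpha + beta) / 2) ->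
     not_pole (- alpha) -> not_pole (RtoC (INR i) - alpha) ->
     not_pole (beta / 2 + 3 * alpha / 2 - RtoC (INR i) + 1) ->
     (forall r : nat, (r <= i)%nat ->
        not_pole (beta / 4 + 3 * alpha / 4 + RtoC ((INR r + 1 - INR i) / 2)) /\
        not_pole (beta / 4 - alpha / 4 + RtoC ((INR r + 1 - INR i) / 2))) ->
     double_series
       (kdf_term [alpha] [alpha + beta - RtoC (INR i)]
                 [RtoC (INR i) - alpha; 1 + alpha / 2; (alpha - beta) / 2]
                 [beta] [] [alpha / 2; 1 + (alpha + beta) / 2]
                 (RtoC (-1)) (RtoC (-1))) S ->
     S = CGamma (- alpha) * CGamma (1 + (alpha + beta) / 2)
         / (CGamma (RtoC (INR i) - alpha)
            * CGamma (beta / 2 + 3 * alpha / 2 - RtoC (INR i) + 1))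
         * sum_n (fun r => RtoC ((-1) ^ r) * binomC i r
               * CGamma (beta / 4 + 3 * alpha / 4 + RtoC ((INR r + 1 - INR i) / 2))
               / CGamma (beta / 4 - alpha / 4 + RtoC ((INR r + 1 - INR i) / 2))) i)
  /\
  (* second identity *)
  (forall S : C,
     not_pole beta -> not_pole (alpha / 2) ->
     not_pole (1 + (alpha + beta) / 2) ->
     not_pole (beta / 2 + 3 * alpha / 2 + RtoC (INR i) + 1) ->
     (forall r : nat, (r <= i)%nat ->
        not_pole (beta / 4 + 3 * alpha / 4 + RtoC ((INR r + 1 + INR i) / 2)) /\
        not_pole (beta / 4 - alpha / 4 + RtoC ((INR r + 1 - INR i) / 2))) ->
     double_series
       (kdf_term [alpha] [alpha + beta + RtoC (INR i)]
                 [- alpha - RtoC (INR i); 1 + alpha / 2; (alpha - beta) / 2]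
                 [beta] [] [alpha / 2; 1 + (alpha + beta) / 2]
                 (RtoC (-1)) (RtoC (-1))) S ->
     S = CGamma (1 + (alpha + beta) / 2)
         / CGamma (beta / 2 + 3 * alpha / 2 + RtoC (INR i) + 1)
         * sum_n (fun r => binomC i r
               * CGamma (beta / 4 + 3 * alpha / 4 + RtoC ((INR r + 1 + INR i) / 2))
               / CGamma (beta / 4 - alpha / 4 + RtoC ((INR r + 1 - INR i) / 2))) i).
Proof.
  set (c := 1 + (alpha + beta) / 2).
  assert (Hbe : beta = 2 * c - 2 - alpha) by (unfold c; field; apply C2_neq_0).
  assert (H2 : (2 <> 0)%R) by lra.
  split; intros S Hb Ha Hc.
  - intros Hna Hia HA HG HS.
    rewrite (kdf_sum alpha beta c (RtoC (INR i)) S Hbe Hb Ha Hc HS).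
    set (a := beta / 2 + 3 * alpha / 2 - RtoC (INR i) + 1) in *.
    assert (Ea : a = c + alpha - RtoC (INR i)) by (unfold a, c; field; apply C2_neq_0).
    (* With b = alpha + 1 the start -alpha is 1 - b: raising it i times to i - alpha expresses the
       value through Bailey series. *)
    assert (E := hgF_numerator_iter i (- alpha) (alpha + 1) (c - RtoC (INR i))).
    replace (- alpha + RtoC (INR i)) with (RtoC (INR i) - alpha) in E by ring.
    replace (c - RtoC (INR i) + RtoC (INR i)) with c in E by ring.
    replace (c - RtoC (INR i) - - alpha) with a in E by (rewrite Ea; ring).
    rewrite sum_n_csum.
    set (Z := fun r => CGamma (beta / 4 + 3 * alpha / 4 + RtoC ((INR r + 1 - INR i) / 2))
               / CGamma (beta / 4 - alpha / 4 + RtoC ((INR r + 1 - INR i) / 2))).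
    rewrite (bs_ext i _ (fun r => npowC 2 alpha * rGamma a * ((-1) ^ r * Z r))) in E.
    2:{ intros r Hr; destruct (HG r Hr) as [N1 N2].
        replace (- alpha) with (1 - (alpha + 1)) by ring.
        replace (c - RtoC (INR i)) with (1 + a - (alpha + 1)) by (rewrite Ea; ring).
        rewrite (poch_hgF_bailey a (alpha + 1) _ _ r N1 N2).
        - fold (Z r); replace (alpha + 1 - 1) with alpha by ring; ring.
        - rewrite RtoC_div, RtoC_minus, RtoC_plus by exact H2; unfold a; field.
        - field. }
    rewrite bs_scal, bs_csum in E.
    rewrite (csum_ext (fun r => RtoC ((-1) ^ r) * binomC i r
               * CGamma (beta / 4 + 3 * alpha / 4 + RtoC ((INR r + 1 - INR i) / 2))
               / CGamma (beta / 4 - alpha / 4 + RtoC ((INR r + 1 - INR i) / 2)))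
               (fun r => binomC i r * ((-1) ^ r * Z r))).
    2:{ intros r _; unfold Z; rewrite RtoC_pow; unfold Cdiv; ring. }
    set (W := csum (fun r => binomC i r * ((-1) ^ r * Z r)) (Datatypes.S i)) in *.
    assert (Hp := poch_neq_0 (- alpha) i Hna).
    rewrite !CGamma_inv by assumption.
    (* Gamma(-alpha)/Gamma(i - alpha) is 1/(-alpha)_i, the symbol left over by the iteration. *)
    rewrite (rGamma_poch (- alpha) i).
    replace (- alpha + RtoC (INR i)) with (RtoC (INR i) - alpha) by ring.
    rewrite npowC_opp.
    replace (hgF (RtoC (INR i) - alpha) (alpha + 1) c)
      with (npowC 2 alpha * rGamma a * W / poch (- alpha) i)
      by (rewrite <- E; field; exact Hp).
    field; repeat split; auto using rGamma_neq_0, npowC_neq_0.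
  - intros HA HG HS.
    replace (alpha + beta + RtoC (INR i)) with (alpha + beta - - RtoC (INR i)) in HS by ring.
    replace (- alpha - RtoC (INR i)) with (- RtoC (INR i) - alpha) in HS by ring.
    rewrite (kdf_sum alpha beta c (- RtoC (INR i)) S Hbe Hb Ha Hc HS).
    set (a := beta / 2 + 3 * alpha / 2 + RtoC (INR i) + 1) in *.
    assert (Ea : a = c + alpha + RtoC (INR i)) by (unfold a, c; field; apply C2_neq_0).
    (* Here p = -i - alpha stays fixed and b is raised from alpha + 1 to alpha + 1 + i = 1 - p. *)
    assert (E := hgF_doubling_iter i (- RtoC (INR i) - alpha) (alpha + 1) c).
    replace (c - (- RtoC (INR i) - alpha)) with a in E by (rewrite Ea; ring).
    rewrite sum_n_csum.
    set (Z := fun r => CGamma (beta / 4 + 3 * alpha / 4 + RtoC ((INR r + 1 + INR i) / 2))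
               / CGamma (beta / 4 - alpha / 4 + RtoC ((INR r + 1 - INR i) / 2))).
    rewrite (bs_ext i _ (fun r => npowC 2 (alpha + RtoC (INR i)) * rGamma a * Z r)) in E.
    2:{ intros r Hr; destruct (HG r Hr) as [N1 N2].
        set (b := alpha + 1 + RtoC (INR i)).
        replace (- RtoC (INR i) - alpha) with (1 - b) by (unfold b; ring).
        replace (c + RtoC (INR r)) with (1 + a - b + RtoC (INR r))
          by (rewrite Ea; unfold b; ring).
        rewrite (poch_hgF_bailey a b _ _ r N1 N2).
        - fold (Z r); replace (b - 1) with (alpha + RtoC (INR i)) by (unfold b; ring); ring.
        - rewrite RtoC_div, !RtoC_plus by exact H2; unfold a; field.
        - rewrite !RtoC_div, RtoC_minus, !RtoC_plus by exact H2; unfold b; field. }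
    (* Bailey's prefactor 2^(alpha + i) splits off exactly the 2^i produced by the doublings. *)
    rewrite bs_scal, bs_csum, npowC_add, npowC_2_INR in E.
    rewrite (csum_ext (fun r => binomC i r
               * CGamma (beta / 4 + 3 * alpha / 4 + RtoC ((INR r + 1 + INR i) / 2))
               / CGamma (beta / 4 - alpha / 4 + RtoC ((INR r + 1 - INR i) / 2)))
               (fun r => binomC i r * Z r)).
    2:{ intros r _; unfold Z, Cdiv; ring. }
    set (W := csum (fun r => binomC i r * Z r) (Datatypes.S i)) in *.
    assert (Hp : 2 ^ i <> 0) by apply Cpow_nz, C2_neq_0.
    rewrite !CGamma_inv by assumption.
    rewrite npowC_opp.
    replace (hgF (- RtoC (INR i) - alpha) (alpha + 1) c)
      with (npowC 2 alpha * rGamma a * W)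
      by (transitivity (2 ^ i * hgF (- RtoC (INR i) - alpha) (alpha + 1) c / 2 ^ i);
          [rewrite E|]; field; exact Hp).
    field; repeat split; auto using rGamma_neq_0, npowC_neq_0.
Qed.
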